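(* Let $p_1,\dots,p_k,q_1,\dots,q_k\in\mathbb{S}^2$ and let $r_1,\dots,r_k>0$. Assume that $d(q_i,q_j)\le d(p_i,p_j)$ for all $i,j\in\{1,\dots,k\}$, and that the intersection $\bigcap_{i=1}^k B_{p_i}(r_i)$ is connected. Then $$\mathrm{Area}\Big(\bigcap_{i=1}^k B_{q_i}(r_i)\Big)\ge \mathrm{Area}\Big(\bigcap_{i=1}^k B_{p_i}(r_i)\Big).$$
   Context: $\mathbb{S}^2$ is the 2-dimensional sphere with its intrinsic (geodesic) distance $d$. For $p\in\mathbb{S}^2$ and $r>0$, $B_p(r)=\{x\in \mathbb{S}^2: d(p,x)\le r\}$ is the closed disk of radius $r$ centered at $p$. The radii $r_i$ need not be equal. *)

(* Defs.v *)
From mathcomp Require Import all_boot all_order all_algebra.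
From mathcomp Require Import all_classical all_reals all_analysis.
Import Order.TTheory GRing.Theory Num.Theory.
Import numFieldNormedType.Exports.

Set Implicit Arguments.
Unset Strict Implicit.
Unset Printing Implicit Defensive.

Local Open Scope classical_set_scope.
Local Open Scope ring_scope.

Definition dot (R : realType) (x y : 'rV[R]_3) : R := \sum_(i < 3) x 0 i * y 0 i.

(* The Euclidean unit sphere; the norm `|x| of 'rV[R]_3 in the library is the
   sup norm, so it cannot be used here.  The topology of 'rV[R]_3 is the usual
   one. *)
Definition sphere2 (R : realType) : set 'rV[R]_3 := [set x | dot x x = 1].
Arguments sphere2 : clear implicits.

(* Length of the shorter great-circle arc, i.e. the angle in [0, pi] between two
   unit vectors; only meaningful for points of sphere2, where dot x y lies in
   [-1, 1]. *)
Definition geodesic_dist (R : realType) (x y : 'rV[R]_3) : R := acos (dot x y).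

Definition disk (R : realType) (p : 'rV[R]_3) (r : R) : set 'rV[R]_3 :=
  [set x | sphere2 R x /\ geodesic_dist p x <= r].

(* A finite intersection of subsets of the sphere; the empty one is the whole
   sphere rather than the whole ambient space. *)
Definition disk_intersection (R : realType) (k : nat)
    (p : 'I_k -> 'rV[R]_3) (r : 'I_k -> R) : set 'rV[R]_3 :=
  sphere2 R `&` \bigcap_(i in [set: 'I_k]) disk (p i) (r i).

(* u.1 is the colatitude and u.2 the longitude. *)
Definition spherical_coord (R : realType) (u : R * R) : 'rV[R]_3 :=
  \row_(i < 3) [:: sin u.1 * cos u.2; sin u.1 * sin u.2; cos u.1]`_i.

Definition coord_domain (R : realType) : set (R * R) :=
  [set u | 0 <= u.1 <= pi /\ 0 <= u.2 < 2 * pi].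
Arguments coord_domain : clear implicits.

(* Surface area: spherical_coord maps coord_domain onto sphere2, injectively
   away from the poles, and its area element (the norm of the cross product of
   the two partial derivatives) is sin u.1. *)
Definition area (R : realType) (A : set 'rV[R]_3) : \bar R :=
  (\int[lebesgue_measure \x lebesgue_measure]_(u in
     coord_domain R `&` (@spherical_coord R) @^-1` A) (sin u.1)%:E)%E.

(* Main.v *)
(* The complement of a disk is a cap {<a, z> > c}, so the theorem says: if unit vectors
   a_i are replaced by b_i with <a_i, a_j> <= <b_i, b_j>, and the common complement C of
   the caps around the a_i is connected, then the area of the union of caps does not
   increase. For two caps this is two-point symmetrization, and in general one inducts on
   the number of caps. Call an affine functional f inner when f <= 0 on C, and link two
   caps when they meet inside {f <= 0}. If C does not lie in a plane, then among three or
   more caps either one is disjoint from all the others, or some inner f leaves three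
   caps in different link classes. In the latter case the cap m = {f > 0} is added to each
   link class: by Kirszbraun's theorem for the sphere m has a partner among the caps
   around the b_i, each class together with m has again a connected complement and fewer
   members than the original family, and outside m the classes are disjoint.

   The functional f is the spherical analogue of a maximal disk centred on the medial
   axis. A smallest cap containing C touches C in two points u, v; rotating its boundary
   plane about the line uv in both directions until it touches C at a third point, one
   either meets a circle with three contacts, which separates three arcs of caps, or both
   extreme planes bound caps i, j of the family. The latter caps are never linked in
   between, because a chain of caps linking them would separate u from v in C; hence a
   third cap k is linked to i at one end, to j at the other, and by openness of linkage to
   neither of them somewhere in between. *)
From HB Require Import structures.
Require Import Defs.
From mathcomp Require Import all_boot all_order all_algebra.
From mathcomp Require Import all_classical all_reals all_analysis.
From mathcomp Require Import measurable_realfun measurable_fun_approximation.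
From mathcomp Require Import ring lra.
Import Order.TTheory GRing.Theory Num.Theory.
Import numFieldNormedType.Exports.
Set Implicit Arguments.
Unset Strict Implicit.
Unset Printing Implicit Defensive.
Local Open Scope classical_set_scope.
Local Open Scope ring_scope.

(** * Change of variables *)

(** Area is given in spherical coordinates with a fixed axis, while symmetrization needs every
    reflection. Exchanging the axis with a horizontal one preserves area because projecting the
    sphere to a disc gives an area element symmetric in both coordinates; conjugation yields the
    other reflections.

    A parity count does the work of the Jordan curve theorem in showing that a chain of caps
    separates u from v. Stereographic projection from u makes caps avoiding u convex, so a chain
    becomes a polygonal path. The parity of its edges below a point is locally constant off the path
    as long as the ends of the path are not below that point; here the ends lie on the line f = 0,
    and no point of the core is above it.

    In the rotation about uv, both f and the added term g vanish at u and v, so compactness alone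
    leaves no room for a further turn. Near such a contact the room comes from a cap that has u on
    its boundary and contains points of the circle arbitrarily close to u.

    The partner of m must be a unit vector. Minimisation gives a point of the ball, which can be
    pushed to the sphere unless the b_i positively span space; then all Gram entries agree. *)

Section transfer_density.
Local Open Scope ereal_scope.
Context d1 d2 (X : measurableType d1) (Y : measurableType d2) (R : realType).
Variables (phi : X -> Y) (mphi : measurable_fun setT phi).
Variables (mu : {measure set X -> \bar R}) (nu : {measure set Y -> \bar R}).
Variables (w : X -> R) (mw : measurable_fun setT w).
Hypothesis w0 : forall x, (0 <= w x)%R.
Hypothesis nuE : forall A, measurable A ->
  nu A = \int[mu]_x (w x * \1_A (phi x))%:E.

Import HBNNSimple.

(** Monotone convergence along simple approximations of [f] reduces the formula to level sets, where
    it is [nuE]. *)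
Lemma ge0_integral_transfer_density (f : Y -> \bar R) :
  measurable_fun setT f -> (forall y, 0 <= f y) ->
  \int[nu]_y f y = \int[mu]_x ((w x)%:E * f (phi x)).
Proof.
move=> mf f0.
pose f_ := nnsfun_approx measurableT mf.
have mwE : measurable_fun setT (EFin \o w) by exact/measurable_EFinP.
transitivity (limn (fun n => \int[nu]_x (f_ n x)%:E)).
  rewrite -monotone_convergence//.
  - apply: eq_integral => y _; apply/esym/cvg_lim => //.
    exact: cvg_nnsfun_approx.
  - by move=> n; exact/measurable_EFinP/measurable_funP.
  - by move=> n y _; rewrite lee_fin.
  - by move=> y _ m n mn; rewrite lee_fin; exact/lefP/nd_nnsfun_approx.
rewrite [X in limn X](_ : _ =
    (fun n => \int[mu]_x ((w x)%:E * (f_ n (phi x))%:E))).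
  rewrite -monotone_convergence//; last 3 first.
    - move=> n /=; apply: emeasurable_funM => //.
      by apply/measurable_EFinP; exact: measurableT_comp.
    - by move=> n x _ /=; rewrite mule_ge0// lee_fin.
    - move=> x _ m n mn; rewrite lee_wpmul2l ?lee_fin//.
      exact/lefP/nd_nnsfun_approx.
  apply: eq_integral => x _ /=; apply/cvg_lim => //.
  by apply: cvgeZl => //; exact: cvg_nnsfun_approx.
apply/funext => n.
have mfn r : measurable (f_ n @^-1` [set r]) by exact: measurable_funPTI.
transitivity (\sum_(k \in range (f_ n))
    \int[nu]_y (k * \1_(f_ n @^-1` [set k]) y)%:E).
  under eq_integral do rewrite fimfunE -fsumEFin//.
  rewrite ge0_integral_fsum//.
  - by move=> r; exact/measurable_EFinP/measurable_funM.
  - by move=> r x _; rewrite nnfun_muleindic_ge0.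
transitivity (\sum_(k \in range (f_ n))
    \int[mu]_x ((w x)%:E * (k * \1_(f_ n @^-1` [set k]) (phi x))%:E)).
  apply: eq_fsbigr => r; rewrite inE => -[z _ zr].
  have r0 : (0 <= r)%R by rewrite -zr.
  rewrite integralZl_indic_nnsfun// integral_indic// setIT nuE//.
  under [RHS]eq_integral do rewrite -EFinM mulrCA EFinM.
  rewrite ge0_integralZl_EFin//.
  - by move=> x _; rewrite lee_fin mulr_ge0.
  - apply/measurable_EFinP/measurable_funM => //.
    by apply: measurableT_comp.
rewrite -ge0_integral_fsum//.
- apply: eq_integral => x _; rewrite [in RHS]fimfunE -fsumEFin//.
  rewrite ge0_mule_fsumr// => r; rewrite EFinM; exact: nnfun_muleindic_ge0.
- move=> r; apply: emeasurable_funM => //.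
  apply/measurable_EFinP/measurable_funM => //.
  by apply: measurableT_comp.
- move=> r x _; apply: mule_ge0; first by rewrite lee_fin.
  by rewrite EFinM; apply: nnfun_muleindic_ge0.
Qed.

End transfer_density.

Section weighted_pushforward.
Local Open Scope ereal_scope.
Context d1 d2 (X : measurableType d1) (Y : measurableType d2) (R : realType).
Variables (mu : {measure set X -> \bar R}).
Variables (phi : X -> Y) (mphi : measurable_fun setT phi).
Variables (w : X -> R) (mw : measurable_fun setT w).
Hypothesis w0 : forall x, (0 <= w x)%R.

(** Packaging the weighted set function as a measure makes it comparable with Lebesgue measure by
    uniqueness, which gives the substitution rule for all nonnegative measurable functions at
    once. *)
Lemma weighted_pushforward_exists : exists nu : {measure set Y -> \bar R},
  forall A, nu A = \int[mu]_x (w x * \1_A (phi x))%:E.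
Proof.
pose f A := \int[mu]_x (w x * \1_A (phi x))%:E.
have f0 : f set0 = 0.
  by rewrite /f integral0_eq// => x _; rewrite indic0 mulr0.
have fge0 A : 0 <= f A.
  by apply: integral_ge0 => x _; rewrite lee_fin mulr_ge0.
have fE A : f A = \int[mu]_(x in phi @^-1` A) (w x)%:E.
  rewrite [RHS]integral_mkcond; apply: eq_integral => x _.
  rewrite patchE indicE.
  have -> : (x \in phi @^-1` A) = (phi x \in A) by apply/idP/idP; rewrite !inE.
  by case: ifPn => _; rewrite ?mulr1 ?mulr0.
have fadd : semi_sigma_additive f.
  move=> F mF tF mUF; rewrite fE.
  under eq_fun do under eq_bigr do rewrite fE.
  rewrite preimage_bigcup.
  have := @semi_sigma_additive_nng_induced _ _ _ mu (EFin \o w).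
  apply => //.
  - exact/measurable_EFinP.
  - by move=> n; rewrite -[X in measurable X]setTI; exact: mphi.
  - apply/trivIsetP => i j _ _ ij; rewrite -preimage_setI.
    by move/trivIsetP : tF => /(_ i j I I ij) ->; rewrite preimage_set0.
  - rewrite -preimage_bigcup -[X in measurable X]setTI; exact: mphi.
pose mix := isMeasure.Build _ _ _ f f0 fge0 fadd.
pose nu : {measure set Y -> \bar R} := HB.pack f mix.
by exists nu.
Qed.

End weighted_pushforward.

Section cos_substitution.
Local Open Scope ereal_scope.
Context (R : realType).
Notation mu := (@lebesgue_measure R).
Variables (s : R) (s0 : (0 < s)%R).
Let w (t : R) : R := (s * sin t * \1_(`[0%R, pi] : set R) t)%R.
Let phi (t : R) : R := (s * cos t)%R.

Let w0 t : (0 <= w t)%R.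
Proof.
rewrite /w indicE; case: (boolP (t \in _)); rewrite ?mulr0//= mulr1 inE/= in_itv/=.
by move=> tp; rewrite mulr_ge0 ?sin_ge0_pi// ltW.
Qed.

Let mw : measurable_fun setT w.
Proof.
apply: measurable_funM => //; apply: measurable_funM => //.
by apply: continuous_measurable_fun => x; exact: continuous_sin.
Qed.

Let mphi : measurable_fun setT phi.
Proof.
apply: measurable_funM => //.
by apply: continuous_measurable_fun => x; exact: continuous_cos.
Qed.

Let int_sin (b : R) : (0 < b)%R -> \int[mu]_(t in `[0%R, b]) (s * sin t)%:E = (s - s * cos b)%:E.
Proof.
move=> b0.
have dF x : is_derive x (1%R:R) (fun t : R => - (s * cos t))%R (s * sin x)%R.
  by apply: trigger_derive; rewrite /GRing.scale/= ; ring.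
have cF : continuous (fun t : R => - (s * cos t))%R.
  by move=> x; apply/differentiable_continuous/derivable1_diffP.
rewrite (@continuous_FTC2 _ _ (fun t => - (s * cos t))%R) ?cos0//.
- by rewrite -EFinB; congr (_%:E); ring.
- apply: continuous_subspaceT => x; apply: cvgM; first exact: cvg_cst.
  exact: continuous_sin.
- split => //.
  + by apply: cvg_at_right_filter; exact: cF.
  + by apply: cvg_at_left_filter; exact: cF.
- by move=> x _; rewrite derive1E derive_val.
Qed.

(** On [0, pi] the condition a < s cos t cuts out an initial interval, up to [acos (a / s)] or, for
    a < -s, all of [0, pi]; a primitive of s sin t is - s cos t. *)
Let int_tail (a : R) : \int[mu]_t (w t * \1_(`]a, +oo[ : set R) (phi t))%:E =
  mu (`]a, +oo[ `&` `[(- s)%R, s]).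
Proof.
have [sa|lt_as] := leP s a.
  rewrite (_ : `]a, +oo[ `&` `[(- s)%R, s] = set0) ?measure0; last first.
    by apply/seteqP; split => // x /=; rewrite !in_itv/=; lra.
  rewrite integral0_eq// => t _; rewrite indicE memNset ?mulr0//=.
  rewrite in_itv/= andbT /phi => ast; have := cos_le1 t.
  by move/(ler_wpM2l (ltW s0)); lra.
have E1 : \int[mu]_t (w t * \1_(`]a, +oo[ : set R) (phi t))%:E =
    \int[mu]_(t in [set t | (0 <= t <= pi)%R /\ (a < s * cos t)%R]) (s * sin t)%:E.
  rewrite [RHS]integral_mkcond; apply: eq_integral => x _.
  rewrite patchE /w !indicE; case: ifPn.
    rewrite inE /= => -[xp ax]; rewrite !mem_set ?mulr1//= in_itv/= ?xp//.
    by rewrite ax.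
  move=> /negP xn; congr (_%:E); apply/eqP; rewrite mulf_eq0.
  case: (boolP (x \in _)) => xp; last by rewrite mulr0 eqxx.
  rewrite mulr1; case: (boolP (phi x \in _)) => xa; last by rewrite eqxx orbT.
  by exfalso; apply: xn; move: xp xa; rewrite !inE /= !in_itv/= andbT.
have {E1} -> : \int[mu]_t (w t * \1_(`]a, +oo[ : set R) (phi t))%:E =
  (s - Num.max a (- s))%:E.
  rewrite E1; have [aNs|aNs] := ltP a (- s)%R.
    rewrite (_ : [set t | _] = `[0%R, pi]%classic); last first.
      apply/seteqP; split => x /=; rewrite in_itv/=; first by case.
      move=> xp.
      split; first exact: xp.
      apply: (lt_le_trans aNs).
      by have := ler_wpM2l (ltW s0) (cos_geN1 x); rewrite mulrN1.
    by rewrite int_sin ?pi_gt0// cospi; congr (_%:E); ring.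
  have as1 : (-1 <= a / s < 1)%R.
    by rewrite ler_pdivlMr// ltr_pdivrMr// mul1r mulN1r aNs lt_as.
  have as2 : (-1 <= a / s <= 1)%R by move: as1; lra.
  have lt_acos x : (0 <= x <= pi)%R -> (x < acos (a / s))%R = (a < s * cos x)%R.
    move=> xp; rewrite -[LHS]ltr_cos ?in_itv/= ?acos_ge0 ?acos_lepi//.
    by rewrite acosK ?in_itv//= ltr_pdivrMr// mulrC.
  rewrite (_ : [set t | _] = `[0%R, (acos (a / s))[%classic); last first.
    apply/seteqP; split => x /=; rewrite in_itv/=.
      by move=> [xp ax]; rewrite lt_acos// ax andbT; case/andP : xp.
    move=> /andP[x0 xp].
    have xpi : (0 <= x <= pi)%R by rewrite x0 (le_trans (ltW xp))// acos_lepi.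
    by split => //; rewrite -lt_acos.
  rewrite integral_itv_bndo_bndc; last first.
    apply/measurable_EFinP/measurable_funM => //.
    apply: measurable_funTS.
    by apply: continuous_measurable_fun => x; exact: continuous_sin.
  rewrite int_sin ?acos_gt0// acosK ?in_itv//=.
  by rewrite (mulrC s) divfK ?gt_eqF.
have -> : `]a, +oo[ `&` `[(- s)%R, s] =
    if (a < - s)%R then `[(- s)%R, s]%classic else `]a, s]%classic.
  apply/seteqP; split => x /=; case: ltP => h /=; rewrite !in_itv/= ?andbT => H;
    do ?[split|apply/andP; split]; move: H => /= H;
    (try case: H => H1 /andP[H2 H3]); (try case/andP: H => H1 H2); lra.
have [aNs|aNs] := ltP a (- s)%R; rewrite lebesgue_measure_itv/= lte_fin.
  have -> : (- s < s)%R by rewrite (lt_trans _ s0)// oppr_lt0.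
  by rewrite -EFinB.
by rewrite lt_as -EFinB.
Qed.

(** The push-forward of s sin t dt under s cos t agrees with Lebesgue measure on half-lines cut down
    to [-s, s], hence on all Borel subsets of that interval. *)
Lemma cos_substitution (f : R -> \bar R) :
  measurable_fun setT f -> (forall y, 0 <= f y) ->
  \int[mu]_(x in `[(- s)%R, s]) f x =
  \int[mu]_(t in `[0%R, pi]) ((s * sin t)%:E * f (s * cos t)%R).
Proof.
move=> mf f0.
have mI : measurable (`[(- s)%R, s] : set R) by [].
have [nu nuE] := @weighted_pushforward_exists _ _ _ (measurableTypeR R) R mu phi mphi w mw w0.
have nuT a : nu `]a, +oo[%classic = mu (`]a, +oo[ `&` `[(- s)%R, s]) by rewrite nuE int_tail.
(* Uniqueness of Lebesgue measure speaks of the whole line, so Lebesgue measure outside [-s, s] is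
   added to [nu]. *)
pose m2 := measure_add nu (mrestr mu (measurableC mI)).
have finI A : measurable A -> mu (A `&` `[(- s)%R, s]) < +oo.
  move=> mA; apply: (@le_lt_trans _ _ (mu `[(- s)%R, s])).
    by apply: le_measure; rewrite ?inE//; exact: measurableI.
  by rewrite lebesgue_measure_itv/= lte_fin; case: ifP => _; rewrite ?ltry.
have nu_itv a b : nu `]a, b]%classic = mu (`]a, b] `&` `[(- s)%R, s]).
  have [ba|ab] := leP b a.
    by rewrite set_itv_ge ?set0I ?measure0// bnd_simp -leNgt.
  have U : `]a, +oo[%classic = `]a, b]%classic `|` `]b, +oo[%classic.
    apply/seteqP; split => x /=; rewrite !in_itv/= ?andbT; last by lra.
    by move=> ax; case: (leP x b) => _; [left; rewrite ax|right].
  have dis : [disjoint `]a, b]%classic & `]b, +oo[%classic].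
    by apply/disj_set2P/seteqP; split => // x [] /=; rewrite !in_itv/=; lra.
  have E1 : nu `]a, +oo[%classic = nu `]a, b]%classic + nu `]b, +oo[%classic.
    by rewrite U measureU//; apply/disj_set2P.
  have E2 : mu (`]a, +oo[ `&` `[(- s)%R, s]) =
      mu (`]a, b] `&` `[(- s)%R, s]) + mu (`]b, +oo[ `&` `[(- s)%R, s]).
    rewrite U setIUl; apply: measureU; [exact: measurableI|exact: measurableI|].
    by rewrite setIACA; move/disj_set2P : dis => ->; rewrite set0I.
  have := nuT a; rewrite E1 E2 (nuT b) => E.
  have fb : mu (`]b, +oo[ `&` `[(- s)%R, s]) \is a fin_num.
    by rewrite ge0_fin_numE// finI.
  by rewrite -(addeK (nu _) fb) E addeK.
have nuE2 A : measurable A -> A `<=` `[(- s)%R, s]%classic -> mu A = nu A.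
  move=> mA AI.
  have -> : mu A = m2 A.
    apply: lebesgue_measure_unique => // X [[a b]] /= _ <-.
    rewrite [RHS]measure_addE nu_itv -[RHS]measureU//.
    - by rewrite /mrestr -setIUr setUv setIT.
    - exact: measurableI.
    - by apply: measurableI => //; exact: measurableC.
    - by rewrite setIACA setICr setI0.
  have A0 : A `&` ~` `[(- s)%R, s] = set0 by apply/seteqP; split => // x [/AI].
  by rewrite [LHS]measure_addE /= /mrestr A0 measure0 adde0.
transitivity (\int[nu]_(x in `[(- s)%R, s]) f x).
  by apply: eq_measure_integral => A mA AI; exact: nuE2.
transitivity (\int[nu]_x f x).
  have nu0 : nu (~` `[(- s)%R, s]) = 0; last first.
    have := @ge0_negligible_integral _ _ _ nu setT (~` `[(- s)%R, s]) f
      (measurableC mI) measurableT mf (fun x _ => f0 x) nu0.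
    by rewrite setTD setCK => ->.
  rewrite nuE integral0_eq// => t _; rewrite /w !indicE.
  case: (boolP (t \in _)); rewrite ?mulr0 ?mul0r//= inE/= in_itv/= => tp.
  rewrite memNset ?mulr0//=; apply; rewrite in_itv/= /phi.
  have := ler_wpM2l (ltW s0) (cos_le1 t); have := ler_wpM2l (ltW s0) (cos_geN1 t).
  by rewrite mulr1 mulrN1 => -> ->.
rewrite (@ge0_integral_transfer_density _ _ (measurableTypeR R) (measurableTypeR R) R phi mphi mu nu w mw w0)//.
rewrite [RHS]integral_mkcond; apply: eq_integral => t _.
rewrite patchE /w indicE; case: ifPn => _; rewrite ?mulr1//.
by rewrite mulr0 mul0e.
Qed.

End cos_substitution.

Section lebesgue_affine.
Local Open Scope ereal_scope.
Context (R : realType).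
Notation mu := (@lebesgue_measure R).

Lemma integral_reflect (c : R) (F : R -> \bar R) (I : set R) :
  measurable I -> measurable_fun setT F -> (forall x, 0 <= F x) ->
  \int[mu]_(x in [set x | I (c - x)%R]) F (c - x)%R = \int[mu]_(x in I) F x.
Proof.
move=> mI mF F0.
pose phi : measurableTypeR R -> measurableTypeR R := fun x => (c - x)%R.
have mphi : measurable_fun setT phi by apply: measurable_funB.
have E A : measurable A -> mu A = pushforward mu phi A.
  apply: lebesgue_measure_unique => X [[a b]] /= _ <-.
  rewrite /pushforward (_ : phi @^-1` _ = `[(c - b)%R, (c - a)%R[%classic).
    rewrite !lebesgue_measure_itv/= !lte_fin.
    have -> : (c - b < c - a)%R = (a < b)%R by apply/idP/idP; lra.
    by case: ifP => // _; rewrite -!EFinB; congr (_%:E); ring.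
  by apply/seteqP; split => x /=; rewrite /phi !in_itv/= => /andP[? ?]; apply/andP; split; lra.
transitivity (\int[pushforward mu phi]_(x in I) F x); last first.
  by apply: eq_measure_integral => A mA AI; rewrite [RHS]E.
rewrite (@ge0_integral_pushforward _ _ (measurableTypeR R) (measurableTypeR R))//.
exact: measurable_funTS.
Qed.

(** A translation is the composite of two reflections. *)
Lemma integral_shift (c : R) (F : R -> \bar R) (I : set R) :
  measurable I -> measurable_fun setT F -> (forall x, 0 <= F x) ->
  \int[mu]_(x in [set x | I (x + c)%R]) F (x + c)%R = \int[mu]_(x in I) F x.
Proof.
move=> mI mF F0; rewrite -(integral_reflect c mI mF F0).
have mI' : measurable [set x | I (c - x)%R].
  rewrite -[X in measurable X]setTI.
  have : measurable_fun setT (fun x : R => (c - x)%R) by apply: measurable_funB.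
  by apply.
have mF' : measurable_fun setT (fun x : R => F (c - x)%R).
  by apply: measurableT_comp => //; apply: measurable_funB.
rewrite -(integral_reflect 0 mI' mF' (fun x : R => F0 _)).
have E (x : R) : (c - (0 - x) = x + c)%R by ring.
congr (integral _ _ _).
  by apply/seteqP; split => x /=; rewrite E.
by apply/funext => x; rewrite E.
Qed.

Lemma integral_period_reflect (F : R -> \bar R) (psi : R) :
  measurable_fun setT F -> (forall x, 0 <= F x) ->
  (forall x, F (x + pi *+ 2)%R = F x) -> (0 <= psi <= pi *+ 2)%R ->
  \int[mu]_(x in `[0%R, (pi *+ 2)%R[) F (psi - x)%R =
  \int[mu]_(x in `[0%R, (pi *+ 2)%R[) F x.
Proof.
move=> mF F0 FP /andP[p0 p2].
have pi0 : (0 < pi :> R)%R := pi_gt0 R.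
have ED : `[0%R, (pi *+ 2)%R[%classic =
   [set x : R | `](psi - pi *+ 2)%R, psi]%classic (psi - x)%R].
  by apply/seteqP; split => x /=; rewrite !in_itv/= => /andP[? ?]; apply/andP; split; lra.
rewrite [in LHS]ED integral_reflect//.
have mFI (I : set R) : measurable_fun I F by exact: measurable_funTS.
rewrite [RHS](integral_itv_bndo_bndc (mFI _)) -[RHS](integral_itv_obnd_cbnd (mFI _)).
(* The period and its reflected image share ]0, psi]; their other parts differ by a translation by 2
   pi. *)
have -> : `]0%R, (pi *+ 2)%R]%classic = `]psi, (pi *+ 2)%R]%classic `|` `]0%R, psi]%classic.
  by apply/seteqP; split => x /=; rewrite !in_itv/=; case: (leP x psi) => xp; lra.
have -> : `](psi - pi *+ 2)%R, psi]%classic =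
    `](psi - pi *+ 2)%R, 0%R]%classic `|` `]0%R, psi]%classic.
  by apply/seteqP; split => x /=; rewrite !in_itv/=; case: (leP x 0%R) => xp; lra.
have d1 : [disjoint `]psi, (pi *+ 2)%R]%classic & `]0%R, psi]%classic].
  by apply/disj_set2P/seteqP; split => // x [] /=; rewrite !in_itv/=; lra.
have d2 : [disjoint `](psi - pi *+ 2)%R, 0%R]%classic & `]0%R, psi]%classic].
  by apply/disj_set2P/seteqP; split => // x [] /=; rewrite !in_itv/=; lra.
rewrite ge0_integral_setU//; last exact: mFI.
rewrite ge0_integral_setU//; last exact: mFI.
congr (_ + _); rewrite -[RHS](integral_shift (pi *+ 2))//.
under [RHS]eq_integral do rewrite FP.
congr (integral _ _ _); apply/seteqP.
by split => x /=; rewrite !in_itv/= => /andP[? ?]; apply/andP; split; lra.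
Qed.

End lebesgue_affine.

(** * Integration over the sphere in polar and in disc coordinates *)

Section sphere_integral.
Local Open Scope ereal_scope.
Context (R : realType).
Notation mu := (@lebesgue_measure R).
Implicit Types G : R -> R -> R -> \bar R.

Definition measurable3 G :=
  measurable_fun setT (fun p : R * R * R => G p.1.1 p.1.2 p.2).

Definition sphint G := \int[mu]_(t in `[0%R, pi]) ((sin t)%:E *
  \int[mu]_(f in `[0%R, (pi *+ 2)%R[) G (sin t * cos f)%R (sin t * sin f)%R (cos t)).

Lemma measurable_sin : measurable_fun setT (@sin R).
Proof. by apply: continuous_measurable_fun => x; exact: continuous_sin. Qed.

Lemma measurable_cos : measurable_fun setT (@cos R).
Proof. by apply: continuous_measurable_fun => x; exact: continuous_cos. Qed.

Lemma measurable3_comp d (T : measurableType d) G (f g h : T -> R) :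
  measurable3 G -> measurable_fun setT f -> measurable_fun setT g ->
  measurable_fun setT h -> measurable_fun setT (fun t => G (f t) (g t) (h t)).
Proof.
move=> mG mf mg mh.
apply: (measurableT_comp (f := fun p : R * R * R => G p.1.1 p.1.2 p.2) (g := fun t => (f t, g t, h t))) => //.
by apply: measurable_fun_pair => //; exact: measurable_fun_pair.
Qed.

Lemma polar_angle (c d : R) : (c ^+ 2 + d ^+ 2 = 1 ->
  exists2 psi, 0 <= psi <= pi *+ 2 & cos psi = c /\ sin psi = d)%R.
Proof.
move=> cd1.
have c1 : (-1 <= c <= 1)%R by nra.
have pi0 := pi_ge0 R.
have sd : (Num.sqrt (1 - c ^+ 2) = `|d|)%R.
  by rewrite -cd1 addrAC subrr add0r sqrtr_sqr.
have [d0|d0] := lerP 0%R d.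
  exists (acos c); first by rewrite acos_ge0//= (le_trans (acos_lepi c1))//; lra.
  by rewrite acosK ?in_itv//= sin_acos// sd ger0_norm.
exists (- acos c + pi *+ 2)%R.
  by have := acos_ge0 c1; have := acos_lepi c1; lra.
by rewrite cosD2pi sinD2pi cosN sinN acosK ?in_itv//= sin_acos// sd ltr0_norm// opprK.
Qed.

(** The plane map is a reflection; it turns the longitude f into psi - f, where psi is the polar
    angle of (c, d). *)
Lemma sphint_horizontal G (c d : R) : measurable3 G ->
  (forall x y z, 0 <= G x y z) -> (c ^+ 2 + d ^+ 2 = 1)%R ->
  sphint (fun x y z => G (c * x + d * y)%R (d * x - c * y)%R z) = sphint G.
Proof.
move=> mG G0 /polar_angle[psi psi2 [<- <-]].
apply: eq_integral => t _; congr (_ * _).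
have mcos := measurable_cos; have msin := measurable_sin.
rewrite -[RHS](@integral_period_reflect _ _ psi)//.
- apply: eq_integral => f _; rewrite cosB sinB.
  by congr (G _ _ _); ring.
- by apply: measurable3_comp => //; exact: measurable_funM.
- by move=> x; rewrite cosD2pi sinD2pi.
Qed.

(** Projection along the y axis: two points of the sphere lie over each interior point (x, h) of the
    unit disc, and dx dh / y is the area element at both. *)
Definition disc_density G (x h : R) : \bar R :=
  let y := Num.sqrt (1 - x ^+ 2 - h ^+ 2) in
  (y^-1)%:E * (G x y h + G x (- y)%R h).

Lemma measurable_disc_density G : measurable3 G ->
  measurable_fun setT (fun p : R * R => disc_density G p.1 p.2).
Proof.
move=> mG; pose y (p : R * R) := Num.sqrt (1 - p.1 ^+ 2 - p.2 ^+ 2)%R.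
have my : measurable_fun setT y.
  apply: measurableT_comp.
    by apply: continuous_measurable_fun; exact: sqrt_continuous.
  by do ?apply: measurable_funB => //; apply: measurable_funX.
apply: emeasurable_funM.
  apply/measurable_EFinP.
  rewrite (_ : (fun _ => _) = fun p => powR (y p) (-1)).
    have mpow : measurable_fun setT (fun u : R => powR u (-1)) := measurable_powR (-1).
    exact: (measurableT_comp mpow my).
  by apply/funext => p; rewrite powR_inv1// sqrtr_ge0.
by apply: emeasurable_funD; apply: measurable3_comp => //; exact: measurableT_comp.
Qed.

Lemma disc_density_ge0 G x h : (forall x y z, 0 <= G x y z) -> 0 <= disc_density G x h.
Proof.
by move=> G0; rewrite mule_ge0 ?adde_ge0// lee_fin invr_ge0 sqrtr_ge0.
Qed.

(** Square roots of nonpositive numbers and the inverse of 0 are both 0, so the density extends by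
    zero from the open disc to the plane. *)
Lemma disc_density0 G x h : (1 - x ^+ 2 - h ^+ 2 <= 0)%R -> disc_density G x h = 0.
Proof. by move=> xh; rewrite /disc_density ler0_sqrtr// invr0 mul0e. Qed.

(** Two uses of [cos_substitution]: with s = sin t along each half of a horizontal circle, and with
    s = 1 for the height h = cos t. *)
Lemma sphint_disc G : measurable3 G -> (forall x y z, 0 <= G x y z) ->
  sphint G = \int[mu]_h \int[mu]_x disc_density G x h.
Proof.
move=> mG G0.
have mD := measurable_disc_density mG.
have D0 x h := disc_density_ge0 x h G0.
have pi0 : (0 < pi :> R)%R := pi_gt0 R.
have mcos := measurable_cos; have msin := measurable_sin.
pose M h := \int[mu]_x disc_density G x h.
have mM : measurable_fun setT M.
  exact: (@measurable_fun_fubini_tonelli_G _ _ (measurableTypeR R) (measurableTypeR R) R mu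
    (fun p => disc_density G p.1 p.2) mD (fun p => D0 p.1 p.2)).
have M0 h : 0 <= M h by exact: integral_ge0.
have inner t : (0 < t < pi)%R ->
    \int[mu]_(f in `[0%R, (pi *+ 2)%R[) G (sin t * cos f)%R (sin t * sin f)%R (cos t)
    = M (cos t).
  move=> tp; have s0 : (0 < sin t)%R by exact: sin_gt0_pi.
  have cs := cos2Dsin2 t.
  have hs : (1 - cos t ^+ 2 = sin t ^+ 2)%R by rewrite -cs addrAC subrr add0r.
  set s := sin t in s0 cs hs *; set h := cos t in cs hs *.
  pose F f := G (s * cos f)%R (s * sin f)%R h.
  have mF : measurable_fun setT F.
    by apply: measurable3_comp => //; exact: measurable_funM.
  have F0 f : 0 <= F f by exact: G0.
  have mF' : measurable_fun setT (fun x : R => F (pi *+ 2 - x)%R).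
    by apply: measurableT_comp => //; exact: measurable_funB.
  have split_dom : `[0%R, (pi *+ 2)%R[%classic =
      `[0%R, pi]%classic `|` `](pi : R), (pi *+ 2)%R[%classic.
    by apply/seteqP; split => x /=; rewrite !in_itv/=; case: (leP x pi) => xp; lra.
  have dis : [disjoint `[0%R, pi]%classic & `](pi : R), (pi *+ 2)%R[%classic].
    by apply/disj_set2P/seteqP; split => // x [] /=; rewrite !in_itv/=; lra.
  (* The half circle with negative sine is folded onto the other one by f -> 2 pi - f. *)
  have -> : \int[mu]_(f in `[0%R, (pi *+ 2)%R[) F f =
      \int[mu]_(f in `]0%R, (pi : R)[) (F f + F (pi *+ 2 - f)%R).
    rewrite split_dom ge0_integral_setU//; last exact: measurable_funTS.
    rewrite ge0_integralD//; [|exact: measurable_funTS..].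
    rewrite integral_itv_bndoo; last exact: measurable_funTS.
    congr (_ + _); rewrite -(integral_reflect (pi *+ 2))//.
    congr (integral _ _ _); apply/seteqP.
    by split => x /=; rewrite !in_itv/= => /andP[? ?]; apply/andP; split; lra.
  have mDh : measurable_fun setT (disc_density G ^~ h).
    by apply: (measurableT_comp (f := fun p : R * R => disc_density G p.1 p.2)
       (g := fun x => (x, h))) => //; exact: measurable_fun_pair.
  transitivity (\int[mu]_(x in `[(- s)%R, s]) disc_density G x h); last first.
    rewrite integral_mkcond; apply: eq_integral => x _.
    rewrite patchE; case: ifPn => // /negP; rewrite inE /= in_itv/= => h1.
    apply/esym; apply: disc_density0; rewrite addrAC hs.
    have [h2|h2] := leP (-s)%R x; last by nra.
    have [h3|h3] := leP x s; last by nra.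
    by exfalso; apply: h1; rewrite h2 h3.
  rewrite (cos_substitution s0 mDh) //.
  rewrite [RHS]integral_itv_bndoo; last first.
    apply: measurable_funTS; apply: emeasurable_funM.
      by apply/measurable_EFinP; apply: measurable_funM.
    by apply: (measurableT_comp (f := disc_density G ^~ h)) => //; apply: measurable_funM.
  apply: eq_integral => x; rewrite inE/= in_itv/= => xp.
  have y0 : (0 < s * sin x)%R by rewrite mulr_gt0// sin_gt0_pi.
  rewrite /disc_density.
  have -> : Num.sqrt (1 - (s * cos x) ^+ 2 - h ^+ 2) = (s * sin x)%R.
    rewrite addrAC hs (_ : _ - _ = (s * sin x) ^+ 2)%R.
      by rewrite sqrtr_sqr ger0_norm// ltW.
    by rewrite !exprMn (sin2cos2 x); ring.
  rewrite muleA -EFinM divff ?gt_eqF// mul1e; congr (_ + _).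
  rewrite /F [(pi *+ 2 - x)%R]addrC cosD2pi sinD2pi cosN sinN.
  by rewrite mulrN.
transitivity (\int[mu]_(h in `[(- 1)%R, 1%R]) M h).
  rewrite (cos_substitution ltr01 mM M0) /sphint.
  apply: eq_integral => t; rewrite inE/= in_itv/= => /andP[].
  rewrite le_eqVlt => /predU1P[<- _|t0]; first by rewrite sin0 mulr0 !mul0e.
  rewrite le_eqVlt => /predU1P[->|tpi]; first by rewrite sinpi mulr0 !mul0e.
  have tp : (0 < t < pi)%R by rewrite t0.
  by rewrite (inner _ tp) !mul1r.
rewrite integral_mkcond; apply: eq_integral => h _.
rewrite patchE; case: ifPn => // /negP; rewrite inE /= in_itv/= => h1.
apply/esym/integral0_eq => x _; apply: disc_density0.
have [h2|h2] := leP (-1)%R h; last by nra.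
have [h3|h3] := leP h 1%R; last by nra.
by exfalso; apply: h1; rewrite h2 h3.
Qed.

(** [disc_density] treats x and h alike, so this is Tonelli's theorem. It is the one basic symmetry
    that moves the polar axis. *)
Lemma sphint_swap G : measurable3 G -> (forall x y z, 0 <= G x y z) ->
  sphint (fun x y z => G z y x) = sphint G.
Proof.
move=> mG G0.
have mG' : measurable3 (fun x y z => G z y x).
  apply: (@measurable3_comp _ (R * R * R)%type G (fun p => p.2) (fun p => p.1.2)
    (fun p => p.1.1)) => //.
  - exact: measurable_snd.
  - by apply: (measurableT_comp (f := snd) (g := fst)).
  - by apply: (measurableT_comp (f := fst) (g := fst)).
rewrite [LHS](sphint_disc mG' (fun x y z => G0 z y x)) [RHS](sphint_disc mG G0).
rewrite (@fubini_tonelli _ _ _ _ _ mu mu (fun p => disc_density G p.2 p.1)) /=.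
- apply: eq_integral => h _; apply: eq_integral => x _.
  rewrite /disc_density; have -> : (1 - x ^+ 2 - h ^+ 2 = 1 - h ^+ 2 - x ^+ 2)%R by ring.
  by [].
- apply: (measurableT_comp (f := fun p : R * R => disc_density G p.1 p.2)
    (g := fun p : R * R => (p.2, p.1))).
    exact: measurable_disc_density.
  by apply: measurable_fun_pair; [exact: measurable_snd|exact: measurable_fst].
- by move=> p; exact: disc_density_ge0.
Qed.

End sphere_integral.

(** * Vectors in space *)

Section vec3.
Context (R : realType).
Implicit Types u v w : 'rV[R]_3.

Definition cx v := v 0 ord0.
Definition cy v := v 0 (lift ord0 ord0).
Definition cz v := v 0 (lift ord0 (lift ord0 ord0)).
Definition vec3 (x y z : R) : 'rV[R]_3 := \row_(i < 3) [:: x; y; z]`_i.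

Lemma dotE u v : dot u v = cx u * cx v + cy u * cy v + cz u * cz v.
Proof. by rewrite /dot !big_ord_recl big_ord0 addr0 addrA. Qed.

Lemma cx_vec3 x y z : cx (vec3 x y z) = x. Proof. by rewrite /cx mxE. Qed.
Lemma cy_vec3 x y z : cy (vec3 x y z) = y. Proof. by rewrite /cy mxE. Qed.
Lemma cz_vec3 x y z : cz (vec3 x y z) = z. Proof. by rewrite /cz mxE. Qed.
Lemma cxD u v : cx (u + v) = cx u + cx v. Proof. by rewrite /cx mxE. Qed.
Lemma cyD u v : cy (u + v) = cy u + cy v. Proof. by rewrite /cy mxE. Qed.
Lemma czD u v : cz (u + v) = cz u + cz v. Proof. by rewrite /cz mxE. Qed.
Lemma cxN u : cx (- u) = - cx u. Proof. by rewrite /cx mxE. Qed.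
Lemma cyN u : cy (- u) = - cy u. Proof. by rewrite /cy mxE. Qed.
Lemma czN u : cz (- u) = - cz u. Proof. by rewrite /cz mxE. Qed.
Lemma cxZ a u : cx (a *: u) = a * cx u. Proof. by rewrite /cx mxE. Qed.
Lemma cyZ a u : cy (a *: u) = a * cy u. Proof. by rewrite /cy mxE. Qed.
Lemma czZ a u : cz (a *: u) = a * cz u. Proof. by rewrite /cz mxE. Qed.
Lemma cx0 : cx 0 = 0. Proof. by rewrite /cx mxE. Qed.
Lemma cy0 : cy 0 = 0. Proof. by rewrite /cy mxE. Qed.
Lemma cz0 : cz 0 = 0. Proof. by rewrite /cz mxE. Qed.

Definition coordE := (cx_vec3, cy_vec3, cz_vec3, cxD, cyD, czD, cxN, cyN, czN,
  cxZ, cyZ, czZ, cx0, cy0, cz0).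

Lemma vec3P u v : cx u = cx v -> cy u = cy v -> cz u = cz v -> u = v.
Proof.
move=> hx hy hz; apply/rowP => i.
case: (unliftP ord0 i) => [j|] ->; last exact: hx.
case: (unliftP ord0 j) => [k|] ->; last exact: hy.
by rewrite (ord1 k); exact: hz.
Qed.

Lemma dotC u v : dot u v = dot v u. Proof. by rewrite !dotE; ring. Qed.
Lemma dotDl u v w : dot (u + v) w = dot u w + dot v w.
Proof. by rewrite !dotE !coordE; ring. Qed.
Lemma dotDr u v w : dot u (v + w) = dot u v + dot u w.
Proof. by rewrite !dotE !coordE; ring. Qed.
Lemma dotNl u v : dot (- u) v = - dot u v.
Proof. by rewrite !dotE !coordE; ring. Qed.
Lemma dotNr u v : dot u (- v) = - dot u v.
Proof. by rewrite !dotE !coordE; ring. Qed.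
Lemma dotBl u v w : dot (u - v) w = dot u w - dot v w.
Proof. by rewrite dotDl dotNl. Qed.
Lemma dotBr u v w : dot u (v - w) = dot u v - dot u w.
Proof. by rewrite dotDr dotNr. Qed.
Lemma dotZl a u v : dot (a *: u) v = a * dot u v.
Proof. by rewrite !dotE !coordE; ring. Qed.
Lemma dotZr a u v : dot u (a *: v) = a * dot u v.
Proof. by rewrite !dotE !coordE; ring. Qed.
Lemma dot0l u : dot 0 u = 0. Proof. by rewrite !dotE !coordE; ring. Qed.
Lemma dot0r u : dot u 0 = 0. Proof. by rewrite dotC dot0l. Qed.

Definition dotM := (dotDl, dotDr, dotNl, dotNr, dotZl, dotZr, dot0l, dot0r).

Lemma dot_ge0 u : 0 <= dot u u. Proof. by rewrite dotE; nra. Qed.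

Lemma dot_eq0 u : dot u u = 0 -> u = 0.
Proof.
rewrite dotE => h.
by apply: vec3P; rewrite coordE; apply/eqP; rewrite -sqrf_eq0; apply/eqP; nra.
Qed.

Lemma dot_gt0 u : u != 0 -> 0 < dot u u.
Proof.
move=> u0; rewrite lt_neqAle dot_ge0 andbT eq_sym.
by apply: contra u0 => /eqP/dot_eq0 ->.
Qed.

Lemma cauchy_schwarz u v : (dot u v) ^+ 2 <= dot u u * dot v v.
Proof.
rewrite -subr_ge0 (_ : _ - _ = (cx u * cy v - cy u * cx v) ^+ 2 +
  (cy u * cz v - cz u * cy v) ^+ 2 + (cz u * cx v - cx u * cz v) ^+ 2).
  by rewrite !addr_ge0// sqr_ge0.
by rewrite !dotE; ring.
Qed.

Lemma sum_dotl (I : Type) (r : seq I) (P : pred I) (F : I -> 'rV[R]_3) v :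
  dot (\sum_(i <- r | P i) F i) v = \sum_(i <- r | P i) dot (F i) v.
Proof. by elim/big_rec2: _ => [|i x y _ <-]; rewrite ?dot0l// dotDl. Qed.

Lemma sum_dotr (I : Type) (r : seq I) (P : pred I) (F : I -> 'rV[R]_3) v :
  dot v (\sum_(i <- r | P i) F i) = \sum_(i <- r | P i) dot v (F i).
Proof. by rewrite dotC sum_dotl; apply: eq_bigr => i _; rewrite dotC. Qed.

Notation S2 := (sphere2 R).

Lemma sphere_dot_le1 u v : S2 u -> S2 v -> dot u v <= 1.
Proof. by rewrite /sphere2/= => hu hv; have := cauchy_schwarz u v; rewrite hu hv; nra. Qed.

Lemma sphere_dot_geN1 u v : S2 u -> S2 v -> -1 <= dot u v.
Proof. by rewrite /sphere2/= => hu hv; have := cauchy_schwarz u v; rewrite hu hv; nra. Qed.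

Lemma dist_sphere u v : S2 u -> S2 v -> dot (u - v) (u - v) = 2 * (1 - dot u v).
Proof. by rewrite /sphere2/= => hu hv; rewrite !dotM hu hv (dotC v u); ring. Qed.

Lemma sphere_dot1 u v : S2 u -> S2 v -> 1 <= dot u v -> u = v.
Proof.
move=> hu hv h; apply/eqP; rewrite -subr_eq0; apply/eqP/dot_eq0.
by apply/eqP; rewrite eq_le dot_ge0 andbT dist_sphere//; lra.
Qed.

Lemma sphere_dot_lt1 u v : S2 u -> S2 v -> u <> v -> dot u v < 1.
Proof. by move=> hu hv uv; rewrite ltNge; apply/negP => /(sphere_dot1 hu hv). Qed.

Lemma sphere_neq0 u : S2 u -> u != 0.
Proof. by move=> hu; apply/eqP => u0; move: hu; rewrite u0 /sphere2/= dot0l; lra. Qed.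

(** The larger root t of |u + t d|^2 = 1. The closed formula makes it continuous in u, as
    [push_path_continuous] requires. *)
Definition push_time u d :=
  (- dot u d + Num.sqrt (dot u d ^+ 2 + dot d d * (1 - dot u u))) / dot d d.

Lemma push_timeP u d : dot u u <= 1 -> d != 0 ->
  0 <= push_time u d /\ S2 (u + push_time u d *: d).
Proof.
move=> u1 d0; rewrite /push_time; have dd := dot_gt0 d0.
pose D := dot u d ^+ 2 + dot d d * (1 - dot u u).
have D0 : 0 <= D by rewrite /D; nra.
have sD := sqr_sqrtr D0; have sD0 := sqrtr_ge0 D.
have sle : `|dot u d| <= Num.sqrt D.
  by rewrite -sqrtr_sqr ler_wsqrtr// /D; nra.
split.
  by rewrite divr_ge0// ?dot_ge0//; move: sle; rewrite ler_norml; lra.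
rewrite /sphere2/= !dotM (dotC d u).
set t := _ / _; have ht : t * dot d d = - dot u d + Num.sqrt D by rewrite /t divfK// gt_eqF.
have : dot d d * (dot u u + t * dot u d + (t * dot u d + t * (t * dot d d)) - 1) = 0.
  have -> : dot d d * (dot u u + t * dot u d + (t * dot u d + t * (t * dot d d)) - 1) =
     dot d d * (dot u u - 1) + 2 * (t * dot d d) * dot u d + (t * dot d d) ^+ 2 by ring.
  by rewrite ht; move: sD; rewrite /D; nra.
by move/eqP; rewrite mulf_eq0 gt_eqF//= subr_eq0 => /eqP.
Qed.

(** Convex combinations of points of the sphere lie in the ball; pushing along d brings them back
    without lowering any functional that is nonnegative on d. *)
Lemma push_to_sphere u d : dot u u <= 1 -> d != 0 ->
  exists2 t, 0 <= t & S2 (u + t *: d).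
Proof. by move=> u1 d0; have [] := push_timeP u1 d0; exists (push_time u d). Qed.

Definition cross u v : 'rV[R]_3 := vec3 (cy u * cz v - cz u * cy v)
  (cz u * cx v - cx u * cz v) (cx u * cy v - cy u * cx v).

Lemma dot_cross1 u v : dot u (cross u v) = 0.
Proof. by rewrite dotE /cross !coordE; ring. Qed.
Lemma dot_cross2 u v : dot v (cross u v) = 0.
Proof. by rewrite dotE /cross !coordE; ring. Qed.

(** Cramer's rule with the denominator multiplied out, so that it also holds for dependent a, b,
    c. *)
Lemma cross_basis (a b c y : 'rV[R]_3) :
  dot a (cross b c) *: y =
  dot a y *: cross b c + dot b y *: cross c a + dot c y *: cross a b.
Proof. by apply: vec3P; rewrite /cross !dotE !coordE; ring. Qed.

Lemma cross_coords (a b c y : 'rV[R]_3) :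
  dot a (cross b c) *: y = dot y (cross b c) *: a + dot y (cross c a) *: b +
    dot y (cross a b) *: c.
Proof. by apply: vec3P; rewrite /cross !dotE !coordE; ring. Qed.

Lemma orth2_exists u v : exists2 d, d != 0 & dot d u = 0 /\ dot d v = 0.
Proof.
have [c0|c0] := eqVneq (cross u v) 0; last first.
  by exists (cross u v) => //; rewrite dotC dot_cross1 dotC dot_cross2.
pose e1 := vec3 1 0 0; pose e2 := vec3 0 1 0; pose e3 := vec3 0 0 1.
have nz (a b c : R) : vec3 a b c = 0 -> [/\ a = 0, b = 0 & c = 0].
  by move=> h; split; [move/(congr1 cx): h|move/(congr1 cy): h|move/(congr1 cz): h]; rewrite !coordE.
have /nz[h1 h2 h3] := c0.
have [->|u0] := eqVneq u 0.
  have [->|v0] := eqVneq v 0.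
    exists e1; last by rewrite !dot0r.
    by apply/eqP => /nz[]/eqP; rewrite oner_eq0.
  have [vz|vz] := eqVneq (vec3 (cy v) (- cx v) 0) 0.
    have [vy vx _] := nz _ _ _ vz.
    exists e1; first by apply/eqP => /nz[]/eqP; rewrite oner_eq0.
    by rewrite dot0r dotE /e1 !coordE; split => //; lra.
  by exists (vec3 (cy v) (- cx v) 0) => //; rewrite dot0r dotE !coordE; split => //; ring.
have [vz|vz] := eqVneq (vec3 (cy u) (- cx u) 0) 0.
  have [uy ux _] := nz _ _ _ vz.
  have uz : cz u != 0.
    by apply: contra u0 => /eqP uz; apply/eqP/vec3P; rewrite !coordE//; lra.
  exists e1; first by apply/eqP => /nz[]/eqP; rewrite oner_eq0.
  rewrite !dotE /e1 !coordE; split; first by lra.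
  have : cz u * cx v = 0 by nra.
  by move/eqP; rewrite mulf_eq0 (negbTE uz)/= => /eqP ->; ring.
exists (vec3 (cy u) (- cx u) 0) => //; rewrite !dotE !coordE; split; first by ring.
by lra.
Qed.

(** Independent vectors admit a d with three equal products, dependent ones a d orthogonal to all
    three. The three vectors will be the ends of a chord and the normal of a plane. *)
Lemma common_direction (a b c : 'rV[R]_3) : exists2 d, d != 0 &
  [/\ 0 <= dot a d, 0 <= dot b d & 0 <= dot c d].
Proof.
have [D0|D0] := eqVneq (dot a (cross b c)) 0; last first.
  pose d0 := cross b c + cross c a + cross a b.
  have ha : dot a d0 = dot a (cross b c) by rewrite /d0 !dotE /cross !coordE; ring.
  have hb : dot b d0 = dot a (cross b c) by rewrite /d0 !dotE /cross !coordE; ring.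
  have hc : dot c d0 = dot a (cross b c) by rewrite /d0 !dotE /cross !coordE; ring.
  have d00 : d0 != 0 by apply/eqP => d00; move: ha D0; rewrite d00 dot0r => <-; rewrite eqxx.
  have [Dp|Dn] := ltP 0 (dot a (cross b c)).
    by exists d0 => //; rewrite ha hb hc; split; exact: ltW.
  by exists (- d0); rewrite ?oppr_eq0// !dotNr ha hb hc oppr_ge0.
have [bc0|bc0] := eqVneq (cross b c) 0; last first.
  by exists (cross b c) => //; rewrite D0 dot_cross1 dot_cross2.
have [ca0|ca0] := eqVneq (cross c a) 0; last first.
  exists (cross c a) => //; rewrite dot_cross1 dot_cross2; split => //.
  have -> : dot b (cross c a) = dot a (cross b c) by rewrite !dotE /cross !coordE; ring.
  by rewrite D0.
have [ab0|ab0] := eqVneq (cross a b) 0; last first.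
  exists (cross a b) => //; rewrite dot_cross1 dot_cross2; split => //.
  have -> : dot c (cross a b) = dot a (cross b c) by rewrite !dotE /cross !coordE; ring.
  by rewrite D0.
have [a0|a0] := eqVneq a 0.
  by have [d d0 [h1 h2]] := orth2_exists b c; exists d => //; rewrite a0 dot0l (dotC b) (dotC c) h1 h2.
have [d d0 [h1 _]] := orth2_exists a a.
(* All three vectors are now parallel to a, so any d orthogonal to a will do. *)
have par w : cross a w = 0 -> dot w d = 0.
  move=> aw; have : dot a a * dot w d = dot a w * dot a d + dot (cross (cross a w) a) d.
    by rewrite !dotE /cross !coordE; ring.
  rewrite aw (dotC a d) h1 mulr0 add0r => h.
  have : dot a a * dot w d = 0 by rewrite h dotE /cross !coordE; ring.
  by move/eqP; rewrite mulf_eq0 gt_eqF ?dot_gt0//= => /eqP.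
exists d => //; rewrite (dotC a) h1 (par b ab0) (par c)//.
by move: ca0 => /eqP; rewrite -oppr_eq0 => /eqP <-; apply: vec3P; rewrite /cross !coordE; ring.
Qed.

End vec3.

Section topology3.
Context (R : realType).
Notation V := 'rV[R]_3.
Notation S2 := (sphere2 R).
Implicit Types (f g : V -> R).

Lemma dot_continuous (n : V) : continuous (dot n : V -> R).
Proof.
rewrite (_ : dot n = fun y => cx n * cx y + cy n * cy y + cz n * cz y); last first.
  by apply/funext => y; rewrite dotE.
have c (i : 'I_3) (a : R) : continuous (fun y : V => a * y 0 i).
  by move=> y; exact: (cvgM (cvg_cst a) (@coord_continuous _ _ _ 0 i y)).
by move=> y; exact: (cvgD (cvgD (c ord0 (cx n) y) (c (lift ord0 ord0) (cy n) y))
  (c (lift ord0 (lift ord0 ord0)) (cz n) y)).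
Qed.

Lemma dot_continuousl (n : V) : continuous ((fun y => dot y n) : V -> R).
Proof.
rewrite (_ : (fun y => _) = dot n); first exact: dot_continuous.
by apply/funext => y; rewrite dotC.
Qed.

Lemma dotdot_continuous : continuous (fun y : V => dot y y).
Proof.
rewrite (_ : (fun y => _) = fun y : V => cx y * cx y + cy y * cy y + cz y * cz y); last first.
  by apply/funext => y; rewrite dotE.
have c (i : 'I_3) : continuous (fun y : V => y 0 i * y 0 i).
  by move=> y; exact: (cvgM (@coord_continuous _ _ _ 0 i y) (@coord_continuous _ _ _ 0 i y)).
by move=> y; exact: (cvgD (cvgD (c ord0 y) (c (lift ord0 ord0) y))
  (c (lift ord0 (lift ord0 ord0)) y)).
Qed.

Lemma sum_continuous3 (I : Type) (r : seq I) (P : pred I) (F : I -> V -> R) :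
  (forall i, continuous (F i)) -> continuous (fun y => \sum_(i <- r | P i) F i y).
Proof.
move=> cF; elim: r => [|i r IH].
  by under eq_fun do rewrite big_nil; exact: cst_continuous.
under eq_fun do rewrite big_cons; case: (P i) => //.
by move=> y; exact: (cvgD (cF i y) (IH y)).
Qed.

Lemma closed_nonpos f : continuous f -> closed [set z | f z <= 0].
Proof.
move=> cf; rewrite (_ : [set z | _] = f @^-1` [set x | x <= 0])//.
by apply: preimage_closed; [move=> x _; exact: cf|exact: closed_le].
Qed.

Lemma closed_sphere : closed S2.
Proof.
rewrite (_ : S2 = (fun y : V => dot y y) @^-1` [set x | x = 1])//.
by apply: preimage_closed; [move=> x _; exact: dotdot_continuous|exact: closed_eq].
Qed.

Lemma compact_ball3 (r : R) : compact [set y : V | dot y y <= r].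
Proof.
apply: bounded_closed_compact.
  exists (1 + `|r|); split => // M rM y /= yr.
  rewrite [leLHS]/Num.norm/= mx_normrE; apply/bigmax_leP; split => /=.
    by rewrite (le_trans _ (ltW rM))// addr_ge0.
  move=> [i j] _ /=; rewrite (le_trans _ (ltW rM))//.
  have h : (y i j) ^+ 2 <= `|r|.
    apply: (le_trans _ (ler_norm r)); apply: (le_trans _ yr).
    rewrite /dot (bigD1 j)//= (ord1 i) expr2 lerDl sumr_ge0// => k _.
    by rewrite -expr2 sqr_ge0.
  rewrite -ler_sqr ?nnegrE ?addr_ge0//.
  rewrite -normrX ger0_norm ?sqr_ge0//.
  have := normr_ge0 r; nra.
rewrite (_ : [set y | _] = (fun y : V => dot y y) @^-1` [set x | x <= r])//.
by apply: preimage_closed; [move=> x _; exact: dotdot_continuous|exact: closed_le].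
Qed.

Lemma compact_sphere : compact S2.
Proof.
apply: (@subclosed_compact _ _ [set y : V | dot y y <= 1]).
- exact: closed_sphere.
- exact: compact_ball3.
- by move=> y /= ->.
Qed.

Lemma attains_min (A : set V) f : A !=set0 -> compact A -> continuous f ->
  exists2 c, A c & forall t, A t -> f c <= f t.
Proof.
move=> A0 cA cf.
have [c Ac hc] := EVT_min_rV A0 cA (continuous_subspaceT cf).
by exists c => [|t At]; [move: Ac; rewrite inE|apply: hc; rewrite inE].
Qed.

Lemma attains_max (A : set V) f : A !=set0 -> compact A -> continuous f ->
  exists2 c, A c & forall t, A t -> f t <= f c.
Proof.
move=> A0 cA cf.
have [c Ac hc] := EVT_max_rV A0 cA (continuous_subspaceT cf).
by exists c => [|t At]; [move: Ac; rewrite inE|apply: hc; rewrite inE].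
Qed.

End topology3.

(** * Spherical area *)

Section area.
Local Open Scope ereal_scope.
Context (R : realType).
Notation mu := (@lebesgue_measure R).
Notation S2 := (sphere2 R).
Implicit Types (A B : set 'rV[R]_3) (n v : 'rV[R]_3).

(** Borel sets are read through coordinates, so that the product measure theory of R * R * R applies
    to them. *)
Definition borel3 A := measurable [set p : R * R * R | A (vec3 p.1.1 p.1.2 p.2)].

Lemma borel3U A B : borel3 A -> borel3 B -> borel3 (A `|` B).
Proof. by move=> mA mB; exact: measurableU. Qed.
Lemma borel3I A B : borel3 A -> borel3 B -> borel3 (A `&` B).
Proof. by move=> mA mB; exact: measurableI. Qed.
Lemma borel3C A : borel3 A -> borel3 (~` A).
Proof. by move=> mA; exact: measurableC. Qed.
Lemma borel3D A B : borel3 A -> borel3 B -> borel3 (A `\` B).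
Proof. by move=> mA mB; exact: measurableD. Qed.
Lemma borel3_bigcup (I : finType) (P : pred I) (F : I -> set 'rV[R]_3) :
  (forall i, borel3 (F i)) -> borel3 [set z | exists2 i, P i & F i z].
Proof.
move=> mF; rewrite /borel3.
rewrite (_ : [set p : R * R * R | _] = \bigcup_(i in [set i | P i])
   [set p : R * R * R | F i (vec3 p.1.1 p.1.2 p.2)]); last first.
  by apply/seteqP; split => p /= [i Pi Fi]; exists i.
apply: fin_bigcup_measurable; first exact: finite_finset.
by move=> i _; exact: mF.
Qed.

Lemma measurable_coords : [/\ measurable_fun setT (fun p : R * R * R => p.1.1),
  measurable_fun setT (fun p : R * R * R => p.1.2) &
  measurable_fun setT (fun p : R * R * R => p.2)].
Proof.
split; [|  |exact: measurable_snd].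
- by apply: (measurableT_comp (f := fst) (g := fst)).
- by apply: (measurableT_comp (f := snd) (g := fst)).
Qed.

Lemma borel3_halfspace n (c : R) : borel3 [set z | (c < dot n z)%R].
Proof.
have [mx my mz] := measurable_coords.
rewrite /borel3 -[X in measurable X]setTI.
have mf : measurable_fun setT (fun p : R * R * R => dot n (vec3 p.1.1 p.1.2 p.2)).
  rewrite (_ : (fun p => _) = fun p : R * R * R => cx n * p.1.1 + cy n * p.1.2 + cz n * p.2)%R.
    by apply: measurable_funD; [apply: measurable_funD|]; exact: measurable_funM.
  by apply/funext => p; rewrite dotE !coordE.
have := mf measurableT `]c, +oo[%classic (measurable_itv _).
by congr (measurable (_ `&` _)); apply/seteqP; split => p /=; rewrite in_itv/= andbT.
Qed.

Lemma spherical_coordE (u : R * R) : spherical_coord u =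
  vec3 (sin u.1 * cos u.2)%R (sin u.1 * sin u.2)%R (cos u.1).
Proof. by []. Qed.

Lemma sphere_spherical_coord (u : R * R) : S2 (spherical_coord u).
Proof.
rewrite spherical_coordE /sphere2/= dotE !coordE.
have := cos2Dsin2 u.1; have := cos2Dsin2 u.2; move=> h1 h2.
transitivity (sin u.1 ^+ 2 * (cos u.2 ^+ 2 + sin u.2 ^+ 2) + cos u.1 ^+ 2)%R; first by ring.
by rewrite h1 mulr1 addrC.
Qed.

Lemma measurable_spherical A : borel3 A ->
  measurable ((@spherical_coord R) @^-1` A).
Proof.
move=> mA; rewrite -[X in measurable X]setTI.
have ms1 : measurable_fun setT (fun u : R * R => sin u.1).
  by apply: measurableT_comp => //; exact: measurable_sin.
have mc1 : measurable_fun setT (fun u : R * R => cos u.1).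
  by apply: measurableT_comp => //; exact: measurable_cos.
have ms2 : measurable_fun setT (fun u : R * R => sin u.2).
  by apply: measurableT_comp => //; exact: measurable_sin.
have mc2 : measurable_fun setT (fun u : R * R => cos u.2).
  by apply: measurableT_comp => //; exact: measurable_cos.
have mphi : measurable_fun setT (fun u : R * R =>
    ((sin u.1 * cos u.2)%R, (sin u.1 * sin u.2)%R, cos u.1)).
  by apply: measurable_fun_pair => //; apply: measurable_fun_pair; exact: measurable_funM.
exact: (mphi measurableT _ mA).
Qed.

Lemma coord_domainE : coord_domain R = `[0%R, pi]%classic `*` `[0%R, (pi *+ 2)%R[%classic.
Proof. by apply/seteqP; split => -[t f] /=; rewrite /coord_domain/= !in_itv/= mulr_natl. Qed.

Lemma measurable_coord_domain : measurable (coord_domain R).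
Proof. by rewrite coord_domainE; apply: measurableX. Qed.

Let Dm A (mA : borel3 A) : measurable (coord_domain R `&` (@spherical_coord R) @^-1` A).
Proof. by apply: measurableI; [exact: measurable_coord_domain|exact: measurable_spherical]. Qed.

Let msin1 (D : set (R * R)) : measurable_fun D (fun u : R * R => (sin u.1)%:E).
Proof.
apply: measurable_funTS; apply/measurable_EFinP; apply: measurableT_comp => //.
exact: measurable_sin.
Qed.

Let sin_ge0' A u : (coord_domain R `&` (@spherical_coord R) @^-1` A) u -> 0 <= (sin u.1)%:E.
Proof. by move=> [[h _] _]; rewrite lee_fin sin_ge0_pi. Qed.

Lemma area_ge0 A : 0 <= area A.
Proof. by apply: integral_ge0 => u Au; exact: (sin_ge0' Au). Qed.

Lemma le_area A B : borel3 A -> borel3 B -> (forall z, S2 z -> A z -> B z) ->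
  area A <= area B.
Proof.
move=> mA mB AB; apply: ge0_subset_integral => //.
- exact: Dm.
- exact: Dm.
- exact: msin1.
- by move=> u [[h _] _]; rewrite lee_fin sin_ge0_pi.
- by move=> u [Du Au]; split => //; apply: AB => //; exact: sphere_spherical_coord.
Qed.

Lemma eq_area A B : (forall z, S2 z -> A z <-> B z) -> area A = area B.
Proof.
move=> AB; congr (integral _ _ _); apply/seteqP.
by split => u [Du Au]; split => //; apply/AB => //; exact: sphere_spherical_coord.
Qed.

Lemma areaU A B : borel3 A -> borel3 B -> (forall z, S2 z -> A z -> B z -> False) ->
  area (A `|` B) = area A + area B.
Proof.
move=> mA mB AB; rewrite /area preimage_setU setIUr ge0_integral_setU//.
- exact: Dm.
- exact: Dm.
- exact: msin1.
- by move=> u [] [[h _] _]; rewrite lee_fin sin_ge0_pi.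
- apply/disj_set2P/seteqP; split => // u [[_ Au] [_ Bu]].
  by apply: (AB (spherical_coord u)) => //; exact: sphere_spherical_coord.
Qed.

Lemma area_lty A : borel3 A -> area A < +oo.
Proof.
move=> mA; apply: (@le_lt_trans _ _ (\int[mu \x mu]_(u in coord_domain R) (cst 1 u))).
  apply: (@le_trans _ _ (\int[mu \x mu]_(u in coord_domain R `&` (@spherical_coord R) @^-1` A) (cst 1 u))).
    apply: ge0_le_integral => //.
    - exact: Dm.
    - by move=> u [[h _] _]; rewrite lee_fin sin_ge0_pi.
    - exact: msin1.
    - by move=> u _; rewrite lee_fin sin_le1.
  by apply: ge0_subset_integral => //; [exact: Dm|exact: measurable_coord_domain].
rewrite integral_cst ?mul1e; last exact: measurable_coord_domain.
rewrite coord_domainE; have /= -> := product_measure1E mu mu; rewrite ?lebesgue_measure_itv//=.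
by rewrite !lte_fin; do ?case: ifP => _; rewrite ?mule0 ?mul0e -?EFinB -?EFinM ltry.
Qed.

Lemma area_fin_num A : borel3 A -> area A \is a fin_num.
Proof. by move=> mA; rewrite ge0_fin_numE ?area_ge0// area_lty. Qed.

Let G A x y z : \bar R := (\1_A (vec3 x y z))%:E.

Let mG A : borel3 A -> measurable3 (G A).
Proof.
move=> mA; apply/measurable_EFinP.
rewrite (_ : (fun p : R * R * R => _) =
    \1_([set p : R * R * R | A (vec3 p.1.1 p.1.2 p.2)])).
  exact: measurable_indic.
by apply/funext => p; rewrite !indicE; congr ((nat_of_bool _)%:R); apply/idP/idP; rewrite !inE.
Qed.

Let G0 A x y z : 0 <= G A x y z. Proof. by rewrite lee_fin. Qed.

Lemma area_sphint A : borel3 A -> area A = sphint (G A).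
Proof.
move=> mA; rewrite /area integral_mkcond.
pose f (u : R * R) := ((EFin \o (fun u : R * R => sin u.1)) \_ (coord_domain R `&` (@spherical_coord R) @^-1` A)) u.
transitivity (\int[mu \x mu]_u f u); first by [].
rewrite fubini_tonelli1; last 2 first.
- by apply/(measurable_restrictT _ (Dm mA)).
- by move=> u; rewrite /f patchE; case: ifPn => //; rewrite inE => /sin_ge0'.
rewrite /sphint [RHS]integral_mkcond; apply: eq_integral => t _.
rewrite /fubini_F patchE; case: ifPn => tp; last first.
  apply: integral0_eq => s _; rewrite /f patchE memNset// => -[[/=]].
  by move=> tp2 _ _; move/negP : tp; apply; rewrite inE/= in_itv.
rewrite -ge0_integralZl//; first last.
- by rewrite lee_fin sin_ge0_pi//; move: tp; rewrite inE/= in_itv.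
- apply: measurable_funTS.
  by apply: measurable3_comp; [exact: mG| | |] => //; apply: measurable_funM => //;
    [exact: measurable_cos|exact: measurable_sin].
rewrite [RHS]integral_mkcond.
apply: eq_integral => s _; rewrite /f !patchE /=.
have -> : ((t, s) \in coord_domain R `&` (@spherical_coord R) @^-1` A) =
    (s \in `[0%R, (pi *+ 2)%R[%classic) && (spherical_coord (t, s) \in A).
  move: tp; rewrite !inE/= in_itv/= => tp.
  by apply/idP/andP; rewrite !inE/= in_itv/= /coord_domain /= mulr_natl tp => -[]; [case|].
rewrite /G indicE spherical_coordE/=.
case: (s \in _) => //=; case: (_ \in A); first by rewrite mule1.
by rewrite mule0.
Qed.

Definition area_preserving (T : 'rV[R]_3 -> 'rV[R]_3) :=
  forall A, borel3 A -> borel3 (T @^-1` A) /\ area (T @^-1` A) = area A.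

Lemma area_preserving_comp T U : area_preserving T -> area_preserving U ->
  area_preserving (T \o U).
Proof.
move=> aT aU A mA; have [mT <-] := aT _ mA; have [mU <-] := aU _ mT.
by rewrite comp_preimage.
Qed.

Definition hreflect (c d : R) v : 'rV[R]_3 :=
  vec3 (c * cx v + d * cy v)%R (d * cx v - c * cy v)%R (cz v).
Definition swapxz v : 'rV[R]_3 := vec3 (cz v) (cy v) (cx v).

Lemma area_preserving_hreflect (c d : R) : (c ^+ 2 + d ^+ 2 = 1)%R ->
  area_preserving (hreflect c d).
Proof.
move=> cd A mA; have [mx my mz] := measurable_coords.
have mT : borel3 (hreflect c d @^-1` A).
  have mphi : measurable_fun setT (fun p : R * R * R =>
     ((c * p.1.1 + d * p.1.2)%R, (d * p.1.1 - c * p.1.2)%R, p.2)).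
    apply: measurable_fun_pair => //; apply: measurable_fun_pair.
      by apply: measurable_funD; exact: measurable_funM.
    by apply: measurable_funB; exact: measurable_funM.
  have := mphi measurableT _ mA; rewrite setTI.
  by congr (measurable _); apply/seteqP; split => p /=; rewrite /hreflect !coordE.
split; first exact: mT.
rewrite (area_sphint mT) (area_sphint mA) -(sphint_horizontal (mG mA) (@G0 A) cd).
congr (sphint _); apply/funext => x; apply/funext => y; apply/funext => z.
rewrite /G !indicE; congr (((nat_of_bool _)%:R)%:E).
by apply/idP/idP; rewrite !inE /= /hreflect !coordE.
Qed.

Lemma area_preserving_swapxz : area_preserving swapxz.
Proof.
move=> A mA; have [mx my mz] := measurable_coords.
have mT : borel3 (swapxz @^-1` A).
  have mphi : measurable_fun setT (fun p : R * R * R => (p.2, p.1.2, p.1.1)).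
    by apply: measurable_fun_pair => //; exact: measurable_fun_pair.
  have := mphi measurableT _ mA; rewrite setTI.
  by congr (measurable _); apply/seteqP; split => p /=; rewrite /swapxz !coordE.
split; first exact: mT.
rewrite (area_sphint mT) (area_sphint mA) -(sphint_swap (mG mA) (@G0 A)).
congr (sphint _); apply/funext => x; apply/funext => y; apply/funext => z.
rewrite /G !indicE; congr (((nat_of_bool _)%:R)%:E).
by apply/idP/idP; rewrite !inE /= /swapxz !coordE.
Qed.

Definition reflection n v := (v - (2 * dot n v) *: n)%R.

(** A mirror with horizontal normal acts on the longitude. A normal with [cx] equal to 0 is
    conjugated to a horizontal one by [swapxz], and a general normal to one with [cx] equal to 0 by
    a horizontal reflection. *)
Lemma area_preserving_reflection n : S2 n -> area_preserving (reflection n).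
Proof.
move=> n1.
have hz m : S2 m -> cz m = 0%R -> area_preserving (reflection m).
  rewrite /sphere2/= dotE => m1 mz0.
  pose c := (1 - 2 * cx m ^+ 2)%R; pose d := (- 2 * cx m * cy m)%R.
  have cd : (c ^+ 2 + d ^+ 2 = 1)%R.
    move: m1; rewrite mz0 /c /d => m1.
    transitivity (1 + 4 * cx m ^+ 2 * (cx m * cx m + cy m * cy m + 0 * 0 - 1))%R; first by ring.
    by rewrite m1; ring.
  have := area_preserving_hreflect cd; congr area_preserving.
  apply/funext => v; apply: vec3P; rewrite /hreflect /reflection !coordE dotE mz0 /c /d.
  - by ring.
  - transitivity (cy v - 2 * (cx m * cx v + cy m * cy v + 0 * cz v) * cy m - 2 * cy v * (1 - (cx m * cx m + cy m * cy m + 0 * 0)))%R; first by ring.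
    by move: m1; rewrite mz0 => ->; ring.
  - by ring.
have hx m : S2 m -> cx m = 0%R -> area_preserving (reflection m).
  move=> m1 mx0.
  have m1' : S2 (swapxz m).
    by move: m1; rewrite /sphere2/= !dotE /swapxz !coordE => <-; ring.
  have aR : area_preserving (reflection (swapxz m)) by apply: hz => //; rewrite /swapxz coordE.
  have := area_preserving_comp (area_preserving_comp area_preserving_swapxz aR) area_preserving_swapxz.
  congr area_preserving; apply/funext => v /=.
  by apply: vec3P; rewrite /swapxz /reflection !coordE !dotE !coordE; ring.
have [c [d [cd h0]]] : exists c d : R, (c ^+ 2 + d ^+ 2 = 1 /\ c * cx n + d * cy n = 0)%R.
  have [r0|r0] := eqVneq (cx n ^+ 2 + cy n ^+ 2)%R 0%R.
    exists 1%R, 0%R; split; first by ring.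
    have : (cx n ^+ 2 = 0)%R by have := sqr_ge0 (cy n); have := sqr_ge0 (cx n); lra.
    by move/eqP; rewrite sqrf_eq0 => /eqP ->; ring.
  have r1 : (0 <= cx n ^+ 2 + cy n ^+ 2)%R by rewrite addr_ge0// sqr_ge0.
  have s0 : (Num.sqrt (cx n ^+ 2 + cy n ^+ 2) != 0)%R by rewrite sqrtr_eq0 -ltNge lt_neqAle eq_sym r0.
  exists (cy n / Num.sqrt (cx n ^+ 2 + cy n ^+ 2))%R, (- cx n / Num.sqrt (cx n ^+ 2 + cy n ^+ 2))%R.
  split; last by field.
  by rewrite !exprMn !exprVn sqr_sqrtr//; field.
have m1 : S2 (hreflect c d n).
  move: n1; rewrite /sphere2/= !dotE /hreflect !coordE => n1.
  transitivity ((c ^+ 2 + d ^+ 2) * (cx n * cx n + cy n * cy n) + cz n * cz n)%R; first by ring.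
  by rewrite cd mul1r.
have aR : area_preserving (reflection (hreflect c d n)) by apply: hx => //; rewrite /hreflect coordE.
have aH := area_preserving_hreflect cd.
have := area_preserving_comp (area_preserving_comp aH aR) aH.
congr area_preserving; apply/funext => v /=.
have dotH u w : dot (hreflect c d u) (hreflect c d w) = dot u w.
  rewrite !dotE /hreflect !coordE.
  transitivity ((c ^+ 2 + d ^+ 2) * (cx u * cx w + cy u * cy w) + cz u * cz w)%R; first by ring.
  by rewrite cd mul1r.
have HH u : hreflect c d (hreflect c d u) = u.
  apply: vec3P; rewrite /hreflect !coordE//.
  - transitivity ((c ^+ 2 + d ^+ 2) * cx u)%R; first by ring.
    by rewrite cd mul1r.
  - transitivity ((c ^+ 2 + d ^+ 2) * cy u)%R; first by ring.
    by rewrite cd mul1r.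
rewrite /reflection dotH.
transitivity (hreflect c d (hreflect c d v) - (2 * dot n v) *: hreflect c d (hreflect c d n))%R.
  by apply: vec3P; rewrite /hreflect !coordE; ring.
by rewrite !HH.
Qed.

Lemma borel3_plane n (c : R) : borel3 [set z | dot n z = c].
Proof.
have := borel3I (borel3C (borel3_halfspace n c)) (borel3C (borel3_halfspace (- n)%R (- c)%R)).
congr borel3; apply/seteqP; split => z /=; rewrite dotNl ltrN2.
  by case=> /negP; rewrite -leNgt => h1 /negP; rewrite -leNgt => h2; apply/eqP; rewrite eq_le h1 h2.
by move=> ->; rewrite ltxx.
Qed.

(** The mirror is the plane bisecting a and b; the formula for [dot m v] tells on which side of it v
    lies. *)
Lemma reflection_swap (a b : 'rV[R]_3) : S2 a -> S2 b -> a <> b ->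
  exists2 m, S2 m & forall v, dot a (reflection m v) = dot b v /\
    dot m v = ((dot b v - dot a v) / Num.sqrt (dot (b - a) (b - a)))%R.
Proof.
rewrite /sphere2/= => a1 b1 ab.
have ba0 : (0 < dot (b - a) (b - a))%R by apply: dot_gt0; rewrite subr_eq0 eq_sym; apply/eqP.
set q := dot (b - a) (b - a) in ba0 *; set s := Num.sqrt q.
have s2 : (s ^+ 2 = q)%R by rewrite sqr_sqrtr// ltW.
have s0 : (s != 0)%R by rewrite -sqrf_eq0 s2 gt_eqF.
have qE : q = (2 * (1 - dot a b))%R by rewrite /q !dotM a1 b1 (dotC b a); ring.
exists (s^-1 *: (b - a))%R.
  rewrite /= dotZl dotZr -/q -s2; field.
  exact: s0.
move=> v.
have mv : dot (s^-1 *: (b - a))%R v = ((dot b v - dot a v) / s)%R by rewrite dotZl dotBl mulrC.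
split=> //; rewrite /reflection dotBr dotZr mv dotZr dotBr a1.
have -> : (2 * ((dot b v - dot a v) / s) * (s^-1 * (dot a b - 1)) = - ((dot b v - dot a v) * (2 * (1 - dot a b)) / s ^+ 2))%R.
  by field.
by rewrite s2 -qE mulfK ?gt_eqF//; ring.
Qed.

(** A horizontal plane meets a single colatitude; a reflection carries the vertical axis to any
    other normal. *)
Lemma area_plane n (c : R) : n != 0%R -> area [set z | dot n z = c] = 0.
Proof.
move=> n0; have nn := dot_gt0 n0.
have s0 : (Num.sqrt (dot n n) != 0)%R by rewrite sqrtr_eq0 -ltNge.
pose e3 := vec3 0 0 (1 : R).
have e31 : S2 e3 by rewrite /sphere2/= dotE !coordE; ring.
have he3 (c' : R) : area [set z | dot e3 z = c'] = 0.
  rewrite area_sphint; last exact: borel3_plane.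
  rewrite /sphint integral_mkcond.
  rewrite (_ : (fun _ => _) = (fun t => (sin t)%:E * \int[mu]_(f in `[0%R, (pi *+ 2)%R[)
    G [set z | dot e3 z = c'] (sin t * cos f)%R (sin t * sin f)%R (cos t)) \_ ([set acos c'] `&` `[0%R, pi]%classic)).
    rewrite -integral_mkcond; apply: (@integral_Sset1 _ _ _ (acos c')).
    by move=> t [].
  apply/funext => t; rewrite !patchE.
  have [tp|tp] := boolP (t \in `[0%R, pi]%classic); last first.
    by rewrite memNset// => -[_ tp']; move: tp; rewrite mem_set.
  have [ta|ta] := eqVneq t (acos c').
    by rewrite -ta mem_set//; split => //; move: tp; rewrite inE.
  rewrite (_ : (t \in _ `&` _) = false); last first.
    by apply/negbTE/negP; rewrite inE => -[/= tc _]; rewrite tc eqxx in ta.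
  rewrite integral0_eq ?mule0// => f _; rewrite /G indicE memNset// /e3 /= dotE !coordE => h.
  move: ta; rewrite -h !mul0r !add0r mul1r cosK ?eqxx//.
  by move: tp; rewrite inE.
pose m := ((Num.sqrt (dot n n))^-1 *: n)%R.
have m1 : S2 m.
  rewrite /sphere2/= /m dotZl dotZr -{3}(sqr_sqrtr (ltW nn)); field.
  exact: s0.
have -> : [set z | dot n z = c] = [set z | dot m z = c / Num.sqrt (dot n n)]%R.
  apply/seteqP; split => z /=; rewrite /m dotZl; first by move=> ->; rewrite mulrC.
  by rewrite mulrC => /(mulIf _) -> //; rewrite invr_eq0.
have [me|me] := pselect (e3 = m); first by rewrite -me he3.
have [w w1 hw] := reflection_swap e31 m1 me.
rewrite -(he3 (c / Num.sqrt (dot n n))%R).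
have [_ <-] := area_preserving_reflection w1 (borel3_plane e3 (c / Num.sqrt (dot n n))%R).
by apply: eq_area => z _ /=; rewrite (hw z).1.
Qed.

End area.

(** * Areas of one and of two caps *)

Section cap_area.
Local Open Scope ereal_scope.
Context (R : realType).
Notation S2 := (sphere2 R).
Implicit Types (a b : 'rV[R]_3) (c : R).

Definition cap a c : set 'rV[R]_3 := [set z | (c < dot a z)%R].

Lemma borel3_cap a c : borel3 (cap a c). Proof. exact: borel3_halfspace. Qed.

Lemma reflectionK (m : 'rV[R]_3) : S2 m -> involutive (reflection m).
Proof.
rewrite /sphere2/= => m1 v; rewrite /reflection dotBr dotZr m1.
by apply: vec3P; rewrite !coordE; ring.
Qed.

Lemma dot_reflection (m u v : 'rV[R]_3) : S2 m ->
  dot (reflection m u) (reflection m v) = dot u v.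
Proof.
rewrite /sphere2/= => m1; rewrite /reflection !dotBl !dotBr !dotZl !dotZr m1 (dotC u m).
by ring.
Qed.

Lemma area_setID (A B : set 'rV[R]_3) : borel3 A -> borel3 B ->
  area A = area (A `&` B) + area (A `\` B).
Proof.
move=> mA mB; rewrite -areaU ?setUIDK//; [exact: borel3I|exact: borel3D|].
by move=> z _ [_ Bz] [_ nBz].
Qed.

(** Take the mirror exchanging b and b'. A point of the first intersection outside [cap b' c2] lies
    on the side of b, and a does not; reflecting such a point does not lower its product with a and
    lands in the second intersection, outside [cap b c2]. *)
Lemma area_capI_mono a b b' c1 c2 : S2 a -> S2 b -> S2 b' ->
  (dot a b <= dot a b')%R ->
  area (cap a c1 `&` cap b c2) <= area (cap a c1 `&` cap b' c2).
Proof.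
move=> a1 b1 b'1 abb'.
have [<-//|bb'] := pselect (b = b').
have [m m1 hm] := reflection_swap b1 b'1 bb'.
set s := Num.sqrt _ in hm.
have s0 : (0 < s)%R.
  by rewrite sqrtr_gt0; apply: dot_gt0; rewrite subr_eq0 eq_sym; apply/eqP.
have hm' v : dot b' (reflection m v) = dot b v.
  by rewrite -(hm _).1 reflectionK.
have mI x y : borel3 (cap a c1 `&` cap x y) by apply: borel3I; exact: borel3_cap.
rewrite (area_setID (mI b c2) (borel3_cap b' c2)).
rewrite (area_setID (mI b' c2) (borel3_cap b c2)).
rewrite setIAC leeD2l//.
have mY : borel3 ((cap a c1 `&` cap b' c2) `\` cap b c2) by apply: borel3D => //; exact: borel3_cap.
have mX : borel3 ((cap a c1 `&` cap b c2) `\` cap b' c2) by apply: borel3D => //; exact: borel3_cap.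
have [mT <-] := area_preserving_reflection m1 mY.
apply: le_area => // z z1 [[]]; rewrite /cap/= => az bz /negP; rewrite -leNgt => b'z.
split; last by rewrite /cap/= (hm z).1; apply/negP; rewrite -leNgt.
split; last by rewrite /cap/= hm'.
rewrite /cap/= /reflection dotBr dotZr (dotC a m) !(hm _).2 (dotC b' a) (dotC b a).
have h1 : ((dot b' z - dot b z) / s <= 0)%R by rewrite ler_pdivrMr// mul0r; lra.
have h2 : (0 <= (dot a b' - dot a b) / s)%R by apply: divr_ge0; [rewrite subr_ge0|exact: ltW].
by nra.
Qed.

Lemma area_capI_congr a a' b c1 c2 : S2 a -> S2 b -> S2 a' ->
  exists2 b', S2 b' & dot a b = dot a' b' /\
  area (cap a c1 `&` cap b c2) = area (cap a' c1 `&` cap b' c2).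
Proof.
move=> a1 b1 a'1.
have [<-|aa'] := pselect (a = a'); first by exists b.
have [m m1 hm] := reflection_swap a'1 a1 (fun h => aa' (esym h)).
exists (reflection m b); first by rewrite /sphere2/= dot_reflection.
split; first by rewrite (hm _).1.
have mI : borel3 (cap a' c1 `&` cap (reflection m b) c2) by apply: borel3I; exact: borel3_cap.
have [mT <-] := area_preserving_reflection m1 mI.
by apply: eq_area => z _; rewrite /cap /= (hm _).1 dot_reflection.
Qed.

Lemma area_cap_eq a b c : S2 a -> S2 b -> area (cap a c) = area (cap b c).
Proof.
move=> a1 b1; have [<-//|ab] := pselect (a = b).
have [m m1 hm] := reflection_swap a1 b1 ab.
have [mT <-] := area_preserving_reflection m1 (borel3_cap a c).
by apply: eq_area => z _; rewrite /cap /= (hm _).1.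
Qed.

Lemma area_capI_le a1 a2 b1 b2 c1 c2 : S2 a1 -> S2 a2 -> S2 b1 -> S2 b2 ->
  (dot a1 a2 <= dot b1 b2)%R ->
  area (cap a1 c1 `&` cap a2 c2) <= area (cap b1 c1 `&` cap b2 c2).
Proof.
move=> a11 a21 b11 b21 h.
have [b' b'1 [e ->]] := area_capI_congr c1 c2 a11 a21 b11.
by apply: area_capI_mono => //; rewrite -e.
Qed.

(** Inclusion and exclusion: caps of equal level have equal area, so a larger intersection means a
    smaller union. *)
Lemma area_capU_le a1 a2 b1 b2 c1 c2 : S2 a1 -> S2 a2 -> S2 b1 -> S2 b2 ->
  (dot a1 a2 <= dot b1 b2)%R ->
  area (cap b1 c1 `|` cap b2 c2) <= area (cap a1 c1 `|` cap a2 c2).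
Proof.
move=> a11 a21 b11 b21 h.
have mc a c := borel3_cap a c.
have E a a' : area (cap a c1 `|` cap a' c2) = area (cap a c1) + area (cap a' c2 `\` cap a c1).
  rewrite -areaU//; last by move=> z _ az [].
    by congr area; apply/seteqP; split => z /=; have [] := pselect (cap a c1 z); tauto.
  exact: borel3D.
rewrite !E (area_cap_eq c1 b11 a11) leeD2l//.
have D a a' : S2 a -> S2 a' -> area (cap a' c2 `\` cap a c1) = area (cap a2 c2) - area (cap a c1 `&` cap a' c2).
  move=> ha ha'; rewrite (area_cap_eq c2 a21 ha') (area_setID (mc a' c2) (mc a c1)).
  rewrite (setIC (cap a c1)) [X in X - _]addeC addeK//.
  by apply: area_fin_num; exact: borel3I.
rewrite !D// leeB// area_capI_le//.
Qed.

End cap_area.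

(** * Kirszbraun extension *)

Section kirszbraun.
Context (R : realType).
Notation V := 'rV[R]_3.
Notation S2 := (sphere2 R).

Lemma linear_term_ge0 (A B s0 : R) : 0 < s0 ->
  (forall s, 0 < s <= s0 -> 0 <= s * A + s ^+ 2 * B) -> 0 <= A.
Proof.
move=> s00 h; rewrite leNgt; apply/negP => A0.
pose s := Num.min s0 (- A / (2 * (1 + `|B|))).
have B1 : 0 < 2 * (1 + `|B|) by rewrite mulr_gt0// ltr_wpDr.
have s1 : 0 < s by rewrite lt_min s00 divr_gt0// oppr_gt0.
have ss : s <= s0 by rewrite ge_min lexx.
have sA : s * (2 * (1 + `|B|)) <= - A by rewrite -ler_pdivlMr// ge_min lexx orbT.
have /h : 0 < s <= s0 by rewrite s1.
have BB := ler_norm B; have nB := normr_ge0 B.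
have h1 : s * A + s ^+ 2 * B = s * (A + s * B) by ring.
rewrite h1 pmulr_rge0//.
have : s * B <= s * `|B| by rewrite ler_wpM2l// ltW.
by nra.
Qed.

Variables (I : finType) (a b : I -> V).
Hypothesis ab : forall i j, dot (a i) (a j) <= dot (b i) (b j).

Lemma weighted_contraction (l : I -> R) : (forall i, 0 <= l i) ->
  dot (\sum_i l i *: a i) (\sum_i l i *: a i) <=
  dot (\sum_i l i *: b i) (\sum_i l i *: b i).
Proof.
move=> l0; rewrite !sum_dotl; apply: ler_sum => i _; rewrite !sum_dotr.
apply: ler_sum => j _; rewrite !dotZl !dotZr.
by rewrite ler_wpM2l// ler_wpM2l.
Qed.

Variable x : V.
Hypothesis x1 : S2 x.

(** Minimise the sum of squared deficits over the ball. If deficits l_i remain at the minimum y, let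
    w be the sum of l_i b_i and u that of l_i a_i. Then |w| <= y.w by minimality, y.w < x.u since
    some deficit is positive, x.u <= |u| by Cauchy-Schwarz and |u| <= |w| by
    [weighted_contraction]. *)
Lemma kirszbraun_ball : exists2 y : V, dot y y <= 1 & forall i, dot x (a i) <= dot y (b i).
Proof.
pose g i (y : V) := Num.max 0 (dot x (a i) - dot y (b i)).
pose f (y : V) := \sum_i g i y ^+ 2.
have cf : continuous f.
  apply: sum_continuous3 => i y.
  have cg : {for y, continuous (g i)}.
    apply: (@continuous_max R V (cst 0) (fun y => dot x (a i) - dot y (b i)) y).
      exact: cst_continuous.
    have cd : (dot z (b i) @[z --> y]) --> dot y (b i).
      by under eq_fun do rewrite dotC; rewrite dotC; exact: dot_continuous.
    exact: (cvgB (cvg_cst _) cd).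
  exact: (cvgM cg cg).
have [|y /= y1 ymin] := attains_min _ (@compact_ball3 R 1) cf.
  by exists 0; rewrite /= dot0l.
exists y => //.
pose l i := g i y.
have l0 i : 0 <= l i by rewrite /l /g le_max lexx.
have gl i (e : R) z : dot z (b i) = e -> g i (y + z) ^+ 2 <= (l i - e) ^+ 2.
  move=> ze; rewrite /l /g dotDl ze; set t := dot x (a i) - dot y (b i).
  have -> : dot x (a i) - (dot y (b i) + e) = t - e by rewrite /t; ring.
  have [t0|t0] := leP 0 t; have [te0|te0] := leP 0 (t - e).
  - by [].
  - by rewrite expr0n/= sqr_ge0.
  - by nra.
  - by rewrite expr0n/= sqr_ge0.
pose w := \sum_i l i *: b i.
(* First variation of [f] at y towards another point y + d of the ball. *)
have var d : dot (y + d) (y + d) <= 1 -> dot d w <= 0.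
  move=> yd1.
  suff : 0 <= (- 2) * dot d w by lra.
  apply: (@linear_term_ge0 _ (\sum_i dot d (b i) ^+ 2) 1) => // s /andP[s0 s1].
  have : f y <= f (y + s *: d).
    apply: ymin => /=.
    have -> : y + s *: d = (1 - s) *: y + s *: (y + d).
      by rewrite scalerBl scale1r scalerDr addrA subrK.
    set z := y + d in yd1 *.
    have h1 : dot y z <= 1.
      have := cauchy_schwarz y z; have := dot_ge0 y; have := dot_ge0 z; nra.
    rewrite !dotDl !dotDr !dotZl !dotZr (dotC z y).
    have k1 : (1 - s) ^+ 2 * dot y y <= (1 - s) ^+ 2 by rewrite ler_piMr// sqr_ge0.
    have k2 : s ^+ 2 * dot z z <= s ^+ 2 by rewrite ler_piMr// sqr_ge0.
    have k3 : (s * (1 - s)) * dot y z <= s * (1 - s) by rewrite ler_piMr// mulr_ge0// ?subr_ge0// ltW.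
    by nra.
  have : f (y + s *: d) <= \sum_i (l i - s * dot d (b i)) ^+ 2.
    by apply: ler_sum => i _; apply: gl; rewrite dotZl.
  have -> : \sum_i (l i - s * dot d (b i)) ^+ 2 =
     f y + (s * (- 2 * dot d w) + s ^+ 2 * \sum_i dot d (b i) ^+ 2).
    rewrite /f /w sum_dotr !mulr_sumr -!big_split /=.
    by apply: eq_bigr => i _; rewrite dotZr -/(l i); ring.
  by lra.
have [all0 i|[i li]] : (forall i, l i = 0) \/ exists i, l i != 0.
- have [[i li]|h] := pselect (exists i, l i != 0); first by right; exists i.
  by left => i; apply/eqP; apply: contrapT => li; apply: h; exists i; apply/negP.
- have : g i y <= 0 by rewrite -/(l i) all0.
  by rewrite /g ge_max lexx/=; lra.
exfalso.
have lt1 : \sum_i l i * dot y (b i) < \sum_i l i * dot x (a i).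
  have term j : l j * dot y (b j) + l j ^+ 2 = l j * dot x (a j).
    rewrite /l /g; case: (leP 0 (dot x (a j) - dot y (b j))) => _; last by ring.
    by ring.
  rewrite -(eq_bigr _ (fun j _ => term j)) big_split/= ltrDl (bigD1 i)//=.
  rewrite ltr_pwDl//; last by apply: sumr_ge0 => j _; exact: sqr_ge0.
  by rewrite lt_neqAle sqr_ge0 andbT eq_sym sqrf_eq0.
have wy : dot y w = \sum_i l i * dot y (b i).
  by rewrite /w sum_dotr; apply: eq_bigr => j _; rewrite dotZr.
pose u := \sum_i l i *: a i.
have xu : dot x u = \sum_i l i * dot x (a i).
  by rewrite /u sum_dotr; apply: eq_bigr => j _; rewrite dotZr.
have uw := weighted_contraction l0; rewrite -/w -/u in uw.
have xu2 := cauchy_schwarz x u; rewrite (x1 : dot x x = 1) mul1r in xu2.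
have w0 : 0 < dot w w.
  rewrite lt_neqAle dot_ge0 andbT eq_sym; apply/eqP => /dot_eq0 w0.
  by move: wy xu xu2 uw lt1; rewrite w0 !dot0r; have := dot_ge0 u; nra.
(* move towards w / |w| *)
pose s := Num.sqrt (dot w w).
have s0 : 0 < s by rewrite sqrtr_gt0.
have s2 : s ^+ 2 = dot w w by rewrite sqr_sqrtr// ltW.
have := var (s^-1 *: w - y); rewrite addrC subrK dotZl dotZr -s2.
have -> : s^-1 * (s^-1 * s ^+ 2) = 1 by field; rewrite gt_eqF.
rewrite lexx => /(_ isT); rewrite dotBl dotZl -s2.
have -> : s^-1 * s ^+ 2 = s by field; rewrite gt_eqF.
move=> sy; have : s < dot x u by lra.
by nra.
Qed.
End kirszbraun.

Section positive_relation.
Context (R : realType).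
Notation V := 'rV[R]_3.
Variables (I : finType) (b : I -> V).
Hypothesis spread : forall v : V, v != 0 -> exists i, dot v (b i) < 0.

Lemma inv1D_le (t : R) : `|t| <= 1 / 2 -> (1 + t)^-1 <= 1 - t + 2 * t ^+ 2.
Proof.
rewrite ler_norml => /andP[t1 t2].
have t0 : 0 < 1 + t by lra.
rewrite -[leLHS]mul1r ler_pdivrMr//; nra.
Qed.

(** The gradient of v -> sum of exp (- v.b_i) vanishes at a minimum, which is a relation with
    strictly positive coefficients; [spread] makes the function coercive, so that a minimum
    exists. *)
Lemma positive_relation : exists2 l : I -> R, (forall i, 0 < l i) & \sum_i l i *: b i = 0.
Proof.
have dc i : continuous (fun v : V => dot v (b i)).
  exact: dot_continuousl.
pose psi (v : V) := \sum_i Num.max 0 (- dot v (b i)).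
have cpsi : continuous psi.
  apply: sum_continuous3 => i y.
  apply: (@continuous_max R V (cst 0) (fun y => - dot y (b i)) y).
    exact: cst_continuous.
  exact: (cvgN (dc i y)).
have [|v0 v01 v0min] := attains_min _ (@compact_sphere R) cpsi.
  by exists (vec3 1 0 0); rewrite /sphere2/= dotE !coordE; ring.
have psi0 : 0 < psi v0.
  have [i hi] := spread (sphere_neq0 v01).
  rewrite /psi (bigD1 i)//= ltr_pwDl//; first by rewrite lt_max oppr_gt0 hi orbT.
  by apply: sumr_ge0 => j _; rewrite le_max lexx.
pose Phi (v : V) := \sum_i expR (- dot v (b i)).
have cPhi : continuous Phi.
  apply: sum_continuous3 => i y.
  apply: (@continuous_comp _ _ _ (fun v : V => - dot v (b i)) (@expR R)).
    exact: (cvgN (dc i y)).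
  exact: continuous_expR.
(* On the sphere of radius rho, [Phi] is at least rho times [psi v0], that is 1 + |I|, which exceeds
   [Phi 0]; so the minimum over the ball is interior. *)
pose rho := (1 + #|I|%:R) / psi v0.
have rho0 : 0 < rho by rewrite divr_gt0// ltr_pwDl.
have [|v /= v1 vmin] := attains_min _ (@compact_ball3 R (rho ^+ 2)) cPhi.
  by exists 0; rewrite /= dot0l sqr_ge0.
have Phi0 : Phi 0 = #|I|%:R.
  rewrite /Phi (eq_bigr (fun=> 1)); first by rewrite sumr_const.
  by move=> i _; rewrite dot0l oppr0 expR0.
have inside : dot v v < rho ^+ 2.
  rewrite lt_neqAle v1 andbT; apply/negP => /eqP vr.
  have : Phi v <= #|I|%:R by rewrite -Phi0; apply: vmin; rewrite /= dot0l sqr_ge0.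
  apply/negP; rewrite -ltNge.
  pose u := rho^-1 *: v.
  have u1 : sphere2 R u.
    by rewrite /sphere2/= /u dotZl dotZr vr; field; rewrite gt_eqF.
  have psiu : psi v = rho * psi u.
    rewrite /psi mulr_sumr; apply: eq_bigr => i _.
    by rewrite maxr_pMr ?ltW// mulr0 mulrN /u dotZl mulVKf// gt_eqF.
  have : psi v <= Phi v.
    apply: ler_sum => i _; rewrite ge_max expR_ge0/=.
    by apply: (le_trans _ (expR_ge1Dx _)); rewrite lerDr.
  apply: lt_le_trans; rewrite psiu.
  have : rho * psi v0 <= rho * psi u by apply: ler_wpM2l; [exact: ltW|exact: v0min].
  apply: lt_le_trans; rewrite /rho divfK ?gt_eqF//.
  by rewrite ltrDr.
pose l i := expR (- dot v (b i)).
exists l => [i|]; first exact: expR_gt0.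
apply: dot_eq0.
set w := \sum_i l i *: b i.
have key d : dot d w <= 0.
  suff : 0 <= - dot d w by lra.
  pose E := 1 + \sum_i `|dot d (b i)|.
  have E0 : 0 < E by rewrite ltr_pwDl// sumr_ge0.
  pose gap := rho ^+ 2 - dot v v.
  have gap0 : 0 < gap by rewrite subr_gt0.
  pose K := 1 + 2 * `|dot v d| + dot d d.
  have K0 : 0 < K.
    by have := normr_ge0 (dot v d); have := dot_ge0 d; rewrite /K; lra.
  (* The three bounds allow s^2 <= s, make |s d.b_i| at most 1/2 as [inv1D_le] asks, and keep v + s
     d in the ball. *)
  pose s0 := Num.min 1 (Num.min (1 / 2 / E) (gap / K)).
  have s00 : 0 < s0 by rewrite !lt_min ltr01 !divr_gt0.
  apply: (@linear_term_ge0 _ _ (\sum_i 2 * l i * dot d (b i) ^+ 2) s0) => // s /andP[s_gt0].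
  rewrite !le_min => /andP[s1 /andP[sE sK]].
  rewrite ler_pdivlMr// in sE; rewrite ler_pdivlMr// in sK.
  have : Phi v <= Phi (v + s *: d).
    apply: vmin => /=; rewrite !dotDl !dotDr !dotZl !dotZr (dotC d v).
    have := ler_norm (dot v d); have := normr_ge0 (dot v d); have dd := dot_ge0 d.
    have : s ^+ 2 * dot d d <= s * dot d d by rewrite ler_wpM2r// expr2 ler_piMr// ltW.
    move: sK; rewrite /K /gap; nra.
  have : Phi (v + s *: d) <= \sum_i (l i - s * (l i * dot d (b i)) + s ^+ 2 * (2 * l i * dot d (b i) ^+ 2)).
    apply: ler_sum => i _; rewrite dotDl dotZl opprD expRD -/(l i) expRN.
    have -> : l i - s * (l i * dot d (b i)) + s ^+ 2 * (2 * l i * dot d (b i) ^+ 2) =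
      l i * (1 - s * dot d (b i) + 2 * (s * dot d (b i)) ^+ 2) by ring.
    rewrite ler_wpM2l ?expR_ge0//.
    have t12 : `|s * dot d (b i)| <= 1 / 2.
      rewrite normrM gtr0_norm//; apply: (le_trans _ sE); rewrite ler_wpM2l ?ltW//.
      rewrite /E (bigD1 i)//= ; have : 0 <= \sum_(j | j != i) `|dot d (b j)| by rewrite sumr_ge0.
      lra.
    apply: (le_trans _ (inv1D_le t12)).
    rewrite lef_pV2 ?posrE ?expR_gt0 ?expR_ge1Dx//.
    by move: t12; rewrite ler_norml; lra.
  rewrite !big_split/= sumrN -!mulr_sumr.
  have -> : \sum_i l i * dot d (b i) = dot d w.
    by rewrite sum_dotr; apply: eq_bigr => i _; rewrite dotZr.
  rewrite -/(Phi v); lra.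
by apply/eqP; rewrite eq_le key dot_ge0.
Qed.

End positive_relation.

Section kirszbraun_sphere.
Context (R : realType).
Notation V := 'rV[R]_3.
Notation S2 := (sphere2 R).

Lemma dot_mx (u v : V) : dot u v = (u *m v^T) 0 0.
Proof. by rewrite mxE; apply: eq_bigr => i _; rewrite mxE. Qed.

(** With the vectors as rows, A A^T = B B^T and a left inverse L of B make M = L A orthogonal with A
    = B M; the point x M^T then has the required products. *)
Lemma gram_isometry (I : finType) (a b : I -> V) (x : V) : S2 x ->
  (forall v : V, (forall i, dot v (b i) = 0) -> v = 0) ->
  (forall i j, dot (a i) (a j) = dot (b i) (b j)) ->
  exists2 y, S2 y & forall i, dot y (b i) = dot x (a i).
Proof.
move=> x1 span gram.
pose n := #|I|.
pose A := \matrix_(i < n) a (enum_val i); pose B := \matrix_(i < n) b (enum_val i).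
have rA i : row i A = a (enum_val i) by rewrite rowK.
have rB i : row i B = b (enum_val i) by rewrite rowK.
have gramAB : A *m A^T = B *m B^T.
  apply/matrixP => i j.
  have E (M : 'M[R]_(n, 3)) : (M *m M^T) i j = dot (row i M) (row j M).
    by rewrite mxE /dot; apply: eq_bigr => k _; rewrite !mxE.
  by rewrite !E !rA !rB gram.
have /row_freeP[L0 hL0] : row_free B^T.
  apply: inj_row_free => v vB; apply: span => i.
  rewrite dot_mx -(enum_rankK i) -rB.
  have E : (v *m B^T) 0 (enum_rank i) = 0 by rewrite vB mxE.
  by rewrite -[RHS]E [LHS]mxE [RHS]mxE; apply: eq_bigr => k _; rewrite !mxE.
pose L := L0^T.
have LB : L *m B = 1%:M by rewrite -[LHS]trmxK trmx_mul /L trmxK hL0 trmx1.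
pose M := L *m A.
have MAt : M *m A^T = B^T by rewrite /M -mulmxA gramAB mulmxA LB mul1mx.
have AMt : A *m M^T = B by rewrite -[LHS]trmxK trmx_mul trmxK MAt trmxK.
have MMt : M *m M^T = 1%:M by rewrite {1}/M -mulmxA AMt LB.
have D0 : A = B *m M.
  apply/eqP; rewrite -subr_eq0; apply/eqP.
  set D := A - B *m M.
  have DDt : D *m D^T = 0.
    have h1 : A *m (M^T *m B^T) = B *m B^T by rewrite mulmxA AMt.
    have h2 : B *m M *m A^T = B *m B^T by rewrite -mulmxA MAt.
    have h3 : B *m M *m (M^T *m B^T) = B *m B^T.
      by rewrite -mulmxA (mulmxA M) MMt mul1mx.
    by rewrite /D linearB/= trmx_mul mulmxBl !mulmxBr gramAB h1 h2 h3 !subrr.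
  apply/matrixP => i j; rewrite [RHS]mxE.
  have : dot (row i D) (row i D) = 0.
    have E : (D *m D^T) i i = 0 by rewrite DDt mxE.
    by rewrite -[RHS]E [RHS]mxE; apply: eq_bigr => k _; rewrite !mxE.
  by move/dot_eq0/(congr1 (fun r : V => r 0 j)); rewrite !mxE.
have MtM : M^T *m M = 1%:M by exact: mulmx1C.
exists (x *m M^T).
  by rewrite /sphere2/= dot_mx (trmx_mul x M^T) trmxK mulmxA -(mulmxA x M^T M) MtM mulmx1 -dot_mx.
move=> i; rewrite !dot_mx -(enum_rankK i) -rA -rB D0 row_mul (trmx_mul _ M).
by rewrite mulmxA.
Qed.

(** If the b_i lie in a closed half-space, the point of the ball is pushed along its normal.
    Otherwise the b_i satisfy a positive relation; since the weighted sum of the a_i is no longer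
    than that of the b_i, which is 0, each term of the difference of squares vanishes. The Gram
    matrices then agree and an isometry carries x over. *)
Theorem kirszbraun_sphere (I : finType) (a b : I -> V) (x : V) :
  (forall i, S2 (a i)) -> (forall i, S2 (b i)) ->
  (forall i j, dot (a i) (a j) <= dot (b i) (b j)) -> S2 x ->
  exists2 y, S2 y & forall i, dot x (a i) <= dot y (b i).
Proof.
move=> a1 b1 ab x1.
have [[v v0 hv]|nv] := pselect (exists2 v : V, v != 0 & forall i, 0 <= dot v (b i)).
  have [y y1 hy] := kirszbraun_ball ab x1.
  have [t t0 yt] := push_to_sphere y1 v0.
  exists (y + t *: v) => // i; rewrite dotDl dotZl.
  by rewrite (le_trans (hy i))// lerDl mulr_ge0.
have spread (v : V) : v != 0 -> exists i, dot v (b i) < 0.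
  move=> v0; apply: contrapT => h; apply: nv; exists v => // i.
  by rewrite leNgt; apply/negP => vi; apply: h; exists i.
have [l l0 lb] := positive_relation spread.
have lge i : 0 <= l i by exact: ltW.
have gram i j : dot (a i) (a j) = dot (b i) (b j).
  have sum0 : \sum_(k : I * I) l k.1 * (l k.2 * (dot (b k.1) (b k.2) - dot (a k.1) (a k.2))) = 0.
    have E (e : I -> V) : \sum_(k : I * I) l k.1 * (l k.2 * dot (e k.1) (e k.2)) =
       dot (\sum_i l i *: e i) (\sum_i l i *: e i).
      rewrite sum_dotl -(pair_bigA _ (fun i j => l i * (l j * dot (e i) (e j))))/=.
      apply: eq_bigr => i' _; rewrite sum_dotr; apply: eq_bigr => j' _.
      by rewrite dotZl dotZr.
    transitivity (dot (\sum_i l i *: b i) (\sum_i l i *: b i) -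
                  dot (\sum_i l i *: a i) (\sum_i l i *: a i)).
      by rewrite -!E -sumrB; apply: eq_bigr => k _; ring.
    have := weighted_contraction ab lge.
    rewrite lb dot0l; have := dot_ge0 (\sum_i l i *: a i); lra.
  have pos (k : I * I) : true -> 0 <= l k.1 * (l k.2 * (dot (b k.1) (b k.2) - dot (a k.1) (a k.2))).
    by move=> _; rewrite !mulr_ge0// subr_ge0.
  have /(_ (i, j) isT)/eqP := psumr_eq0P pos sum0.
  by rewrite /= !mulf_eq0 (gt_eqF (l0 i)) (gt_eqF (l0 j))/= subr_eq0 => /eqP ->.
have [|y y1 hy] := gram_isometry x1 _ gram.
  move=> v vb; apply/eqP; apply: contrapT => /negP/spread[i].
  by rewrite vb ltxx.
by exists y => // i; rewrite hy.
Qed.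

End kirszbraun_sphere.

(** * Parity of crossings with a polygonal path *)

Section crossing_parity.
Context (R : realType).
Implicit Types (p q c : R * R) (s : seq (R * R)).

(** This is (q.1 - p.1) times the height above c at which the line pq meets the vertical through
    c. *)
Definition orient p q c : R :=
  (p.2 - c.2) * (q.1 - c.1) - (q.2 - c.2) * (p.1 - c.1).

(** The edge meets the downward ray from c. The strict test counts a vertex on the vertical through
    c as lying to its left, the same way for both edges at that vertex. *)
Definition crosses_below p q c : bool :=
  ((c.1 < p.1) (+) (c.1 < q.1)) &&
  (if c.1 < q.1 then orient p q c < 0 else 0 < orient p q c).

Fixpoint crossing_parity p s c : bool :=
  if s is q :: s' then crosses_below p q c (+) crossing_parity q s' c else false.

Definition on_segment p q c := exists2 t : R, 0 <= t <= 1 &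
  c.1 = (1 - t) * p.1 + t * q.1 /\ c.2 = (1 - t) * p.2 + t * q.2.

Lemma orientC p q c : orient q p c = - orient p q c.
Proof. by rewrite /orient; ring. Qed.

Lemma crosses_belowC p q c : crosses_below q p c = crosses_below p q c.
Proof.
rewrite /crosses_below orientC oppr_lt0 oppr_gt0.
by case: (c.1 < p.1); case: (c.1 < q.1).
Qed.

Lemma on_segmentC p q c : on_segment p q c -> on_segment q p c.
Proof.
by move=> [t t01 [h1 h2]]; exists (1 - t); [lra|split; rewrite ?h1 ?h2; ring].
Qed.

Lemma on_segment_orient0 p q c : orient p q c = 0 ->
  ((c.1 < p.1) (+) (c.1 < q.1)) -> on_segment p q c.
Proof.
wlog : p q / c.1 < q.1.
  move=> wl o0; case: (ltP c.1 q.1) => qc; last first.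
    case: (ltP c.1 p.1) => // pc _; apply/on_segmentC/wl => //.
      by rewrite orientC o0 oppr0.
    by rewrite pc ltNge qc.
  by move=> pq; apply: wl => //; rewrite qc.
move=> qc o0; rewrite qc addbT -leNgt => pc.
have pq : p.1 < q.1 by lra.
have d0 : q.1 - p.1 != 0 by lra.
exists ((c.1 - p.1) / (q.1 - p.1)).
  by apply/andP; split; [apply: divr_ge0; lra|rewrite ler_pdivrMr; lra].
split; first by field.
apply: (mulfI d0); move: o0; rewrite /orient.
have -> : (q.1 - p.1) * ((1 - (c.1 - p.1) / (q.1 - p.1)) * p.2 +
  (c.1 - p.1) / (q.1 - p.1) * q.2) = (q.1 - c.1) * p.2 + (c.1 - p.1) * q.2 by field.
by lra.
Qed.

Let near_imp (P Q : R * R -> Prop) c0 : (forall c, P c -> Q c) ->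
  (\forall c \near c0, P c) -> \forall c \near c0, Q c.
Proof. by move=> PQ; apply: filterS. Qed.

Let near_and (P Q : R * R -> Prop) c0 : (\forall c \near c0, P c) ->
  (\forall c \near c0, Q c) -> \forall c \near c0, P c /\ Q c.
Proof. by move=> hP hQ; near=> c; split; near: c. Unshelve. all: by end_near. Qed.

Let near_pos (f : R * R -> R) c0 : {for c0, continuous f} -> 0 < f c0 ->
  \forall c \near c0, 0 < f c.
Proof. by move=> cf f0; exact: (cvgr_gt _ cf _ f0). Qed.

Let cont_fst c0 : {for c0, continuous (fun c : R * R => c.1)}.
Proof. by case: c0 => a b; exact: cvg_fst. Qed.
Let cont_snd c0 : {for c0, continuous (fun c : R * R => c.2)}.
Proof. by case: c0 => a b; exact: cvg_snd. Qed.

Lemma orient_continuous p q c0 : {for c0, continuous (orient p q)}.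
Proof.
have h (r : R) : {for c0, continuous (fun c : R * R => r - c.1)}.
  exact: (cvgB (cvg_cst _) (@cont_fst c0)).
have k (r : R) : {for c0, continuous (fun c : R * R => r - c.2)}.
  exact: (cvgB (cvg_cst _) (@cont_snd c0)).
exact: (cvgB (cvgM (k p.2) (h q.1)) (cvgM (k q.2) (h p.1))).
Qed.

Let near_side p c0 : p.1 != c0.1 -> \forall c \near c0, (c.1 < p.1) = (c0.1 < p.1).
Proof.
rewrite neq_lt => /orP[pc|pc].
  have : \forall c \near c0, 0 < c.1 - p.1.
    by apply: near_pos; [exact: (cvgB (@cont_fst c0) (cvg_cst _))|lra].
  by apply: filterS => c cp; rewrite !ltNge ltW ?ltW//; lra.
have : \forall c \near c0, 0 < p.1 - c.1.
  by apply: near_pos; [exact: (cvgB (cvg_cst _) (@cont_fst c0))|lra].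
by apply: filterS => c; rewrite subr_gt0 pc => ->.
Qed.

Let near_orient p q c0 : orient p q c0 != 0 ->
  \forall c \near c0, (orient p q c < 0) = (orient p q c0 < 0) /\
                      (0 < orient p q c) = (0 < orient p q c0).
Proof.
have co := @orient_continuous p q c0.
rewrite neq_lt => /orP[ne|ne].
  have : \forall c \near c0, 0 < - orient p q c.
    by apply: near_pos; [exact: (cvgN co)|lra].
  apply: filterS => c cp; rewrite ne; split; first by apply/idP; lra.
  by apply/idP/idP; lra.
have : \forall c \near c0, 0 < orient p q c by exact: near_pos.
apply: filterS => c cp; rewrite ne; split; last by apply/idP.
by apply/idP/idP; lra.
Qed.

(* [vertex_jump c0 p c]: as c moves away from c0, the vertex p (lying on the ray
   below c0) changes side; the two edges at p feel this change simultaneously. *)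
Definition vertex_jump c0 p c : bool :=
  [&& p.1 == c0.1, p.2 < c0.2 & c.1 < p.1].

Let edge_jump_vertex p q c0 : ~ on_segment p q c0 -> p.1 = c0.1 -> q.1 != c0.1 ->
  \forall c \near c0, crosses_below p q c (+) crosses_below p q c0 = vertex_jump c0 p c.
Proof.
move=> nseg p1 q1.
have p2 : p.2 != c0.2.
  apply/eqP => p2; apply: nseg; exists 0; first by rewrite lexx ler01.
  by rewrite p1 p2; split; ring.
have oE : orient p q c0 = (p.2 - c0.2) * (q.1 - c0.1) by rewrite /orient p1; ring.
have o0 : orient p q c0 != 0 by rewrite oE mulf_neq0// subr_eq0.
near=> c.
have sq : (c.1 < q.1) = (c0.1 < q.1) by near: c; exact: near_side.
have [hN hP] : (orient p q c < 0) = (orient p q c0 < 0) /\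
              (0 < orient p q c) = (0 < orient p q c0) by near: c; exact: near_orient.
rewrite /crosses_below /vertex_jump sq hN hP p1 ltxx eqxx /= oE.
move: (p2) (q1); rewrite !neq_lt => /orP[P2|P2] /orP[Q1|Q1].
- have h : 0 < (p.2 - c0.2) * (q.1 - c0.1) by nra.
  by rewrite P2 (ltNge c0.1) (ltW Q1)/= h; case: (c.1 < c0.1).
- have h : (p.2 - c0.2) * (q.1 - c0.1) < 0 by nra.
  by rewrite P2 Q1 h; case: (c.1 < c0.1).
- have h : (p.2 - c0.2) * (q.1 - c0.1) < 0 by nra.
  by rewrite (ltNge c0.1) (ltW Q1)/= (ltNge 0) (ltW h) (ltNge p.2) (ltW P2) /= andbF.
- have h : 0 < (p.2 - c0.2) * (q.1 - c0.1) by nra.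
  by rewrite Q1 (ltNge _ 0) (ltW h) (ltNge p.2) (ltW P2) /= andbF.
Unshelve. all: by end_near.
Qed.

(** If no end point is on the vertical through c0, sides and orientation are stable near c0. If
    exactly one is, its side alone decides, and it matters only when the vertex is below c0. If both
    are, they lie both below or both above c0. *)
Lemma edge_jump p q c0 : ~ on_segment p q c0 ->
  \forall c \near c0, crosses_below p q c (+) crosses_below p q c0 =
    vertex_jump c0 p c (+) vertex_jump c0 q c.
Proof.
move=> nseg; have [p1|p1] := eqVneq p.1 c0.1; have [q1|q1] := eqVneq q.1 c0.1.
- apply: (@nearW _ (nbhs c0)) => c; rewrite /crosses_below p1 q1 !addbb /= /vertex_jump p1 q1 eqxx /=.
  have ne2 : (p.2 < c0.2) = (q.2 < c0.2); last by rewrite ne2 addbb.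
  apply/idP/idP => h; rewrite ltNge; apply/negP => h'; apply: nseg.
    exists ((c0.2 - p.2) / (q.2 - p.2)); first by
      apply/andP; split; [apply: divr_ge0; lra|rewrite ler_pdivrMr; lra].
    by rewrite p1 q1; split; field; lra.
  exists ((p.2 - c0.2) / (p.2 - q.2)); first by
    apply/andP; split; [apply: divr_ge0; lra|rewrite ler_pdivrMr; lra].
  by rewrite p1 q1; split; field; lra.
- have := edge_jump_vertex nseg p1 q1; apply: near_imp => c ->.
  by rewrite {3}/vertex_jump (negbTE q1) addbF.
- have nseg' : ~ on_segment q p c0 by move=> /on_segmentC.
  have := edge_jump_vertex nseg' q1 p1; apply: near_imp => c.
  by rewrite !(crosses_belowC p q) => ->; rewrite /(vertex_jump c0 p c) (negbTE p1).
case xr : ((c0.1 < p.1) (+) (c0.1 < q.1)).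
  have o0 : orient p q c0 != 0.
    by apply/eqP => o0; apply: nseg; apply: on_segment_orient0; rewrite ?xr.
  have := near_and (near_and (near_side p1) (near_side q1)) (near_orient o0).
  apply: near_imp => c [[sp sq] [hN hP]].
  rewrite /vertex_jump (negbTE p1) (negbTE q1)/= /crosses_below sp sq hN hP.
  by rewrite addbb.
have := near_and (near_side p1) (near_side q1).
apply: near_imp => c [sp sq].
by rewrite /vertex_jump (negbTE p1) (negbTE q1)/= /crosses_below sp sq xr.
Qed.

Fixpoint off_path p s c : Prop :=
  if s is q :: s' then ~ on_segment p q c /\ off_path q s' c else True.

(** The jumps of consecutive edges telescope and leave those of the two ends of the path. *)
Lemma crossing_parity_jump p s c0 : off_path p s c0 ->
  \forall c \near c0, crossing_parity p s c (+) crossing_parity p s c0 =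
    vertex_jump c0 p c (+) vertex_jump c0 (last p s) c.
Proof.
elim: s p => [|q s IH] p /=; first by move=> _; apply: (@nearW _ (nbhs c0)) => c; rewrite addbb.
move=> [nseg /IH off].
have := near_and (edge_jump nseg) off; apply: near_imp => c [h1 h2].
move: h1 h2; case: (crosses_below p q c); case: (crosses_below p q c0);
  case: (crossing_parity q s c); case: (crossing_parity q s c0);
  case: (vertex_jump c0 p c); case: (vertex_jump c0 q c);
  by case: (vertex_jump c0 (last q s) c).
Qed.

(** The path is open, but an end that is not below c0 causes no jump. *)
Lemma crossing_parity_locally_constant p s c0 : off_path p s c0 ->
  c0.2 <= p.2 -> c0.2 <= (last p s).2 ->
  \forall c \near c0, crossing_parity p s c = crossing_parity p s c0.
Proof.
move=> off hp hl; have := crossing_parity_jump off; apply: near_imp => c.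
rewrite /vertex_jump !ltNge hp hl !andbF /=.
by case: (crossing_parity p s c); case: (crossing_parity p s c0).
Qed.

(** Such a point either has all vertices on one side or lies below all of them. *)
Lemma crossing_parity_far p s c (M : R) :
  (forall r, r \in p :: s -> `|r.1| <= M /\ `|r.2| <= M) ->
  M < `|c.1| \/ c.2 < - M -> crossing_parity p s c = false.
Proof.
elim: s p => [//|q s IH] p hM hc /=.
rewrite IH//; last by move=> r rs; apply: hM; rewrite in_cons rs orbT.
rewrite addbF.
have [p1 p2] := hM p (mem_head _ _).
have [q1 q2] : `|q.1| <= M /\ `|q.2| <= M by apply: hM; rewrite !in_cons eqxx orbT.
move: p1 p2 q1 q2; rewrite !ler_norml => /andP[p1 p1'] /andP[p2 p2'] /andP[q1 q1'] /andP[q2 q2'].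
case: hc => [|hc].
  move=> hc; rewrite /crosses_below.
  have [c0|c0] := lerP 0 c.1.
    rewrite ger0_norm// in hc.
    by rewrite (ltNge _ p.1) (ltNge _ q.1) (le_trans p1' (ltW hc)) (le_trans q1' (ltW hc)).
  rewrite ltr0_norm// in hc.
  have -> : c.1 < p.1 by lra.
  by have -> : c.1 < q.1 by lra.
rewrite /crosses_below /orient.
case: (ltP c.1 p.1) => h1; case: (ltP c.1 q.1) => h2 //=.
  by apply/negbTE; rewrite -leNgt; nra.
by apply/negbTE; rewrite -leNgt; nra.
Qed.

(** Each edge that changes sides passes below c, so only the sides of the two ends remain. *)
Lemma crossing_parity_lower p s c :
  off_path p s c -> (forall r, r \in p :: s -> r.2 <= c.2) ->
  crossing_parity p s c = (c.1 < p.1) (+) (c.1 < (last p s).1).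
Proof.
elim: s p => [|q s IH] p /=; first by rewrite addbb.
move=> [nseg off] hr; rewrite IH//; last by move=> r rs; apply: hr; rewrite in_cons rs orbT.
have -> : crosses_below p q c = (c.1 < p.1) (+) (c.1 < q.1).
  have p2 : p.2 <= c.2 by apply: hr; rewrite mem_head.
  have q2 : q.2 <= c.2 by apply: hr; rewrite !in_cons eqxx orbT.
  rewrite /crosses_below; case xr : (_ (+) _) => //=.
  have o0 : orient p q c != 0.
    by apply/eqP => o0; apply: nseg; apply: on_segment_orient0; rewrite ?xr.
  move: xr o0; rewrite /orient; case: (ltP c.1 p.1) => h1; case: (ltP c.1 q.1) => h2 //= _ o0.
    by rewrite lt_neqAle eq_sym o0 /=; nra.
  by rewrite lt_neqAle o0 /=; nra.
by rewrite addbA addbK.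
Qed.

End crossing_parity.

(** * Chains of caps *)

Lemma connected_locally_constant (T : topologicalType) (A : set T) (P : T -> Prop) :
  connected A -> (exists2 x, A x & P x) ->
  (forall x, A x -> P x -> \forall y \near x, A y -> P y) ->
  (forall x, A x -> ~ P x -> \forall y \near x, A y -> ~ P y) ->
  forall x, A x -> P x.
Proof.
move=> cA [x0 Ax0 Px0] hP hN.
have : A `&` [set x | P x] = A; last by move=> <- x [].
apply: cA.
- by exists x0.
- exists (interior [set y | A y -> P y]); first exact: open_interior.
  apply/seteqP; split => x [Ax /= Px]; split => //; first exact: hP.
  by apply: (interior_subset Px).
- exists (~` (interior [set y | A y -> ~ P y])).
    by apply: open_closedC; exact: open_interior.
  apply/seteqP; split => x [Ax /= Px]; split => //.
    by move=> /interior_subset /(_ Ax).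
  by apply: contrapT => nPx; apply: Px; exact: hN.
Qed.

Section convex_coordinates.
Context (R : realType).
Implicit Types (a b c x m p q : 'rV[R]_3) (t : R).

Lemma dot_comb a t p q :
  dot a ((1 - t) *: p + t *: q) = (1 - t) * dot a p + t * dot a q.
Proof. by rewrite dotDr !dotZr. Qed.

Lemma dotZZ t p : dot (t *: p) (t *: p) = t ^+ 2 * dot p p.
Proof. by rewrite dotZl dotZr; ring. Qed.

Lemma dot_basis_inj a b c x m : dot a (cross b c) != 0 ->
  dot a x = dot a m -> dot b x = dot b m -> dot c x = dot c m -> x = m.
Proof.
move=> D0 ax bx cx; apply/eqP; rewrite -subr_eq0; apply/eqP.
have := cross_basis a b c (x - m).
rewrite !dotBr ax bx cx !subrr !scale0r !addr0 => /eqP.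
by rewrite scaler_eq0 (negbTE D0)/= => /eqP.
Qed.

Lemma dotdot_convex t p q : 0 <= t <= 1 ->
  dot ((1 - t) *: p + t *: q) ((1 - t) *: p + t *: q) <=
  (1 - t) * dot p p + t * dot q q.
Proof.
move=> /andP[t0 t1].
have -> : dot ((1 - t) *: p + t *: q) ((1 - t) *: p + t *: q) =
    (1 - t) * dot p p + t * dot q q - t * (1 - t) * dot (p - q) (p - q).
  by rewrite !dotBr !dotDr !dotZr !dotDl !dotNl !dotZl (dotC q p); ring.
by rewrite lerBlDr lerDl mulr_ge0 ?dot_ge0// mulr_ge0// subr_ge0.
Qed.

Lemma dot_sum3_le a b c : dot (a + b + c) (a + b + c) <= 3 * (dot a a + dot b b + dot c c).
Proof.
have h1 := dot_ge0 (a - b); have h2 := dot_ge0 (b - c); have h3 := dot_ge0 (a - c).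
move: h1 h2 h3; rewrite !dotBr !dotBl !dotDr !dotDl (dotC b a) (dotC c a) (dotC c b).
by lra.
Qed.

End convex_coordinates.

Section chain.
Context (R : realType).
Notation V := 'rV[R]_3.
Notation S2 := (sphere2 R).

Definition ev (f : V * R) (z : V) : R := dot f.1 z - f.2.

Lemma ev_continuous f : continuous (ev f).
Proof. by move=> z; exact: (cvgB (@dot_continuous R f.1 z) (cvg_cst _)). Qed.

Variables (I : finType) (F : I -> V * R).

Definition core : set V := [set z | S2 z /\ forall i, ev (F i) z <= 0].

(** A cap contained in {f > 0} is linked to nothing, not even to itself; link classes are those of
    [connect], which is reflexive. *)
Definition linked (f : V * R) : rel I := fun i j =>
  `[< exists z, [/\ S2 z, 0 < ev (F i) z, 0 < ev (F j) z & ev f z <= 0] >].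

Lemma linked_sym f : symmetric (linked f).
Proof. by move=> i j; apply/asboolP/asboolP => -[z [? ? ? ?]]; exists z. Qed.

Variables (f g : V * R) (u v : V).
Hypothesis Ccon : connected core.
Hypothesis f_core : forall z, core z -> ev f z <= 0.
Hypothesis Cu : core u.
Hypothesis Cv : core v.
Hypothesis uv : u <> v.
Hypothesis fu : ev f u = 0.
Hypothesis fv : ev f v = 0.
Hypothesis gu : ev g u = 0.
Hypothesis gv : ev g v = 0.
Hypothesis fg : cross f.1 g.1 != 0.

Let u1 : S2 u. Proof. by case: Cu. Qed.
Let v1 : S2 v. Proof. by case: Cv. Qed.

(** The chord uv has the direction of the cross product of f.1 and g.1, and it is not tangent to the
    sphere at u. *)
Lemma independent_at_contact : dot g.1 (cross f.1 u) != 0.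
Proof.
have E : dot g.1 (cross f.1 u) = - dot u (cross f.1 g.1).
  by rewrite !dotE /cross !coordE; ring.
rewrite E oppr_eq0; apply/eqP => h.
have nf : dot f.1 (v - u) = 0 by move: fu fv; rewrite /ev dotBr; lra.
have ng : dot g.1 (v - u) = 0 by move: gu gv; rewrite /ev dotBr; lra.
pose w := cross f.1 g.1.
have par : dot w w *: (v - u) = dot w (v - u) *: w.
  have E1 : cross w (v - u) = dot f.1 (v - u) *: g.1 - dot g.1 (v - u) *: f.1.
    by rewrite /w /cross; apply: vec3P; rewrite !dotE !coordE; ring.
  have : dot w w *: (v - u) = dot w (v - u) *: w + cross (cross w (v - u)) w.
    by rewrite /cross; apply: vec3P; rewrite !dotE !coordE; ring.
  rewrite E1 nf ng !scale0r subrr => ->.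
  by apply: vec3P; rewrite /cross !coordE; ring.
have ww : dot w w != 0 by apply: contra fg => /eqP/dot_eq0 w0; rewrite -/w w0.
have k0 : dot w (v - u) * dot w u = dot w w * (dot u v - 1).
  by rewrite -dotZl -par dotZl dotBl (dotC v u) (u1 : dot u u = 1).
have k1 : dot u v - 1 != 0 by rewrite subr_eq0 lt_eqF// sphere_dot_lt1.
by have := mulf_neq0 ww k1; rewrite -k0 (dotC w u) h mulr0 eqxx.
Qed.

Let s (z : V) : R := 1 - dot z u.
Let w (z : V) : V := (s z)^-1 *: (z - u).
(** Stereographic projection from u, in the coordinates g and f: the circle f = 0 becomes the
    horizontal axis, v the origin, and the core without u lies in the lower half-plane. *)
Definition proj (z : V) : R * R := (ev g z / s z, ev f z / s z).

Let s_gt0 z : S2 z -> z <> u -> 0 < s z.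
Proof. by move=> z1 zu; rewrite subr_gt0 sphere_dot_lt1. Qed.

Let dot_wu z : S2 z -> z <> u -> dot u (w z) = - 1.
Proof.
move=> z1 zu; rewrite /w dotZr dotBr (u1 : dot u u = 1) (dotC u z).
have := s_gt0 z1 zu; rewrite /s => s0.
by rewrite -[dot z u - 1]opprB mulrN mulVf// gt_eqF.
Qed.

Let dot_ww z : S2 z -> z <> u -> dot (w z) (w z) = 2 / s z.
Proof.
move=> z1 zu; rewrite /w dotZl dotZr dist_sphere// -/(s z).
by field; rewrite gt_eqF// s_gt0.
Qed.

Let ev_w (h : V * R) z : S2 z -> z <> u -> ev h z = ev h u + s z * dot h.1 (w z).
Proof.
move=> z1 zu; rewrite /w dotZr mulVKf ?gt_eqF ?s_gt0// /ev dotBr; ring.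
Qed.

Let projE z : S2 z -> z <> u -> proj z = (dot g.1 (w z), dot f.1 (w z)).
Proof.
move=> z1 zu; rewrite /proj (ev_w g z1 zu) (ev_w f z1 zu) fu gu !add0r.
have s0 : s z != 0 by rewrite gt_eqF ?s_gt0.
by congr (_, _); rewrite mulrAC divff// mul1r.
Qed.

(* In the coordinate [w] a cap avoiding [u] is convex. *)
Let cap_segment k y z c : S2 y -> S2 z -> 0 < ev (F k) y -> 0 < ev (F k) z ->
  core c -> c <> u -> ~ on_segment (proj y) (proj z) (proj c).
Proof.
move=> y1 z1 ky kz [c1 Cc] cu [t /andP[t0 t1]].
have fku : ev (F k) u <= 0 by case: Cu.
have yu : y <> u by move=> yu; move: ky; rewrite yu ltNge fku.
have zu : z <> u by move=> zu; move: kz; rewrite zu ltNge fku.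
rewrite !projE//= => -[hg hf].
pose m := (1 - t) *: w y + t *: w z.
have wm : w c = m.
  apply: (dot_basis_inj independent_at_contact).
  - by rewrite [RHS]dot_comb.
  - by rewrite [RHS]dot_comb.
  - by rewrite [RHS]dot_comb !dot_wu//; ring.
(* Since |w|^2 = 2 / s, dividing [ev (F k)] by s gives a quadratic in w with leading coefficient
   [ev (F k) u / 2]. As u is in the core this is nonpositive, so the quadratic is concave. *)
pose H x := dot (F k).1 (w x) + ev (F k) u * (dot (w x) (w x) / 2).
have HE x : S2 x -> x <> u -> ev (F k) x = s x * H x.
  move=> x1 xu; rewrite ev_w// /H dot_ww//; field.
  by rewrite gt_eqF// s_gt0.
have Hy : 0 < H y by move: ky; rewrite HE// pmulr_rgt0// s_gt0.
have Hz : 0 < H z by move: kz; rewrite HE// pmulr_rgt0// s_gt0.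
have Hc : H c <= 0 by have := Cc k; rewrite HE// pmulr_rle0// s_gt0.
have conv : dot m m <= (1 - t) * dot (w y) (w y) + t * dot (w z) (w z).
  by apply: dotdot_convex; rewrite t0 t1.
have : (1 - t) * H y + t * H z <= H c.
  by rewrite /H wm {1}/m dot_comb; nra.
have : 0 < (1 - t) * H y + t * H z.
  have [->|t00] := eqVneq t 0; first by lra.
  have : 0 < t by lra.
  nra.
by lra.
Qed.

Let proj_continuous z : S2 z -> z <> u -> {for z, continuous proj}.
Proof.
move=> z1 zu.
have cs : {for z, continuous (fun z => s z)}.
  exact: (cvgB (cvg_cst _) (@dot_continuousl R u z)).
have s0 : s z != 0 by rewrite gt_eqF ?s_gt0.
have c1 (h : V * R) : {for z, continuous (fun z => ev h z / s z)}.
  exact: (cvgM (@ev_continuous h z) (cvgV s0 cs)).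
exact: (cvg_pair (c1 g) (c1 f)).
Qed.

(** Near u the vector w is long, because |w|^2 = 2 / s. The height of core points is never positive,
    so they leave every box sideways or downwards. *)
Let proj_far (M : R) : \forall c \near u, core c -> c <> u ->
  M < `|(proj c).1| \/ (proj c).2 < - M.
Proof.
pose D := dot g.1 (cross f.1 u).
have D0 : 0 < D ^+ 2 by rewrite exprn_even_gt0//= independent_at_contact.
pose q1 := dot (cross f.1 u) (cross f.1 u).
pose q2 := dot (cross u g.1) (cross u g.1).
pose q3 := dot (cross g.1 f.1) (cross g.1 f.1).
have [q10 q20 q30] : [/\ 0 <= q1, 0 <= q2 & 0 <= q3] by split; exact: dot_ge0.
pose K := 3 * (M ^+ 2 * (q1 + q2) + q3) + 1.
have K0 : 0 < K.
  by rewrite ltr_wpDl// mulr_ge0// addr_ge0// mulr_ge0 ?sqr_ge0// addr_ge0.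
have near_s : \forall c \near u, s c < D ^+ 2 / K.
  have cs : {for u, continuous (fun z => s z)}.
    exact: (cvgB (cvg_cst _) (@dot_continuousl R u u)).
  apply: (cvgr_lt _ cs); rewrite /s (u1 : dot u u = 1) subrr.
  by rewrite divr_gt0.
apply: filterS near_s => c sc [c1 Cc] cu.
have [//|X] := ltP M `|(proj c).1|; first by left.
right; rewrite ltNge; apply/negP => Y.
have Y0 : (proj c).2 <= 0.
  by rewrite /proj /= pmulr_lle0 ?invr_gt0 ?s_gt0//; exact: f_core.
move: X Y Y0; rewrite projE//=; set X := dot g.1 _; set Y := dot f.1 _ => hX hY hY0.
have E := cross_basis g.1 f.1 u (w c); rewrite dot_wu// -/X -/Y -/D in E.
have X2 : X ^+ 2 <= M ^+ 2.
  by rewrite -(ger0_norm (sqr_ge0 X)) normrX ler_sqr ?nnegrE ?(le_trans _ hX).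
have Y2 : Y ^+ 2 <= M ^+ 2 by nra.
have := dot_sum3_le (X *: cross f.1 u) (Y *: cross u g.1) (-1 *: cross g.1 f.1).
rewrite -E (dotZZ D) (dotZZ X) (dotZZ Y) (dotZZ (-1)) dot_ww// -/q1 -/q2 -/q3.
have sc0 := s_gt0 c1 cu.
have : 2 * K < D ^+ 2 * (2 / s c).
  move: sc; rewrite ltr_pdivlMr// => sc.
  have -> : D ^+ 2 * (2 / s c) = (2 * D ^+ 2) / s c by field; rewrite gt_eqF.
  by rewrite ltr_pdivlMr//; nra.
rewrite /K; nra.
Qed.

Fixpoint cap_path y (p : seq V) : Prop :=
  if p is z :: p' then
    [/\ exists k, 0 < ev (F k) y /\ 0 < ev (F k) z, S2 z, ev f z <= 0 & cap_path z p']
  else True.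

Let off_cap_path y p c : S2 y -> cap_path y p -> core c -> c <> u ->
  off_path (proj y) (map proj p) (proj c).
Proof.
elim: p y => [//|z p IH] y y1 /= [[k [ky kz]] z1 _ pz] Cc cu; split.
  exact: (cap_segment y1 z1 ky kz).
exact: IH.
Qed.

(** The path passes below v from one side to the other, so its parity at v is odd; near u it is
    even. Away from u the parity is locally constant on the core, which the path avoids. This
    contradicts the connectedness of the core. *)
Let no_cap_path y p : S2 y -> ev f y = 0 -> 0 < ev g y -> cap_path y p ->
  ev f (last y p) = 0 -> ev g (last y p) < 0 -> False.
Proof.
move=> y1 fy gy py fl gl.
have core_neg c : core c -> c <> u -> (proj c).2 <= 0.
  by move=> Cc cu; rewrite /proj /= pmulr_lle0 ?invr_gt0 ?s_gt0//; [exact: f_core|case: Cc].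
have [sph ne_u fneg] : [/\ forall z, z \in y :: p -> S2 z, forall z, z \in y :: p -> z <> u &
    forall z, z \in y :: p -> ev f z <= 0].
  have y_u : y <> u by move=> yu; move: gy; rewrite yu gu ltxx.
  have : ev f y <= 0 by rewrite fy.
  move: y1 y_u py => {fy gy fl gl}; elim: p y => [|z p IH] y y1 yu /=.
    by move=> _ fy; split => x; rewrite inE => /eqP ->.
  move=> [[k [ky kz]] z1 fz pz] fy.
  have zu : z <> u by move=> zu; move: kz; rewrite zu ltNge; case: Cu => _ ->.
  have [h1 h2 h3] := IH z z1 zu pz fz.
  by split => x; rewrite in_cons => /predU1P[->//|xp]; [exact: h1|exact: h2|exact: h3].
have core_neg' z : z \in y :: p -> (proj z).2 <= 0.
  move=> zp; rewrite /proj /= pmulr_lle0 ?invr_gt0 ?s_gt0//; [exact: fneg|exact: sph|exact: ne_u].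
pose par c := crossing_parity (proj y) (map proj p) (proj c).
have y2 : (proj y).2 = 0 by rewrite /proj /= fy mul0r.
have l2 : (last (proj y) (map proj p)).2 = 0 by rewrite last_map /proj /= fl mul0r.
have locpar c : core c -> c <> u -> \forall c' \near c, c' <> u /\ par c' = par c.
  move=> Cc cu; have [c1 _] := Cc.
  have h1 : \forall c' \near c, c' <> u.
    have cs : {for c, continuous (fun z => s z)}.
      exact: (cvgB (cvg_cst _) (@dot_continuousl R u c)).
    have : \forall c' \near c, 0 < s c' by apply: (cvgr_gt _ cs); exact: s_gt0.
    by apply: filterS => c' h c'u; move: h; rewrite c'u /s (u1 : dot u u = 1) subrr ltxx.
  have off := off_cap_path y1 py Cc cu.
  have h2 : \forall c' \near c, par c' = par c.
    have c2 : (proj c).2 <= 0 by exact: core_neg.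
    have h3 := crossing_parity_locally_constant off.
    rewrite y2 l2 in h3; exact: (proj_continuous c1 cu (h3 c2 c2)).
  by near=> c'; split; near: c'.
have vu : v <> u by move=> vu; exact: uv.
have pv : par v.
  rewrite /par crossing_parity_lower; first last.
  - move=> r; rewrite -map_cons => /mapP[z zp ->].
    rewrite {2}/proj /= fv mul0r; apply: (core_neg' z).
    exact: zp.
  - exact: off_cap_path.
  rewrite last_map /proj /= gv mul0r pmulr_lgt0 ?gy ?invr_gt0 ?s_gt0//; last exact: ne_u y (mem_head _ _).
  rewrite pmulr_lgt0; last by rewrite invr_gt0 s_gt0//; [exact: sph _ (mem_last _ _)|exact: ne_u _ (mem_last _ _)].
  by rewrite ltNge (ltW gl).
have : forall c, core c -> c <> u /\ par c.
  apply: (@connected_locally_constant _ core (fun c => c <> u /\ par c)) => //.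
  - by exists v.
  - move=> c Cc [cu pc]; have := locpar c Cc cu; apply: filterS => c' [c'u ->] _.
    by split.
  - move=> c Cc; have [->|cu] := pselect (c = u).
      move=> _.
      have [M hM] : exists M : R, forall r, r \in proj y :: map proj p -> `|r.1| <= M /\ `|r.2| <= M.
        exists (\sum_(r <- proj y :: map proj p) (`|r.1| + `|r.2|)) => r rs.
        rewrite (big_rem r)//=.
        have := normr_ge0 r.1; have := normr_ge0 r.2.
        have : 0 <= \sum_(i <- rem r (proj y :: map proj p)) (`|i.1| + `|i.2|).
          by apply: sumr_ge0 => i _; rewrite addr_ge0.
        by move=> ? ? ?; split; lra.
      have := proj_far M; apply: filterS => c' far Cc' [c'u].
      by rewrite /par (crossing_parity_far hM)//; exact: far.
    move=> npc; have := locpar c Cc cu; apply: filterS => c' [c'u ppc] _ [_ pc'].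
    by apply: npc; split => //; rewrite -ppc.
by move=> /(_ u Cu)[].
Unshelve. all: by end_near.
Qed.

(** Consecutive link witnesses share a cap, so a chain of links from i to j gives a path from y to
    y' of the kind excluded by [no_cap_path]. *)
Theorem chain_separation i j y y' : S2 y -> ev f y = 0 -> 0 < ev g y -> 0 < ev (F i) y ->
  S2 y' -> ev f y' = 0 -> ev g y' < 0 -> 0 < ev (F j) y' -> ~ connect (linked f) i j.
Proof.
move=> y1 fy gy iy y'1 fy' gy' jy' /connectP[p].
suff build : forall z i, S2 z -> ev f z <= 0 -> 0 < ev (F i) z -> path (linked f) i p ->
    j = last i p -> exists q, cap_path z q /\ last z q = y'.
  move=> pp lp; have [|q [pq lq]] := build y i y1 _ iy pp lp; first by rewrite fy.
  by apply: (no_cap_path y1 fy gy pq); rewrite lq.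
elim: p => [|k p IH] z l z1 fz lz /=.
  move=> _ jl; exists [:: y']; split => //=; split => //; last by rewrite fy'.
  by exists l; rewrite -jl; split => //; rewrite jl.
move=> /andP[/asboolP[x [x1 lx kx fx]] pp] jl.
have [q [pq lq]] := IH x k x1 fx kx pp jl.
by exists (x :: q); split => //=; split => //; exists l.
Qed.

End chain.

(** * Inner functionals and their contacts *)

Section affine_functionals.
Context (R : realType).
Notation V := 'rV[R]_3.
Notation S2 := (sphere2 R).
Implicit Types (f g : V * R) (u v w z n : V).

Lemma ev_comb f (a b : R) u v : a + b = 1 ->
  ev f (a *: u + b *: v) = a * ev f u + b * ev f v.
Proof.
by move=> ab; rewrite /ev dotDr !dotZr -[in LHS](mul1r f.2) -ab; ring.
Qed.

Lemma ev_comb3 f (a b c : R) u v w : a + b + c = 1 ->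
  ev f (a *: u + b *: v + c *: w) = a * ev f u + b * ev f v + c * ev f w.
Proof.
by move=> ab; rewrite /ev !dotDr !dotZr -[in LHS](mul1r f.2) -ab; ring.
Qed.

Definition pencil f (t : R) g : V * R := (f.1 + t *: g.1, f.2 + t * g.2).

Lemma ev_pencil f t g z : ev (pencil f t g) z = ev f z + t * ev g z.
Proof. by rewrite /ev /pencil/= dotDl dotZl; ring. Qed.

Definition oppf f : V * R := (- f.1, - f.2).
Lemma ev_oppf f z : ev (oppf f) z = - ev f z.
Proof. by rewrite /ev /oppf/= dotNl; ring. Qed.

Lemma cross_pencil f t g : cross (pencil f t g).1 g.1 = cross f.1 g.1.
Proof. by rewrite /pencil/=; apply: vec3P; rewrite /cross !coordE; ring. Qed.

Lemma cross_pencilr f t g : cross f.1 (pencil g t f).1 = cross f.1 g.1.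
Proof. by rewrite /pencil/=; apply: vec3P; rewrite /cross !coordE; ring. Qed.

Lemma cross_opp f g : cross f.1 (oppf g).1 = - cross f.1 g.1.
Proof. by rewrite /oppf/=; apply: vec3P; rewrite /cross !coordE; ring. Qed.

Lemma cross_neq0l f g : cross f.1 g.1 != 0 -> f.1 != 0.
Proof.
apply: contra => /eqP ->; apply/eqP; apply: vec3P; rewrite /cross !coordE; ring.
Qed.

Lemma near_contact f u v z (N : set V) : f.1 != 0 -> S2 u -> S2 v -> u <> v ->
  ev f u = 0 -> ev f v = 0 -> S2 z -> ev f z = 0 -> nbhs z N ->
  exists z', [/\ S2 z', N z' & 0 < ev f z'].
Proof.
move=> f0 u1 v1 uv fu fv z1 fz Nz.
pose n := f.1; pose h := dot n z.
pose T := n - h *: z.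
have hE : f.2 = h by move: fz; rewrite /ev /h /n; lra.
pose q := dot T T.
have Tz : dot T z = 0 by rewrite /T dotBl dotZl (z1 : dot z z = 1) -/h; ring.
have nT : dot n T = q by rewrite /q {2}/T dotBl dotZl (dotC z) Tz; ring.
have q0 : 0 < q.
  apply: dot_gt0; apply/eqP => T0.
  have nE : n = h *: z by apply/eqP; rewrite -subr_eq0 -/T T0.
  have h0 : h != 0 by apply: contra f0 => /eqP h0; rewrite -/n nE h0 scale0r.
  have eqz x : S2 x -> ev f x = 0 -> x = z.
    move=> x1; rewrite /ev hE -/n nE dotZl => /eqP.
    rewrite -[X in _ - X]mulr1 -mulrBr mulf_eq0 (negbTE h0)/= subr_eq0 => /eqP zx.
    by apply: sphere_dot1 => //; rewrite dotC zx.
  by apply: uv; rewrite (eqz u)// (eqz v).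
have ssq s : 0 <= s * s * q by rewrite -expr2 mulr_ge0 ?sqr_ge0 ?ltW.
pose D s : R := 1 + s * s * q.
pose c s : V := ((1 - s * s * q) / D s) *: z + (2 * s / D s) *: T.
have D0 s : D s != 0 by rewrite gt_eqF// ltr_pwDl.
have cS s : S2 (c s).
  rewrite /sphere2/= /c !dotDl !dotDr !dotZl !dotZr (dotC z T) Tz -/q (z1 : dot z z = 1).
  by move: (D0 s); rewrite /D => Ds; field.
have cf s : ev f (c s) = 2 * s * q * (1 - s * h) / D s.
  rewrite /ev hE /c dotDr !dotZr -/n nT -/h; move: (D0 s); rewrite /D => Ds; field.
  exact: Ds.
have csq : {for (0:R), continuous (fun s : R => s * s * q)}.
  exact: (cvgM (cvgM (@cvg_id _ _) (@cvg_id _ _)) (cvg_cst _)).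
have cD : {for (0:R), continuous D} by exact: (cvgD (cvg_cst _) csq).
have cDV : {for (0:R), continuous (fun s : R => (D s)^-1)} by exact: (cvgV (D0 0) cD).
have cc : {for (0:R), continuous c}.
  have h1 : {for (0:R), continuous (fun s : R => (1 - s * s * q) / D s)}.
    exact: (cvgM (cvgB (cvg_cst _) csq) cDV).
  have h2 : {for (0:R), continuous (fun s : R => 2 * s / D s)}.
    exact: (cvgM (cvgM (cvg_cst _) (@cvg_id _ _)) cDV).
  exact: (cvgD (cvgZ h1 (cvg_cst z)) (cvgZ h2 (cvg_cst T))).
have c0 : c 0 = z.
  by rewrite /c /D !(mul0r, mulr0) subr0 addr0 divr1 scale1r scale0r addr0.
have near1 : \forall s \near (0:R)^'+, N (c s).
  by apply: (cvg_at_right_filter cc); rewrite c0.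
have near2 : \forall s \near (0:R)^'+, 0 < 1 - s * h.
  have c1h : {for (0:R), continuous (fun s : R => 1 - s * h)}.
    exact: (cvgB (cvg_cst _) (cvgM (@cvg_id _ _) (cvg_cst _))).
  have := cvg_at_right_filter c1h => c1h'.
  by apply: (cvgr_gt _ c1h'); rewrite mul0r subr0.
have near3 : \forall s \near (0:R)^'+, 0 < s by exact: nbhs_right_gt.
have [s [Ns sh s0]] : exists s, [/\ N (c s), 0 < 1 - s * h & 0 < s].
  near (0:R)^'+ => s; exists s; split; near: s => //.
exists (c s); split => //; rewrite cf.
rewrite divr_gt0//; last by rewrite ltr_pwDl.
by rewrite !mulr_gt0.
Unshelve. all: by end_near.
Qed.

Lemma near_contact_neg f u v z (N : set V) : f.1 != 0 -> S2 u -> S2 v -> u <> v ->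
  ev f u = 0 -> ev f v = 0 -> S2 z -> ev f z = 0 -> nbhs z N ->
  exists z', [/\ S2 z', N z' & ev f z' < 0].
Proof.
move=> f0 u1 v1 uv fu fv z1 fz Nz.
have [||||z' [z'1 Nz' h]] := @near_contact (oppf f) u v z N _ u1 v1 uv _ _ z1 _ Nz.
- by rewrite /oppf/= oppr_eq0.
- by rewrite ev_oppf fu oppr0.
- by rewrite ev_oppf fv oppr0.
- by rewrite ev_oppf fz oppr0.
by exists z'; split => //; move: h; rewrite ev_oppf oppr_gt0.
Qed.

Lemma parallel_diff f u v : ev f u = 0 -> ev f v = 0 -> dot f.1 (v - u) = 0.
Proof. by rewrite /ev dotBr; lra. Qed.

Lemma det_orthogonal n (a b c : V) : n != 0 -> dot n a = 0 -> dot n b = 0 -> dot n c = 0 ->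
  dot a (cross b c) = 0.
Proof.
move=> n0 na nb nc; have := cross_basis a b c n.
rewrite (dotC a n) (dotC b n) (dotC c n) na nb nc !scale0r !addr0 => /eqP.
by rewrite scaler_eq0 (negbTE n0) orbF => /eqP.
Qed.

Lemma cross_orthogonal n (a b : V) : n != 0 -> dot n a = 0 -> dot n b = 0 ->
  dot n (cross a b) = 0 -> cross a b = 0.
Proof.
move=> n0 na nb nab.
have E : dot n n *: cross a b = dot n (cross a b) *: n + cross (dot n b *: a - dot n a *: b) n.
  by apply: vec3P; rewrite /cross !dotE !coordE; ring.
move: E; rewrite na nb nab !scale0r subrr add0r => E.
have : dot n n *: cross a b = 0 by rewrite E; apply: vec3P; rewrite /cross !coordE; ring.
by move/eqP; rewrite scaler_eq0 gt_eqF ?dot_gt0//= => /eqP.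
Qed.

Lemma sphere_collinear u v w : S2 u -> S2 v -> S2 w -> u <> v ->
  cross (v - u) (w - u) = 0 -> w = u \/ w = v.
Proof.
move=> u1 v1 w1 uv c0.
set e := v - u in c0; set d := w - u in c0.
have e0 : e != 0 by rewrite subr_eq0; apply/eqP => vu; exact: uv.
have ee := dot_gt0 e0.
have E : dot e e *: d = dot e d *: e.
  have : dot e e *: d = dot e d *: e + cross (cross e d) e.
    by apply: vec3P; rewrite /cross !dotE !coordE; ring.
  by rewrite c0 => ->; apply: vec3P; rewrite /cross !coordE; ring.
pose t := dot e d / dot e e.
have dE : d = t *: e.
  by apply: (scalerI (lt0r_neq0 ee)); rewrite E scalerA /t mulrC divfK// gt_eqF.
have wE : w = u + t *: e by rewrite -dE /d addrC subrK.
have ue : dot e e = - 2 * dot u e.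
  rewrite /e dist_sphere// dotBr (u1 : dot u u = 1) (dotC v); ring.
have : dot w w = 1 by [].
rewrite wE !dotDl !dotDr !dotZl !dotZr (u1 : dot u u = 1) (dotC e u) => h.
have : t * (t - 1) * dot e e = 0 by nra.
move/eqP; rewrite mulf_eq0 (gt_eqF ee) orbF mulf_eq0 subr_eq0 => /orP[/eqP t0|/eqP t1].
  by left; move: wE; rewrite t0 scale0r addr0.
by right; move: wE; rewrite t1 scale1r /e addrC subrK.
Qed.

(** Three distinct points of the sphere are not collinear, hence they span the plane f = 0
    affinely. *)
Lemma barycentric f u v w z : f.1 != 0 -> S2 u -> S2 v -> S2 w ->
  u <> v -> w <> u -> w <> v ->
  ev f u = 0 -> ev f v = 0 -> ev f w = 0 -> ev f z = 0 ->
  exists a b c : R, a + b + c = 1 /\ z = a *: u + b *: v + c *: w.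
Proof.
move=> f0 u1 v1 w1 uv wu wv fu fv fw fz.
have ne := parallel_diff fu fv; have nd := parallel_diff fu fw; have np := parallel_diff fu fz.
set e := v - u in ne; set d := w - u in nd; set p := z - u in np; set n := f.1 in f0 ne nd np.
have D0 : dot e (cross d n) != 0.
  apply/eqP => D0.
  have : cross e d = 0.
    apply: (cross_orthogonal f0) => //.
    by rewrite -D0 !dotE /cross !coordE; ring.
  by move/(sphere_collinear u1 v1 w1 uv) => [].
have E := cross_coords e d n p.
have ped : dot p (cross e d) = 0 by apply: (det_orthogonal f0).
rewrite ped in E.
pose b := dot p (cross d n) / dot e (cross d n).
pose c := dot p (cross n e) / dot e (cross d n).
exists (1 - b - c), b, c; split; first by ring.
have pE : p = b *: e + c *: d.
  apply: (scalerI D0); rewrite E scale0r addr0 [RHS]scalerDr !scalerA /b /c.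
  by rewrite 2!(mulrC (dot e _)) !divfK.
have -> : z = u + p by rewrite /p addrC subrK.
by rewrite pE /e /d; apply: vec3P; rewrite !coordE; ring.
Qed.

Lemma line_sphere f g u v z : cross f.1 g.1 != 0 -> S2 u -> S2 v -> S2 z -> u <> v ->
  ev f u = 0 -> ev f v = 0 -> ev g u = 0 -> ev g v = 0 ->
  ev f z = 0 -> ev g z = 0 -> z = u \/ z = v.
Proof.
move=> fg u1 v1 z1 uv fu fv gu gv fz gz; apply: sphere_collinear => //.
have fe := parallel_diff fu fv; have fd := parallel_diff fu fz.
have ge := parallel_diff gu gv; have gd := parallel_diff gu gz.
set e := v - u in fe ge *; set d := z - u in fd gd *.
set w := cross f.1 g.1 in fg.
have E (x : V) : dot f.1 x = 0 -> dot g.1 x = 0 -> dot w w *: x = dot w x *: w.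
  move=> hf hg.
  have E1 : cross w x = dot f.1 x *: g.1 - dot g.1 x *: f.1.
    by apply: vec3P; rewrite /w /cross !dotE !coordE; ring.
  have -> : dot w w *: x = dot w x *: w + cross (cross w x) w.
    by apply: vec3P; rewrite /cross !dotE !coordE; ring.
  by rewrite E1 hf hg !scale0r subrr; apply: vec3P; rewrite /cross !coordE; ring.
have ww := dot_gt0 fg.
have : (dot w w) ^+ 2 *: cross e d = 0.
  transitivity (cross (dot w w *: e) (dot w w *: d)).
    by apply: vec3P; rewrite /cross !coordE; ring.
  by rewrite !E//; apply: vec3P; rewrite /cross !coordE; ring.
by move/eqP; rewrite scaler_eq0 expf_eq0/= gt_eqF//= => /eqP.
Qed.

(** The midpoint of the chord uv is strictly inside the ball; it is pushed out within the plane f =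
    0, in a direction that increases g. *)
Lemma circle_point f g u v : cross f.1 g.1 != 0 -> S2 u -> S2 v -> u <> v ->
  ev f u = 0 -> ev f v = 0 -> ev g u = 0 -> ev g v = 0 ->
  exists y, [/\ S2 y, ev f y = 0 & 0 < ev g y].
Proof.
move=> fg u1 v1 uv fu fv gu gv.
pose m : V := 2^-1 *: (u + v).
have fm h : ev h u = 0 -> ev h v = 0 -> ev h m = 0.
  move=> hu hv; rewrite /m scalerDr ev_comb ?hu ?hv; first by ring.
  by field.
have mm : dot m m < 1.
  rewrite /m dotZl dotZr !dotDl !dotDr (u1 : dot u u = 1) (v1 : dot v v = 1) (dotC v u).
  by have := sphere_dot_lt1 u1 v1 uv; lra.
have [d fd gd] : exists2 d, dot f.1 d = 0 & 0 < dot g.1 d.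
  pose d0 := cross (cross f.1 g.1) f.1.
  exists d0; first by rewrite dot_cross2.
  have -> : dot g.1 d0 = dot (cross f.1 g.1) (cross f.1 g.1).
    by rewrite /d0 /cross !dotE !coordE; ring.
  exact: dot_gt0.
have d0 : d != 0 by apply/eqP => d0; move: gd; rewrite d0 dot0r ltxx.
have [t t0 y1] := push_to_sphere (ltW mm) d0.
exists (m + t *: d); split => //.
  by have := fm f fu fv; rewrite /ev (dotDr f.1 m) (dotZr t f.1 d) fd; lra.
have t00 : 0 < t.
  rewrite lt_neqAle t0 andbT eq_sym; apply/eqP => te.
  by move: y1; rewrite te scale0r addr0 /sphere2/= => h; move: mm; rewrite h ltxx.
by have := fm g gu gv; rewrite /ev (dotDr g.1 m) (dotZr t g.1 d); nra.
Qed.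

(** The chord from z1 to z2 meets the plane f = 0; that point is pushed out within the plane, along
    a direction that does not decrease g. *)
Lemma cap_meets_circle f g z1 z2 : S2 z1 -> S2 z2 -> 0 < ev g z1 -> 0 < ev g z2 ->
  0 < ev f z1 -> ev f z2 <= 0 -> exists z, [/\ S2 z, ev f z = 0 & 0 < ev g z].
Proof.
move=> h1 h2 g1 g2 f1 f2.
pose a := ev f z1 / (ev f z1 - ev f z2).
have den : 0 < ev f z1 - ev f z2 by lra.
have a01 : 0 < a <= 1 by apply/andP; split; [exact: divr_gt0|rewrite /a ler_pdivrMr//; lra].
pose p := (1 - a) *: z1 + a *: z2.
have ab : 1 - a + a = 1 by ring.
have fp : ev f p = 0 by rewrite /p ev_comb// /a; field; lra.
have gp : 0 < ev g p by rewrite /p ev_comb//; nra.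
have pp : dot p p <= 1.
  have a01' : 0 <= a <= 1 by case/andP: a01 => /ltW -> ->.
  apply: (le_trans (dotdot_convex z1 z2 a01')).
  by rewrite (h1 : dot z1 z1 = 1) (h2 : dot z2 z2 = 1); lra.
have [d d0 [df dfg]] := orth2_exists f.1 f.1.
have [d' d'0 [fd gd]] : exists2 d : V, d != 0 & dot f.1 d = 0 /\ 0 <= dot g.1 d.
  have [gd|gd] := lerP 0 (dot g.1 d); first by exists d => //; rewrite dotC.
  exists (- d); first by rewrite oppr_eq0.
  by rewrite !dotNr (dotC f.1) df oppr0; split => //; rewrite oppr_ge0 ltW.
have [t t0 y1] := push_to_sphere pp d'0.
exists (p + t *: d'); split => //.
  by move: fp; rewrite /ev (dotDr f.1 p) (dotZr t f.1 d') fd; lra.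
by move: gp; rewrite /ev (dotDr g.1 p) (dotZr t g.1 d'); nra.
Qed.

End affine_functionals.

Lemma infinite_pigeonhole (I : finType) (P : I -> nat -> Prop) :
  (forall n, exists i, P i n) -> exists i, forall N, exists2 n, (N <= n)%N & P i n.
Proof.
move=> h; apply: contrapT => nh.
have : forall i, exists N, forall n, (N <= n)%N -> ~ P i n.
  move=> i; apply: contrapT => ni; apply: nh; exists i => N.
  by apply: contrapT => nN; apply: ni; exists N => n Nn Pn; apply: nN; exists n.
move=> /choice[N hN]; have [i Pi] := h (\max_i N i).
by apply: (hN i _ _ Pi); exact: leq_bigmax.
Qed.

(** * Circles with three contacts *)

Section three_contacts.
Context (R : realType).
Notation V := 'rV[R]_3.
Notation S2 := (sphere2 R).
Implicit Types (f g : V * R) (u v w z : V).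

Lemma plane_through f h a b c : S2 a -> S2 b -> S2 c -> a <> b -> c <> a -> c <> b ->
  f.1 != 0 -> ev f a = 0 -> ev f b = 0 -> ev f c = 0 ->
  ev h a = 0 -> ev h b = 0 -> ev h c = 0 -> exists k, forall z, ev h z = k * ev f z.
Proof.
move=> a1 b1 c1 ab ca cb f0 fa fb fc ha hb hc.
have fe := parallel_diff fa fb; have fd := parallel_diff fa fc.
have he := parallel_diff ha hb; have hd := parallel_diff ha hc.
set e := b - a in fe he; set d := c - a in fd hd; set m := cross e d.
have m0 : m != 0.
  by apply/eqP => /(sphere_collinear a1 b1 c1 ab) [].
have E (n : V) : dot n e = 0 -> dot n d = 0 -> dot m m *: n = dot m n *: m.
  move=> ne nd.
  have E1 : cross m n = dot n e *: d - dot n d *: e.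
    by apply: vec3P; rewrite /m /cross !dotE !coordE; ring.
  have -> : dot m m *: n = dot m n *: m + cross (cross m n) m.
    by apply: vec3P; rewrite /cross !dotE !coordE; ring.
  by rewrite E1 ne nd !scale0r subrr; apply: vec3P; rewrite /cross !coordE; ring.
have mm := dot_gt0 m0.
have mf : dot m f.1 != 0.
  apply: contra f0 => /eqP mf.
  by have /eqP := E f.1 fe fd; rewrite mf scale0r scaler_eq0 gt_eqF.
pose k := dot m h.1 / dot m f.1; exists k => z.
have hE : h.1 = k *: f.1.
  apply: (scalerI (lt0r_neq0 mm)).
  by rewrite scalerA mulrC -scalerA (E f.1 fe fd) (E h.1 he hd) scalerA /k divfK.
have h2 : h.2 = k * f.2.
  have fa' : f.2 = dot f.1 a by move: (fa); rewrite /ev; lra.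
  by move: (ha); rewrite /ev hE dotZl fa'; lra.
by rewrite /ev hE dotZl h2; ring.
Qed.

Variables (I : finType) (F : I -> V * R).
Notation C := (core F).
Hypothesis Fn : forall i, (F i).1 != 0.
Hypothesis Ccon : connected C.
Hypothesis Cfull : forall f, f.1 != 0 -> exists2 z, C z & ev f z <> 0.

Definition inner f := forall z, C z -> ev f z <= 0.

Definition split3 := exists f, [/\ f.1 != 0, inner f & exists i j k,
  [/\ ~ connect (linked F f) i j, ~ connect (linked F f) i k &
      ~ connect (linked F f) j k]].

Lemma linked_connect_sym f : connect_sym (linked F f).
Proof. exact/sym_connect_sym/linked_sym. Qed.

Lemma isolated f j k : (forall z, S2 z -> 0 < ev (F j) z -> 0 < ev f z) ->
  connect (linked F f) j k -> j = k.
Proof.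
move=> hj /connectP[[|x p] /=]; first by move=> _ ->.
by move=> /andP[/asboolP[z [z1 jz _ fz]] _] _; have := hj z z1 jz; rewrite ltNge fz.
Qed.

(** Equality of the cap j with {f > 0}, expressed on the functionals. *)
Definition supports j f := exists2 k, 0 < k & forall z, ev (F j) z = k * ev f z.

Lemma supports_isolated f j k : supports j f -> connect (linked F f) j k -> j = k.
Proof.
move=> [c c0 E]; apply: isolated => z _; rewrite E.
by rewrite pmulr_rgt0.
Qed.

Lemma core_or_cap z : S2 z -> C z \/ exists i, 0 < ev (F i) z.
Proof.
move=> z1; have [h|h] := pselect (exists i, 0 < ev (F i) z); first by right.
left; split => // i; rewrite leNgt; apply/negP => iz; apply: h; by exists i.
Qed.

(** Otherwise the points of the sphere near z belong to the core, and by [near_contact] some of them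
    have f > 0. *)
Lemma contact_on_cap f u v z : f.1 != 0 -> inner f -> S2 u -> S2 v -> u <> v ->
  ev f u = 0 -> ev f v = 0 -> C z -> ev f z = 0 -> exists j, ev (F j) z = 0.
Proof.
move=> f0 fin u1 v1 uv fu fv [z1 Cz] fz; apply: contrapT => h.
have Fz j : 0 < - ev (F j) z.
  rewrite oppr_gt0 lt_neqAle Cz andbT; apply/eqP => jz; apply: h; by exists j.
have nF : \forall y \near z, forall j, 0 < - ev (F j) y.
  have E j : \forall y \near z, 0 < - ev (F j) y.
    exact: (cvgr_gt _ (cvgN (@ev_continuous R (F j) z)) _ (Fz j)).
  exact: filter_forall E.
have [z' [z'1 nz' fz']] := near_contact f0 u1 v1 uv fu fv z1 fz nF.
have : C z' by split => // j; have := nz' j; rewrite oppr_gt0 => /ltW.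
by move/fin; rewrite leNgt fz'.
Qed.

(** Each of infinitely many points of the arc lies on the boundary of a cap, so one cap has three of
    them on its boundary and its plane is that of f. [Cfull] makes the factor positive. *)
Lemma arc_in_core f g u v w : inner f -> cross f.1 g.1 != 0 ->
  C u -> C v -> S2 w -> u <> v -> ev f u = 0 -> ev f v = 0 -> ev f w = 0 ->
  ev g u = 0 -> ev g v = 0 -> 0 < ev g w ->
  (forall z, S2 z -> ev f z = 0 -> ev g z < 0 -> C z) -> exists j, supports j f.
Proof.
move=> fin fg Cu Cv w1 uv fu fv fw gu gv gw arc.
have f0 := cross_neq0l fg.
have [u1 _] := Cu; have [v1 _] := Cv.
(* Distinct points of the arc: [z n] is the second intersection of the sphere with the line from w
   through the point [m n] of the chord uv. *)
pose s (n : nat) : R := (n.+2)%:R^-1.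
have s01 n : 0 < s n < 1.
  by rewrite /s invr_gt0 ltr0n/= invf_lt1 ?ltr0n// ltr1n.
pose m n : V := (1 - s n) *: u + s n *: v.
have mm n : dot (m n) (m n) < 1.
  have /andP[s0 s1] := s01 n.
  rewrite /m !dotDl !dotDr !dotZl !dotZr (u1 : dot u u = 1) (v1 : dot v v = 1) (dotC v u).
  have := sphere_dot_lt1 u1 v1 uv.
  have : 0 < s n * (1 - s n) by rewrite mulr_gt0// subr_gt0.
  nra.
have evm h n : ev h u = 0 -> ev h v = 0 -> ev h (m n) = 0.
  by move=> hu hv; rewrite /m ev_comb ?hu ?hv; [ring|ring].
pose d n : V := m n - w.
have d0 n : 0 < dot (d n) (d n).
  apply: dot_gt0; rewrite /d subr_eq0; apply/eqP => mw.
  by move: gw; rewrite -mw evm// ltxx.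
have dE n : dot (d n) (d n) = dot (m n) (m n) - 2 * dot w (m n) + 1.
  by rewrite /d !dotBl !dotBr (w1 : dot w w = 1) (dotC (m n) w); ring.
have wd n : dot w (d n) = dot w (m n) - 1.
  by rewrite /d dotBr (w1 : dot w w = 1).
pose t n := 2 * (1 - dot w (m n)) / dot (d n) (d n).
have t1 n : 1 < t n.
  rewrite /t ltr_pdivlMr// mul1r dE; have := mm n; lra.
pose z n : V := (1 - t n) *: w + t n *: m n.
have zE n : z n = w + t n *: d n.
  by rewrite /z /d scalerBl scale1r scalerBr addrAC addrA.
have z1 n : S2 (z n).
  rewrite /sphere2/= zE (dotDl w) !(dotDr _ w) (dotC _ w) !dotZl !dotZr (w1 : dot w w = 1) wd.
  rewrite /t; field; rewrite gt_eqF//.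
have evz h n : ev h u = 0 -> ev h v = 0 -> ev h (z n) = (1 - t n) * ev h w.
  by move=> hu hv; rewrite /z ev_comb ?evm//; ring.
have zC n : C (z n).
  apply: arc => //; rewrite evz//; first by rewrite fw mulr0.
  by have := t1 n; nra.
have zinj n k : z n = z k -> n = k.
  move=> znk; have tnk : t n = t k.
    have := congr1 (ev g) znk; rewrite !evz// => /(mulIf (lt0r_neq0 gw)); lra.
  have mnk : m n = m k.
    move: znk; rewrite /z tnk => /addrI /scalerI; apply.
    by rewrite gt_eqF// (lt_trans ltr01).
  have : (s n - s k) *: (v - u) = 0.
    have -> : (s n - s k) *: (v - u) = m n - m k.
      by rewrite /m; apply: vec3P; rewrite !coordE; ring.
    by rewrite mnk subrr.
  move/eqP; rewrite scaler_eq0 !subr_eq0 => /orP[/eqP/invr_inj/eqP|/eqP vu].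
    by rewrite eqr_nat => /eqP[].
  by case: uv.
have [j hj] : exists j, forall N, exists2 n, (N <= n)%N & ev (F j) (z n) = 0.
  apply: infinite_pigeonhole => n.
  by apply: (contact_on_cap f0 fin u1 v1 uv fu fv (zC n)); rewrite evz// fw mulr0.
have [n1 _ h1] := hj 0%N; have [n2 n12 h2] := hj n1.+1; have [n3 n23 h3] := hj n2.+1.
have fz n : ev f (z n) = 0 by rewrite evz// fw mulr0.
have [|||k hk] := plane_through (z1 n1) (z1 n2) (z1 n3) _ _ _ f0 (fz _) (fz _) (fz _) h1 h2 h3.
- by move/zinj => e; move: n12; rewrite e ltnn.
- by move/zinj => e; have := ltn_trans n12 n23; rewrite e ltnn.
- by move/zinj => e; move: n23; rewrite e ltnn.
exists j; exists k => //.
rewrite ltNge; apply/negP => k0.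
have [x Cx fx] := Cfull f0.
have fx0 : ev f x < 0 by rewrite lt_neqAle (fin x Cx) andbT; apply/eqP.
have jx : ev (F j) x <= 0 by case: Cx.
have kz : k = 0 by rewrite hk in jx; nra.
have [y Cy] := Cfull (Fn j); apply.
by rewrite hk kz mul0r.
Qed.

Lemma arc_touched f g u v w : inner f -> cross f.1 g.1 != 0 ->
  C u -> C v -> S2 w -> u <> v -> ev f u = 0 -> ev f v = 0 -> ev f w = 0 ->
  ev g u = 0 -> ev g v = 0 -> 0 < ev g w ->
  (exists j, supports j f) \/
  exists j y, [/\ S2 y, ev f y = 0, ev g y < 0 & 0 < ev (F j) y].
Proof.
move=> fin fg Cu Cv w1 uv fu fv fw gu gv gw.
have [h|h] := pselect (exists j y, [/\ S2 y, ev f y = 0, ev g y < 0 & 0 < ev (F j) y]).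
  by right.
left; apply: (arc_in_core fin fg Cu Cv w1 uv fu fv fw gu gv gw) => z z1 fz gz.
have [//|[i iz]] := core_or_cap z1.
by exfalso; apply: h; exists i, z.
Qed.

Lemma chord_functional f u v w : f.1 != 0 -> S2 u -> S2 v -> S2 w ->
  u <> v -> w <> u -> w <> v -> ev f u = 0 -> ev f v = 0 -> ev f w = 0 ->
  exists g, [/\ cross f.1 g.1 != 0, ev g u = 0, ev g v = 0 & 0 < ev g w].
Proof.
move=> f0 u1 v1 w1 uv wu wv fu fv fw.
pose g : V * R := (cross (v - u) f.1, dot (cross (v - u) f.1) u).
have fe := parallel_diff fu fv.
have gu : ev g u = 0 by rewrite /ev subrr.
have gv : ev g v = 0.
  rewrite /ev /g/= -dotBr; set e := v - u.
  by rewrite dotC dot_cross1.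
have fgE : cross f.1 g.1 = dot f.1 f.1 *: (v - u).
  transitivity (dot f.1 f.1 *: (v - u) - dot f.1 (v - u) *: f.1).
    by rewrite /g/=; apply: vec3P; rewrite /cross !dotE !coordE; ring.
  by rewrite fe scale0r subr0.
have fg : cross f.1 g.1 != 0.
  rewrite fgE scaler_eq0 gt_eqF ?dot_gt0//= subr_eq0; apply/eqP => vu.
  by apply: uv.
have gw : ev g w != 0.
  apply/eqP => gw.
  by have [] := line_sphere fg u1 v1 w1 uv fu fv gu gv fw gw.
move: gw; rewrite neq_lt => /orP[gw|gw]; last by exists g.
exists (oppf g); split.
- by rewrite cross_opp oppr_eq0.
- by rewrite ev_oppf gu oppr0.
- by rewrite ev_oppf gv oppr0.
- by rewrite ev_oppf oppr_gt0.
Qed.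

(* Three contacts: two arcs of the circle seen from opposite sides of the chord [u, v]. *)
Lemma arcs_separated f g g' u v w i j y y' : inner f -> cross f.1 g.1 != 0 ->
  C u -> C v -> C w -> u <> v -> w <> u -> w <> v ->
  ev f u = 0 -> ev f v = 0 -> ev f w = 0 ->
  ev g u = 0 -> ev g v = 0 -> 0 < ev g w ->
  ev g' v = 0 -> ev g' w = 0 -> 0 < ev g' u ->
  S2 y -> ev f y = 0 -> ev g y < 0 -> 0 < ev (F i) y ->
  S2 y' -> ev f y' = 0 -> ev g' y' < 0 -> 0 < ev (F j) y' ->
  ~ connect (linked F f) i j.
Proof.
move=> fin fg Cu Cv Cw uv wu wv fu fv fw gu gv gw g'v g'w g'u y1 fy gy iy y'1 fy' gy' jy'.
have f0 := cross_neq0l fg.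
have [u1 _] := Cu; have [v1 _] := Cv; have [w1 _] := Cw.
have [a [b [c [abc y'E]]]] := barycentric f0 u1 v1 w1 uv wu wv fu fv fw fy'.
have ga : ev g y' = c * ev g w by rewrite y'E ev_comb3// gu gv; ring.
have g'a : ev g' y' = a * ev g' u by rewrite y'E ev_comb3// g'v g'w; ring.
have a0 : a < 0 by move: gy'; rewrite g'a; nra.
have c0 : 0 < c.
  rewrite ltNge; apply/negP => c0.
  (* otherwise v would be a proper convex combination of u, w and y' *)
  have y'v := sphere_dot_le1 y'1 v1; have uv1 := sphere_dot_lt1 u1 v1 uv.
  have wv1 := sphere_dot_le1 w1 v1.
  have : dot y' v = a * dot u v + b + c * dot w v.
    by rewrite y'E !dotDl !dotZl (v1 : dot v v = 1); ring.
  by nra.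
have gy'0 : 0 < ev g y' by rewrite ga mulr_gt0.
rewrite linked_connect_sym.
exact: (chain_separation Ccon fin Cu Cv uv fu fv gu gv fg y'1 fy' gy'0 jy' y1 fy gy iy).
Qed.

(** An arc between two contacts either meets a cap or lies in the core, and in the latter case {f >
    0} is itself a cap. Caps met by different arcs are separated by [arcs_separated]. *)
Lemma three_contacts f u v w : f.1 != 0 -> inner f -> C u -> C v -> C w ->
  u <> v -> w <> u -> w <> v -> ev f u = 0 -> ev f v = 0 -> ev f w = 0 ->
  (exists j, supports j f) \/ split3.
Proof.
move=> f0 fin Cu Cv Cw uv wu wv fu fv fw.
have [u1 _] := Cu; have [v1 _] := Cv; have [w1 _] := Cw.
have vu : v <> u by move=> h; exact: uv.
have uw : u <> w by move=> h; exact: wu.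
have vw : v <> w by move=> h; exact: wv.
have [g1 [fg1 g1u g1v g1w]] := chord_functional f0 u1 v1 w1 uv wu wv fu fv fw.
have [g2 [fg2 g2v g2w g2u]] := chord_functional f0 v1 w1 u1 vw uv uw fv fw fu.
have [g3 [fg3 g3w g3u g3v]] := chord_functional f0 w1 u1 v1 wu vw vu fw fu fv.
have [|[i [yi [yi1 fyi gyi iyi]]]] := arc_touched fin fg1 Cu Cv w1 uv fu fv fw g1u g1v g1w; first by left.
have [|[j [yj [yj1 fyj gyj jyj]]]] := arc_touched fin fg2 Cv Cw u1 vw fv fw fu g2v g2w g2u; first by left.
have [|[k [yk [yk1 fyk gyk kyk]]]] := arc_touched fin fg3 Cw Cu v1 wu fw fu fv g3w g3u g3v; first by left.
right; exists f; split => //; exists i, j, k; split.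
- exact: (arcs_separated fin fg1 Cu Cv Cw uv wu wv fu fv fw g1u g1v g1w g2v g2w g2u yi1 fyi gyi iyi yj1).
- rewrite linked_connect_sym.
  exact: (arcs_separated fin fg3 Cw Cu Cv wu vw vu fw fu fv g3w g3u g3v g1u g1v g1w yk1 fyk gyk kyk yi1).
- exact: (arcs_separated fin fg2 Cv Cw Cu vw uv uw fv fw fu g2v g2w g2u g3w g3u g3v yj1 fyj gyj jyj yk1).
Qed.

End three_contacts.

Lemma frequently_pigeonhole (T : Type) (G : set_system T) (I : finType) (P : I -> T -> Prop) :
  Filter G -> ~ G [set s | ~ exists i, P i s] -> exists i, ~ G [set s | ~ P i s].
Proof.
move=> FG h; apply: contrapT => nh; apply: h.
have : forall i, G [set s | ~ P i s].
  by move=> i; apply: contrapT => ni; apply: nh; exists i.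
by move/filter_forall; apply: filterS => s hs [i Pi]; exact: (hs i).
Qed.

(** * Rotating a plane about a chord *)

Section blocked_pencil.
Context (R : realType).
Notation V := 'rV[R]_3.
Notation S2 := (sphere2 R).
Implicit Types (f g : V * R) (u v w z : V).
Variables (I : finType) (F : I -> V * R).
Notation C := (core F).
Notation inner := (inner F).

Lemma compact_core : compact C.
Proof.
apply: (@subclosed_compact _ _ S2); last by move=> z [].
  rewrite (_ : core F = S2 `&` \bigcap_(i in [set: I]) [set z | ev (F i) z <= 0]).
    apply: closedI; first exact: closed_sphere.
    by apply: closed_bigI => i _; apply: closed_nonpos; exact: ev_continuous.
  by apply/seteqP; split=> z [z1 h]; (split; [exact: z1|]) => i; [move=> _; exact: h|exact: (h i Logic.I)].
exact: compact_sphere.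
Qed.

(** Points of the circle with g > 0 are outside the core, so one cap b contains such points
    arbitrarily close to u and has u on its boundary. Its functional is p g + q f with p > 0 up to a
    second-order term, and it is nonpositive on the core; this forces f below a negative multiple of
    g. *)
Lemma escape_near_contact f g u v : cross f.1 g.1 != 0 -> inner f ->
  C u -> C v -> u <> v -> ev f u = 0 -> ev f v = 0 -> ev g u = 0 -> ev g v = 0 ->
  (forall w, C w -> ev f w = 0 -> ev g w <= 0) ->
  exists2 e, 0 < e & \forall z \near u, C z -> 0 < ev g z -> ev f z <= - e * ev g z.
Proof.
move=> fg fin Cu Cv uv fu fv gu gv noc.
have [u1 Fu] := Cu; have [v1 Fv] := Cv.
have uv0 : dot u v < 1 by exact: sphere_dot_lt1.
have [d fd gd] : exists2 d, dot f.1 d = 0 & 0 < dot g.1 d.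
  exists (cross (cross f.1 g.1) f.1); first by rewrite dot_cross2.
  have -> : dot g.1 (cross (cross f.1 g.1) f.1) = dot (cross f.1 g.1) (cross f.1 g.1).
    by rewrite /cross !dotE !coordE; ring.
  exact: dot_gt0.
(* [Z s] runs along the circle f = 0 from u into g > 0; it is the second intersection of the sphere
   with the line through v in the direction [L s]. *)
pose L (s : R) : V := (u - v) + s *: d.
pose den s := dot (u - v) (u - v) + s * (2 * dot (u - v) d) + s * s * dot d d.
have denE s : dot (L s) (L s) = den s.
  by rewrite /L /den !(dotDl (u - v)) !(dotDr _ (u - v)) !dotZl !dotZr (dotC d (u - v)); ring.
pose t s := (- 2 * (dot v (u - v) + s * dot v d)) / den s.
have den0 : den 0 = 2 * (1 - dot u v).
  by rewrite /den dist_sphere//; ring.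
have t0 : t 0 = 1.
  rewrite /t den0 dotBr (v1 : dot v v = 1) (dotC v u); field.
  by rewrite subr_eq0 gt_eqF.
have cid : {for (0:R), continuous (fun s : R => s)} by exact: cvg_id.
have cden : {for (0:R), continuous den}.
  exact: (cvgD (cvgD (cvg_cst _) (cvgM cid (cvg_cst _))) (cvgM (cvgM cid cid) (cvg_cst _))).
have ct : {for (0:R), continuous t}.
  have d00 : den 0 != 0 by rewrite den0 mulf_neq0// subr_eq0 gt_eqF.
  exact: (cvgM (cvgM (cvg_cst _) (cvgD (cvg_cst _) (cvgM cid (cvg_cst _)))) (cvgV d00 cden)).
pose Z s : V := v + t s *: L s.
have evZ h s : ev h (Z s) = ev h v + t s * (dot h.1 (u - v) + s * dot h.1 d).
  by rewrite /ev /Z (dotDr h.1 v) (dotZr (t s)) /L (dotDr h.1 (u - v)) (dotZr s); ring.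
have good : \forall s \near (0:R)^'+, [/\ S2 (Z s), ev f (Z s) = 0 & 0 < ev g (Z s)].
  have n1 : \forall s \near (0:R)^'+, 0 < s by exact: nbhs_right_gt.
  have n2 : \forall s \near (0:R)^'+, 0 < t s.
    by apply: (cvgr_gt _ (cvg_at_right_filter ct)); rewrite t0.
  have n3 : \forall s \near (0:R)^'+, 0 < den s.
    apply: (cvgr_gt _ (cvg_at_right_filter cden)).
    by rewrite den0 mulr_gt0// subr_gt0.
  have fuv : dot f.1 (u - v) = 0 by exact: parallel_diff.
  have guv : dot g.1 (u - v) = 0 by exact: parallel_diff.
  near=> s; have s0 : 0 < s by near: s.
  have ts : 0 < t s by near: s.
  have ds : 0 < den s by near: s.
  split; last 2 first.
  - by rewrite evZ fv fuv fd; ring.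
  - rewrite evZ gv guv !add0r mulr_gt0 ?ts ?mulr_gt0 ?s0 ?gd //.
  rewrite /sphere2/= /Z dotDl !(dotDr _ v) (dotC _ v) !(dotZl (t s)) !(dotZr (t s)) denE (v1 : dot v v = 1).
  have vL : dot v (L s) = dot v (u - v) + s * dot v d.
    by rewrite /L (dotDr v (u - v)) (dotZr s).
  rewrite vL /t; field; rewrite gt_eqF//.
(* One of the finitely many caps contains [Z s] for arbitrarily small s > 0. *)
have [b hb] : exists b, ~ \forall s \near (0:R)^'+, ~ 0 < ev (F b) (Z s).
  apply: (@frequently_pigeonhole R ((0:R)^'+) I (fun i s => 0 < ev (F i) (Z s)) _) => h.
  have : \forall s \near (0:R)^'+, False; last first.
    by move=> /filter_ex[].
  apply: (filterS _ (filterI h good)) => s [nb [z1 fz gz]].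
  case: (core_or_cap F z1) => // Cz; have := noc _ Cz fz.
  by rewrite leNgt gz.
have bu : ev (F b) u = 0.
  apply/eqP; rewrite eq_le Fu/= leNgt; apply/negP => bu; apply: hb.
  have cb : {for (0:R), continuous (fun s => ev (F b) v + t s * (dot (F b).1 (u - v) + s * dot (F b).1 d))}.
    exact: (cvgD (cvg_cst _) (cvgM ct (cvgD (cvg_cst _) (cvgM cid (cvg_cst _))))).
  have : \forall s \near (0:R)^'+, ev (F b) (Z s) < 0.
    under eq_near do rewrite evZ.
    apply: (cvgr_lt _ (cvg_at_right_filter cb)).
    rewrite t0 mul0r addr0 mul1r /ev dotBr; move: bu; rewrite /ev; lra.
  by apply: filterS => s h; apply/negP; rewrite -leNgt ltW.
pose D := dot g.1 (cross f.1 u).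
have D0 : D != 0 by exact: (independent_at_contact Cu Cv uv fu fv gu gv fg).
have DD : 0 < D ^+ 2 by rewrite exprn_even_gt0.
pose n := (F b).1.
pose p := dot n (cross f.1 u) / D; pose q := dot n (cross u g.1) / D; pose r := dot n (cross g.1 f.1) / D.
have nE : n = p *: g.1 + q *: f.1 + r *: u.
  apply: (scalerI D0); rewrite (cross_coords g.1 f.1 u n) !scalerDr !scalerA /p /q /r.
  by rewrite ![D * (_ / D)]mulrC !divfK.
have bE z : S2 z -> ev (F b) z = p * ev g z + q * ev f z - r * (1 - dot z u).
  move=> z1; have -> : ev (F b) z = dot n (z - u).
    by move: bu; rewrite /ev -/n dotBr; lra.
  rewrite nE !dotDl !dotZl !dotBr (u1 : dot u u = 1) (dotC u z).
  by move: fu gu; rewrite /ev => fu' gu'; nra.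
(* The sign of r comes from the other contact v, that of p from the points [Z s]. *)
have r0 : 0 <= r.
  have := Fv b; rewrite bE// fv gv (dotC v u); nra.
have p0 : 0 < p.
  rewrite ltNge; apply/negP => p0; apply: hb; apply: filterS good => s [z1 fz gz].
  apply/negP; rewrite -leNgt bE// fz mulr0 addr0.
  by have := sphere_dot_le1 z1 u1; nra.
pose q1 := dot (cross f.1 u) (cross f.1 u).
pose q2 := dot (cross u g.1) (cross u g.1).
pose q3 := dot (cross g.1 f.1) (cross g.1 f.1).
have [q10 q20 q30] : [/\ 0 <= q1, 0 <= q2 & 0 <= q3] by split; exact: dot_ge0.
(* 1 - z.u is half of |z - u|^2; expanding z - u by [cross_basis] and absorbing the term in (1 -
   z.u)^2 bounds it by a quadratic form in f and g. *)
have small z : S2 z -> 3 * q3 * (1 - dot z u) <= D ^+ 2 ->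
    D ^+ 2 * (1 - dot z u) <= 3 * (ev g z ^+ 2 * q1 + ev f z ^+ 2 * q2).
  move=> z1 hz; have S0 := sphere_dot_le1 z1 u1.
  have E := cross_basis g.1 f.1 u (z - u); rewrite -/D in E.
  have gE : dot g.1 (z - u) = ev g z by move: gu; rewrite /ev dotBr; lra.
  have fE : dot f.1 (z - u) = ev f z by move: fu; rewrite /ev dotBr; lra.
  have uE : dot u (z - u) = - (1 - dot z u) by rewrite dotBr (u1 : dot u u = 1) (dotC u z); ring.
  rewrite gE fE uE in E.
  have := dot_sum3_le (ev g z *: cross f.1 u) (ev f z *: cross u g.1) (- (1 - dot z u) *: cross g.1 f.1).
  rewrite -E !dotZZ dist_sphere// -/q1 -/q2 -/q3.
  have : 0 <= 1 - dot z u by lra.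
  by set S := 1 - dot z u in hz *; nra.
pose K := 3 * (q1 + q2) / D ^+ 2.
have K0 : 0 <= K by rewrite divr_ge0 ?(ltW DD)// mulr_ge0// addr_ge0.
(* The factor 3 divides p g into thirds: one bounds q f, one the second-order term, and one is left
   over. The bound 1 gives f^2 <= g^2. *)
pose e := Num.min 1 (p / (3 * (1 + `|q|))).
have e0 : 0 < e by rewrite lt_min ltr01 divr_gt0// mulr_gt0// ltr_pwDl.
have e1 : e <= 1 by rewrite ge_min lexx.
have eq3 : 3 * (`|q| * e) <= p.
  have : e <= p / (3 * (1 + `|q|)) by rewrite ge_min lexx orbT.
  rewrite ler_pdivlMr ?mulr_gt0 ?ltr_pwDl//; have := normr_ge0 q; nra.
exists e => //.
have near_g : \forall z \near u, r * K * ev g z < p / 3.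
  apply: (cvgr_lt _ (cvgM (cvg_cst _) (@ev_continuous R g u))).
  by rewrite gu mulr0 divr_gt0.
have near_S : \forall z \near u, 3 * q3 * (1 - dot z u) < D ^+ 2.
  apply: (cvgr_lt _ (cvgM (cvg_cst _) (cvgB (cvg_cst _) (@dot_continuousl R u u)))).
  by rewrite (u1 : dot u u = 1) subrr mulr0.
apply: (filterS _ (filterI near_g near_S)) => z [zg zS] Cz gz.
have [z1 Fz] := Cz; have fz := fin z Cz.
rewrite leNgt; apply/negP => fez.
have := Fz b; rewrite leNgt bE//; apply/negP/negPn.
have S0 : 0 <= 1 - dot z u by have := sphere_dot_le1 z1 u1; lra.
have f2 : ev f z ^+ 2 <= ev g z ^+ 2.
  have : - ev f z <= e * ev g z by lra.
  have : e * ev g z <= ev g z by rewrite ler_piMl// ltW.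
  by nra.
have SK : 1 - dot z u <= K * ev g z ^+ 2.
  have := small z z1 (ltW zS) => h.
  rewrite /K mulrAC ler_pdivlMr//; nra.
have qf : - (`|q| * (e * ev g z)) <= q * ev f z.
  have := ler_norm q; have := ler_norm (- q); rewrite normrN; nra.
have rS : r * (1 - dot z u) <= r * K * ev g z * ev g z.
  by have := ler_wpM2l r0 SK; rewrite expr2; lra.
nra.
Unshelve. all: by end_near.
Qed.

(** Near u and v this is [escape_near_contact]. The rest of the core with g >= 0 is compact and f is
    negative on it: f = 0 would give g = 0, hence one of the points u, v. *)
Lemma pencil_escape f g u v : cross f.1 g.1 != 0 -> inner f ->
  C u -> C v -> u <> v -> ev f u = 0 -> ev f v = 0 -> ev g u = 0 -> ev g v = 0 ->
  (forall w, C w -> ev f w = 0 -> ev g w <= 0) ->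
  exists2 e, 0 < e & inner (pencil f e g).
Proof.
move=> fg fin Cu Cv uv fu fv gu gv noc.
have [u1 _] := Cu; have [v1 _] := Cv.
have vu : v <> u by move=> h; exact: uv.
have [e1 e10 near1] := escape_near_contact fg fin Cu Cv uv fu fv gu gv noc.
have [e2 e20 near2] := escape_near_contact fg fin Cv Cu vu fv fu gv gu noc.
pose N1 := interior [set z | C z -> 0 < ev g z -> ev f z <= - e1 * ev g z].
pose N2 := interior [set z | C z -> 0 < ev g z -> ev f z <= - e2 * ev g z].
pose A := C `&` (~` N1 `&` ~` N2 `&` [set z | ev (oppf g) z <= 0]).
have cA : compact A.
  apply: compact_closedI; first exact: compact_core.
  apply: closedI; last by apply: closed_nonpos; exact: ev_continuous.
  by apply: closedI; apply: open_closedC; exact: open_interior.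
have [G G0 hG] : exists2 G, 0 < G & forall z, C z -> ev g z <= G.
  have [|c _ hc] := attains_max _ compact_core (@ev_continuous R g); first by exists u.
  exists (1 + `|ev g c|); first by rewrite ltr_pwDl.
  by move=> z Cz; have := hc z Cz; have := ler_norm (ev g c); lra.
have [e3 e30 far] : exists2 e3, 0 < e3 & forall z, A z -> ev f z <= - e3 * ev g z.
  have [A0|A0] := pselect (A !=set0); last first.
    by exists 1 => // z Az; exfalso; apply: A0; exists z.
  have [c Ac hc] := attains_max A0 cA (@ev_continuous R f).
  have fc : ev f c < 0.
    have [Cc [[nN1 nN2] /= gc]] := Ac; have [c1 _] := Cc.
    rewrite ev_oppf oppr_le0 in gc.
    rewrite lt_neqAle (fin c Cc) andbT; apply/eqP => fc.
    have gc0 : ev g c = 0 by apply/eqP; rewrite eq_le gc andbT; exact: noc.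
    have [cu|cv] := line_sphere fg u1 v1 c1 uv fu fv gu gv fc gc0.
      by apply: nN1; rewrite cu.
    by apply: nN2; rewrite cv.
  exists (- ev f c / G); first by rewrite divr_gt0// oppr_gt0.
  move=> z Az; apply: (le_trans (hc z Az)).
  have [Cz [_ /= gz]] := Az; rewrite ev_oppf oppr_le0 in gz.
  have -> : - (- ev f c / G) * ev g z = ev f c * (ev g z / G) by field; rewrite gt_eqF.
  have : ev g z / G <= 1 by rewrite ler_pdivrMr// mul1r hG.
  by nra.
pose e := Num.min e1 (Num.min e2 e3).
have e0 : 0 < e by rewrite !lt_min e10 e20 e30.
exists e => // z Cz; rewrite ev_pencil.
have [gz|gz] := leP (ev g z) 0; first by have := fin z Cz; nra.
have le_e (e' : R) : e <= e' -> ev f z <= - e' * ev g z -> ev f z + e * ev g z <= 0 by nra.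
have [z1|z1] := pselect (N1 z).
  by apply: (le_e e1); [rewrite ge_min lexx|exact: (interior_subset z1)].
have [z2|z2] := pselect (N2 z).
  by apply: (le_e e2); [rewrite !ge_min lexx orbT|exact: (interior_subset z2)].
apply: (le_e e3); first by rewrite !ge_min lexx !orbT.
by apply: far; split => //; split => //=; rewrite ev_oppf oppr_le0 ltW.
Qed.

(** T is the supremum of the t for which f + t g is inner; without a contact in g > 0,
    [pencil_escape] would allow a larger value. *)
Lemma blocked_pencil f g u v : cross f.1 g.1 != 0 -> inner f ->
  C u -> C v -> u <> v -> ev f u = 0 -> ev f v = 0 -> ev g u = 0 -> ev g v = 0 ->
  (exists2 w, C w & 0 < ev g w) ->
  exists T, [/\ 0 <= T, inner (pencil f T g) &
    exists2 w, C w & ev (pencil f T g) w = 0 /\ 0 < ev g w].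
Proof.
move=> fg fin Cu Cv uv fu fv gu gv [w0 Cw0 gw0].
pose J : set R := [set t | 0 <= t /\ inner (pencil f t g)].
have J0 : J 0.
  by split => // z Cz; rewrite ev_pencil mul0r addr0; exact: fin.
have Jub t : J t -> t <= - ev f w0 / ev g w0.
  by move=> [_ /(_ w0 Cw0)]; rewrite ev_pencil ler_pdivlMr//; lra.
have supJ : has_sup J by split; [exists 0|exists (- ev f w0 / ev g w0) => t; exact: Jub].
pose T := sup J.
have T0 : 0 <= T by apply: sup_upper_bound.
have Tin : inner (pencil f T g).
  move=> z Cz; rewrite ev_pencil; have fz := fin z Cz.
  have [gz|gz] := leP (ev g z) 0; first by nra.
  have : T <= - ev f z / ev g z.
    apply: ge_sup; first by exists 0.
    by move=> t [_ /(_ z Cz)]; rewrite ev_pencil ler_pdivlMr//; lra.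
  by rewrite ler_pdivlMr//; lra.
exists T; split => //; apply: contrapT => nw.
have [e e0 ein] : exists2 e, 0 < e & inner (pencil (pencil f T g) e g).
  apply: (@pencil_escape _ _ u v) => //.
  - by rewrite cross_pencil.
  - by rewrite ev_pencil fu gu mulr0 addr0.
  - by rewrite ev_pencil fv gv mulr0 addr0.
  - move=> w Cw fw; rewrite leNgt; apply/negP => gw; apply: nw.
    by exists w.
have : T + e <= T.
  apply: sup_upper_bound => //; split; first by rewrite addr_ge0// ltW.
  by move=> z Cz; have := ein z Cz; rewrite !ev_pencil; lra.
lra.
Qed.

End blocked_pencil.

(** * The smallest cap around the core and a gap between its contacts *)

Section first_gap.
Context (R : realType).
Notation V := 'rV[R]_3.
Notation S2 := (sphere2 R).
Implicit Types (f g : V * R) (u v w x y z d : V).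

Lemma dot_cross_cross u v : dot (cross u v) (cross u v) = dot u u * dot v v - dot u v ^+ 2.
Proof. by rewrite /cross !dotE !coordE; ring. Qed.

(** The support function of C is continuous although its maximiser [c] is an arbitrary choice; its
    minimum over the sphere defines the smallest cap. *)
Lemma minimal_support (C : set V) : C !=set0 -> compact C -> exists x (h : R),
  [/\ S2 x, exists2 u, C u & dot u x = h, forall z, C z -> dot z x <= h &
      forall x', S2 x' -> exists2 z, C z & h <= dot z x'].
Proof.
move=> C0 cC.
have /choice[c hc] : forall x, exists y, C y /\ forall z, C z -> dot z x <= dot y x.
  move=> x.
  by have [y Cy hy] := attains_max C0 cC (@dot_continuousl R x); exists y.
have [B B0 hB] : exists2 B : R, 0 < B & forall z, C z -> dot z z <= B.
  have [y Cy hy] := attains_max C0 cC (@dotdot_continuous R).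
  exists (1 + dot y y); first by rewrite ltr_pwDl// dot_ge0.
  by move=> z Cz; rewrite (le_trans (hy z Cz))// lerDr.
pose h x := dot (c x) x.
have ch : continuous h.
  move=> x; apply/(@cvgrPdist_lt _ _ _ (nbhs x) _ h (h x)) => e e0.
  have n1 : \forall y \near x, dot (x - y) (x - y) < e ^+ 2 / B.
    have E y : dot (x - y) (x - y) = dot x x - 2 * dot y x + dot y y.
      by rewrite dotBl !dotBr (dotC x y); ring.
    have cd : {for x, continuous (fun y => dot (x - y) (x - y))}.
      rewrite (funext E).
      exact: (cvgD (cvgB (cvg_cst _) (cvgM (cvg_cst _) (@dot_continuousl R x x))) (@dotdot_continuous R x)).
    apply: (cvgr_lt _ cd); rewrite subrr dot0l.
    by rewrite divr_gt0// exprn_gt0.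
  apply: filterS n1 => y ny.
  have bound z : C z -> `|dot z (x - y)| < e.
    move=> Cz; rewrite -ltr_sqr ?nnegrE ?normr_ge0 ?ltW// real_normK ?num_real//.
    apply: (le_lt_trans (cauchy_schwarz _ _)).
    move: ny; rewrite ltr_pdivlMr// => ny.
    have := hB z Cz; have := dot_ge0 (x - y); nra.
  have [Cx hx] := hc x; have [Cy hy] := hc y.
  have := bound _ Cx; have := bound _ Cy; rewrite !ltr_norml !dotBr => /andP[a1 a2] /andP[b1 b2].
  have := hx _ Cy; have := hy _ Cx => l1 l2.
  rewrite /h; move: l1 l2 => l1 l2.
  by apply/andP; split; lra.
have S0 : S2 !=set0.
  exists (vec3 1 0 0); rewrite /sphere2/= dotE !coordE; ring.
have [x x1 hx] := attains_min S0 (@compact_sphere R) ch.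
exists x, (h x); split => //.
- by exists (c x) => //; case: (hc x).
- by case: (hc x).
- by move=> x' x'1; exists (c x'); [case: (hc x')|exact: hx].
Qed.

(** Tilting x along the tangent vector d, away from the only contact u, lowers the products near u
    to first order; elsewhere there is a gap e, and renormalising costs only second order. *)
Lemma perturb_support (C : set V) x u (h : R) : compact C -> (forall z, C z -> S2 z) ->
  S2 x -> -1 < h < 1 -> C u -> dot u x = h -> (forall z, C z -> dot z x <= h) ->
  (forall z, C z -> dot z x = h -> z = u) ->
  exists2 x', S2 x' & forall z, C z -> dot z x' < h.
Proof.
move=> cC CS x1 /andP[hm hM] Cu uh Ch only.
have u1 := CS u Cu.
pose d := h *: x - u; pose q := 1 - h ^+ 2.
have q0 : 0 < q by rewrite /q; nra.
have q1 : q <= 1 by rewrite /q; nra.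
have xx : dot x x = 1 by [].
have uu : dot u u = 1 by [].
have dx : dot x d = 0 by rewrite /d dotBr dotZr xx (dotC x) uh; ring.
have dd : dot d d = q.
  by rewrite /d dotBl !dotBr !dotZl !dotZr xx uu (dotC x) uh /q; ring.
have ud : dot u d = - q by rewrite /d dotBr dotZr uu uh /q; ring.
pose N := C `&` [set z | - (dot d z + q / 2) <= 0].
have cN : compact N.
  apply: compact_closedI => //; apply: closed_nonpos => z.
  exact: (cvgN (cvgD (@dot_continuous R d z) (cvg_cst _))).
have [e e0 he] : exists2 e, 0 < e & forall z, N z -> dot z x <= h - e.
  have [N0|N0] := pselect (N !=set0); last first.
    by exists 1 => // z Nz; exfalso; apply: N0; exists z.
  have [y [Cy /= Ny] hy] := attains_max N0 cN (@dot_continuousl R x).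
  exists (h - dot y x).
    rewrite subr_gt0 lt_neqAle Ch// andbT; apply/eqP => yh.
    by move: Ny; rewrite (only y Cy yh) (dotC d) ud; lra.
  by move=> z /hy; lra.
pose s := Num.min 4^-1 (e / 4).
have s0 : 0 < s by rewrite lt_min !divr_gt0// invr_gt0 ltr0n.
have s1 : s <= 4^-1 by rewrite ge_min lexx.
have se : s <= e / 4 by rewrite ge_min lexx orbT.
have s1' : 4 * s <= 1 by lra.
have se' : 4 * s <= e by lra.
(* The margin s^2 q pays for the renormalisation by k, which raises the bound when h < 0. *)
have main z : C z -> dot z x + s * dot z d < h - s ^+ 2 * q.
  move=> Cz; have := Ch z Cz.
  have zd : dot z d <= 1.
    have := dot_ge0 (z - d); rewrite (dotBl z) !(dotBr _ z) dd (dotC d) (CS z Cz : dot z z = 1); lra.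
  have s2 : s ^+ 2 * q <= s * 4^-1 * q by rewrite expr2 ler_wpM2r ?ler_wpM2l// ltW.
  have [zN|zN] := leP (- (dot d z + q / 2)) 0.
    have := he z (conj Cz zN); have : s * dot z d <= s by rewrite ler_piMr// ltW.
    have : s * 4^-1 * q <= s by rewrite -mulrA ler_piMr ?(ltW s0)//; lra.
    by lra.
  have : s * dot z d <= s * (- (q / 2)).
    by rewrite ler_wpM2l ?(ltW s0)// dotC; lra.
  have : 0 < s * q by rewrite mulr_gt0.
  by nra.
pose D := 1 + s ^+ 2 * q; pose k := (Num.sqrt D)^-1.
have D1 : 1 <= D by rewrite /D lerDl mulr_ge0 ?sqr_ge0 ?(ltW q0).
have D0 : 0 < D by lra.
have k0 : 0 < k by rewrite invr_gt0 sqrtr_gt0.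
have kD : k ^+ 2 * D = 1.
  by rewrite /k exprVn sqr_sqrtr ?(ltW D0)// mulVf// gt_eqF.
have k1 : k <= 1.
  by rewrite invf_le1 ?sqrtr_gt0// -[leLHS]sqrtr1 ler_wsqrtr.
exists (k *: (x + s *: d)).
  rewrite /sphere2/= dotZl dotZr (dotDl x) !(dotDr _ x) (dotC _ x) !dotZl !dotZr dx dd xx.
  by rewrite -[RHS]kD /D; ring.
move=> z Cz; rewrite (dotZr k) (dotDr z x) (dotZr s z d).
have := main z Cz.
set L := _ + _; move=> hL.
have kL : k * L < k * (h - s ^+ 2 * q) by rewrite ltr_pM2l.
apply: (lt_le_trans kL).
(* k * (s^2 q) = (1 - k) (1 + k) / k >= 1 - k *)
have E : k * (k * (s ^+ 2 * q)) = (1 - k) * (1 + k).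
  by move: kD; rewrite /D; lra.
have : 1 - k <= k * (s ^+ 2 * q).
  rewrite -(ler_pM2l k0) E.
  by nra.
have : 0 <= (1 - k) * (1 + h) by rewrite mulr_ge0; lra.
by nra.
Qed.

Variables (I : finType) (F : I -> V * R).
Notation C := (core F).
Notation inner := (inner F).
Hypothesis Fn : forall i, (F i).1 != 0.
Hypothesis Ccon : connected C.
Hypothesis Cfull : forall f, f.1 != 0 -> exists2 z, C z & ev f z <> 0.
Hypothesis I3 : (2 < #|I|)%N.

Definition separate_cap := exists j, forall k, k != j ->
  ~ exists z, [/\ S2 z, 0 < ev (F j) z & 0 < ev (F k) z].

Lemma some_index : exists i : I, True.
Proof. by have /card_gt0P[i _] : (0 < #|I|)%N by apply: leq_trans I3. Qed.

Lemma two_contacts : separate_cap \/ exists x (h : R) u v,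
  [/\ S2 x, -1 < h < 1, inner (x, h) & [/\ C u, C v, u <> v, dot x u = h & dot x v = h]].
Proof.
have C0 : C !=set0.
  have [i _] := some_index; have [z Cz _] := Cfull (Fn i); by exists z.
have [x [h [x1 [u Cu uh] Ch hmin]]] := minimal_support C0 (@compact_core R I F).
have [u1 _] := Cu.
have hm : -1 < h.
  rewrite lt_neqAle -{2}uh sphere_dot_geN1// andbT; apply/eqP => hE.
  have [z Cz] := Cfull (sphere_neq0 x1 : (x, h).1 != 0); apply.
  have [z1 _] := Cz; have := Ch z Cz; have := sphere_dot_geN1 z1 x1.
  by rewrite /ev/= (dotC x); lra.
(* For h >= 1 every point of the sphere is in the core, so all caps are empty and any of them is
   separate. *)
have [h1|h1] := leP 1 h.
  left; have [i _] := some_index; exists i => k _ [z [z1 iz _]].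
  have [y [y1 Cy] zy] := hmin z z1.
  have yz : y = z by apply: sphere_dot1 => //; lra.
  by have := Cy i; rewrite yz leNgt iz.
have [h2|h2] := pselect (forall z, C z -> dot z x = h -> z = u).
  have CS z : C z -> S2 z by case.
  have [x' x'1 hx'] := perturb_support (@compact_core R I F) CS x1 (introT andP (conj hm h1)) Cu uh Ch h2.
  by have [z Cz hz] := hmin x' x'1; have := hx' z Cz; rewrite ltNge hz.
right; have [v [Cv vh vu]] : exists v, [/\ C v, dot v x = h & v <> u].
  apply: contrapT => nv; apply: h2 => z Cz zh; apply: contrapT => zu.
  by apply: nv; exists z.
exists x, h, u, v; split => //; first by rewrite hm h1.
  by move=> z /Ch; rewrite /ev/= (dotC x) subr_le0.
by split => //; [exact/nesym|rewrite dotC|rewrite dotC].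
Qed.

(** A full circle of contacts makes {f > 0} a cap j. A cap k that meets j cannot cross the circle,
    so it lies in {f > 0} too; j and k are then alone in their classes and any third index completes
    the split. *)
Lemma full_circle x (h : R) u : S2 x -> -1 < h < 1 -> inner (x, h) ->
  C u -> dot x u = h -> (forall z, S2 z -> dot x z = h -> C z) ->
  separate_cap \/ split3 F.
Proof.
move=> x1 /andP[hm hM] fin Cu uh circ.
have xx : dot x x = 1 by [].
have [u1 _] := Cu; have uu : dot u u = 1 by [].
have q0 : 0 < 1 - h ^+ 2 by nra.
pose f : V * R := (x, h).
have fE z : S2 z -> ev f z = 0 -> C z.
  by move=> z1 fz; apply: circ => //; move: fz; rewrite /ev/=; lra.
have [j jf] : exists j, supports F j f.
  (* v is opposite to u on the circle, and w is a quarter turn away from both. *)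
  pose v := (2 * h) *: x - u; pose w := h *: x + cross x u.
  pose g : V * R := (cross x u, 0).
  have xw := dot_cross1 x u; have uw := dot_cross2 x u; have ww := dot_cross_cross x u.
  have wx : dot (cross x u) x = 0 by rewrite dotC.
  have wu : dot (cross x u) u = 0 by rewrite dotC.
  rewrite xx uu uh mulr1 in ww.
  have v1 : S2 v.
    by rewrite /sphere2/= /v dotBl !dotBr !dotZl !dotZr xx uu (dotC u) uh; ring.
  have vh : dot x v = h by rewrite /v dotBr dotZr xx uh; ring.
  have w1 : S2 w.
    by rewrite /sphere2/= /w dotDl !dotDr !dotZl !dotZr xx xw wx ww; ring.
  have wh : dot x w = h by rewrite /w dotDr dotZr xx xw; ring.
  apply: (@arc_in_core R I F Fn Cfull f g u v w fin) => //.
  - apply/eqP => /(congr1 (dot u)); rewrite /f/g/= => E.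
    have : dot u (cross x (cross x u)) = h ^+ 2 - 1.
      have -> : dot u (cross x (cross x u)) = dot x u ^+ 2 - dot x x * dot u u.
        by rewrite /cross !dotE !coordE; ring.
      by rewrite uh xx uu mulr1.
    by rewrite E dot0r; lra.
  - exact: circ.
  - move=> uv; have : dot u v = 1 by rewrite -uv.
    by rewrite /v dotBr dotZr uu (dotC u) uh; lra.
  - by rewrite /ev/= uh subrr.
  - by rewrite /ev/= vh subrr.
  - by rewrite /ev/= wh subrr.
  - by rewrite /ev/= wu subr0.
  - by rewrite /ev/= /v dotBr dotZr wx wu; ring.
  - by rewrite /ev/= /w dotDr dotZr wx ww; lra.
  - by move=> z z1 fz _; exact: fE.
have [h1|h1] := pselect (forall k, k != j ->
    ~ exists z, [/\ S2 z, 0 < ev (F j) z & 0 < ev (F k) z]); first by left; exists j.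
right; have [k [kj [z [z1 jz kz]]]] : exists k, k != j /\ exists z, [/\ S2 z, 0 < ev (F j) z & 0 < ev (F k) z].
  apply: contrapT => nk; apply: h1 => k kj hk; apply: nk; by exists k.
have fz : 0 < ev f z.
  by case: jf jz => c c0 ->; rewrite pmulr_rgt0.
have kin y : S2 y -> 0 < ev (F k) y -> 0 < ev f y.
  move=> y1 ky; rewrite ltNge; apply/negP => fy.
  have [p [p1 fp kp]] := cap_meets_circle z1 y1 kz ky fz fy.
  by have [_ /(_ k)] := fE p p1 fp; rewrite leNgt kp.
have [l lj lk] : exists2 l, l != j & l != k.
  have : (0 < #|(~: [set j; k])%SET|)%N.
    by rewrite cardsCs finset.setCK subn_gt0 (leq_ltn_trans _ I3)// cards2; case: (_ != _).
  by case/card_gt0P => l; rewrite !inE negb_or => /andP[]; exists l.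
exists f; split => //; first exact: sphere_neq0 x1.
exists j, k, l; split.
- by move/(supports_isolated jf) => E; rewrite E eqxx in kj.
- by move/(supports_isolated jf) => E; rewrite E eqxx in lj.
- by move/(isolated kin) => E; rewrite E eqxx in lk.
Qed.

(** Projecting the circle stereographically from a point y outside the core turns its contacts into
    a compact set of reals; u' and v' are its extremes, and their chord leaves all contacts on one
    side. *)
Lemma gap_ends x (h : R) u v y : S2 x -> -1 < h < 1 ->
  C u -> C v -> u <> v -> dot x u = h -> dot x v = h -> S2 y -> dot x y = h -> ~ C y ->
  exists g u' v', [/\ cross x g.1 != 0, [/\ C u', C v', u' <> v', dot x u' = h & dot x v' = h],
    ev g u' = 0, ev g v' = 0 & forall z, C z -> dot x z = h -> ev g z <= 0].
Proof.
move=> x1 /andP[hm hM] Cu Cv uv uh vh y1 yh nCy.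
have xx : dot x x = 1 by [].
have yy : dot y y = 1 by [].
pose q := 1 - h ^+ 2.
have q0 : 0 < q by rewrite /q; nra.
pose e := cross x y; pose p := h *: x - y.
have xe : dot x e = 0 by exact: dot_cross1.
have ye : dot y e = 0 by exact: dot_cross2.
have xp : dot x p = 0 by rewrite /p dotBr dotZr xx yh; ring.
have ee : dot e e = q by rewrite dot_cross_cross xx yy yh /q; ring.
have pp : dot p p = q by rewrite /p dotBl !dotBr !dotZl !dotZr xx yy (dotC y) yh /q; ring.
pose E := C `&` ([set z | ev (x, h) z <= 0] `&` [set z | ev (oppf (x, h)) z <= 0]).
have EP z : E z <-> C z /\ dot x z = h.
  split=> [[Cz [/=]]|[Cz zh]].
    by rewrite ev_oppf oppr_le0 /ev/= => h1 h2; split => //; lra.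
  by split => //=; rewrite ev_oppf /ev/= zh subrr oppr0.
have cE : compact E.
  apply: compact_closedI; first exact: compact_core.
  by apply: closedI; apply: closed_nonpos; exact: ev_continuous.
have Eu : E u by apply/EP.
have y_lt z : E z -> 0 < 1 - dot y z.
  move=> /EP[Cz _]; rewrite subr_gt0; apply: sphere_dot_lt1 => //; first by case: Cz.
  by move=> yz; apply: nCy; rewrite yz.
pose s z := dot e z / (1 - dot y z).
have cs : {within E, continuous s}.
  apply: continuous_in_subspaceT => z /set_mem /y_lt yz.
  have c1 : {for z, continuous (fun z => 1 - dot y z)}.
    exact: (cvgB (cvg_cst _) (@dot_continuous R y z)).
  exact: (cvgM (@dot_continuous R e z) (cvgV (lt0r_neq0 yz) c1)).
(* b z (1 + s z ^ 2) = 2, the stereographic parametrisation of the circle from y *)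
pose b z := (1 - dot y z) / q.
have b0 z : E z -> 0 < b z by move=> /y_lt yz; rewrite divr_gt0.
have ez z : E z -> dot e z = q * (b z * s z).
  by move=> /y_lt yz; rewrite /b /s; field; rewrite !gt_eqF.
have pz z : E z -> dot p z = q * b z - q.
  move=> /EP[_ zh]; rewrite /p dotBl dotZl zh /b /q; field.
  by rewrite gt_eqF.
have zE z : E z -> z = y + (b z * s z) *: e + b z *: p.
  move=> Ez; have Ez' := Ez; move/EP: Ez' => [Cz zh].
  have B := cross_basis x y e z.
  have De : dot x (cross y e) = q.
    by rewrite -ee /e /cross !dotE !coordE; ring.
  have ye1 : cross y e = x - h *: y.
    have -> : cross y e = dot y y *: x - dot x y *: y.
      by rewrite /e; apply: vec3P; rewrite /cross !dotE !coordE; ring.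
    by rewrite yy yh scale1r.
  have ex : cross e x = y - h *: x.
    have -> : cross e x = dot x x *: y - dot x y *: x.
      by rewrite /e; apply: vec3P; rewrite /cross !dotE !coordE; ring.
    by rewrite xx yh scale1r.
  rewrite De zh ye1 ex ez// -/e in B.
  apply: (scalerI (lt0r_neq0 q0)); rewrite B.
  have -> : dot y z = 1 - q * b z by rewrite /b; field; rewrite gt_eqF.
  by rewrite /p; apply: vec3P; rewrite !coordE /q; ring.
have bs z : E z -> b z * (1 + s z ^+ 2) = 2.
  move=> Ez; have Ez' := Ez; move/EP: Ez' => [[z1 _] _].
  have : dot z z = 1 by [].
  rewrite {2}(zE z Ez) !(dotDr z) (dotZr (b z * s z)) (dotZr (b z)) (dotC z e) (dotC z p) ez// pz//.
  have -> : dot z y = 1 - q * b z by rewrite (dotC z) /b; field; rewrite gt_eqF.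
  move=> Q; have : q * b z * (b z * (1 + s z ^+ 2) - 2) = 0 by lra.
  have qb : q * b z != 0 by rewrite gt_eqF// mulr_gt0 ?b0.
  by move/eqP; rewrite mulf_eq0 (negbTE qb) orFb subr_eq0 => /eqP.
have E0 : E !=set0 by exists u.
have [u' /set_mem Eu' hu'] := EVT_min_rV E0 cE cs.
have [v' /set_mem Ev' hv'] := EVT_max_rV E0 cE cs.
have sinj z z' : E z -> E z' -> s z = s z' -> z = z'.
  move=> Ez Ez' zz'; have bb : b z = b z'.
    have S0 : 0 < 1 + s z' ^+ 2 by rewrite ltr_pwDl// sqr_ge0.
    have := bs z Ez; rewrite zz' -(bs z' Ez') => /(mulIf (lt0r_neq0 S0)); exact.
  by rewrite (zE z Ez) (zE z' Ez') zz' bb.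
have uv' : u' <> v'.
  move=> E1; have Ev : E v by apply/EP.
  apply: uv; apply: sinj => //; apply/eqP; rewrite eq_le.
  have := hu' u (mem_set Eu); have := hv' u (mem_set Eu).
  have := hu' v (mem_set Ev); have := hv' v (mem_set Ev).
  by rewrite E1; lra.
(* As b s^2 = 2 - b, the product b (s - s u') (s - s v') is affine in b s and b, hence in z; A and B
   are its coefficients. *)
pose A := - (s u' + s v'); pose B := s u' * s v' - 1.
pose n : V := A *: e + B *: p.
pose g : V * R := (n, dot n y - 2 * q).
have gE z : E z -> ev g z = q * (b z * ((s z - s u') * (s z - s v'))).
  move=> Ez; rewrite /ev/= /n !dotDl !dotZl ez// pz// (dotC e y) ye.
  have -> : dot p y = - q by rewrite /p dotBl dotZl yh yy /q; ring.
  have bz := bs z Ez; rewrite /A /B.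
  have -> : 2 * q = q * (b z * (1 + s z ^+ 2)) by rewrite bz; ring.
  by ring.
have [Cu' uh'] : C u' /\ dot x u' = h by apply/EP.
have [Cv' vh'] : C v' /\ dot x v' = h by apply/EP.
exists g, u', v'; split => //.
- apply/eqP => c0; have := dot_cross_cross x n; rewrite /g/= in c0; rewrite c0 dot0l xx.
  have -> : dot x n = 0 by rewrite /n dotDr !dotZr xe xp; ring.
  rewrite mul1r expr2 mulr0 subr0 => /esym/dot_eq0 n0.
  by have := gE u' Eu'; rewrite /ev/= n0 !dot0l !subrr mul0r !mulr0; lra.
- by rewrite gE// subrr mul0r !mulr0.
- by rewrite gE// subrr !mulr0.
- move=> z Cz zh; have Ez : E z by apply/EP.
  rewrite gE// (pmulr_rle0 _ q0) (pmulr_rle0 _ (b0 z Ez)).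
  have := hu' z (mem_set Ez); have := hv' z (mem_set Ez); nra.
Qed.

Lemma first_gap : (separate_cap \/ split3 F) \/ exists f g u v,
  [/\ cross f.1 g.1 != 0, inner f, [/\ C u, C v & u <> v],
    [/\ ev f u = 0, ev f v = 0, ev g u = 0 & ev g v = 0] &
    forall w, C w -> ev f w = 0 -> ev g w <= 0].
Proof.
have [|[x [h [u [v [x1 hh fin [Cu Cv uv uh vh]]]]]]] := two_contacts; first by left; left.
have [h1|h1] := pselect (forall z, S2 z -> dot x z = h -> C z).
  by left; exact: full_circle hh fin Cu uh h1.
right; have [y [y1 yh nCy]] : exists y, [/\ S2 y, dot x y = h & ~ C y].
  apply: contrapT => ny; apply: h1 => z z1 zh; apply: contrapT => nCz.
  by apply: ny; exists z.
have [g [u' [v' [xg [Cu' Cv' uv' uh' vh'] gu gv gw]]]] :=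
  gap_ends x1 hh Cu Cv uv uh vh y1 yh nCy.
exists (x, h), g, u', v'; split => //; first by split => //; rewrite /ev/= ?uh' ?vh' subrr.
by move=> w Cw; rewrite {1}/ev/= => /eqP; rewrite subr_eq0 => /eqP; exact: gw.
Qed.

End first_gap.

(** * Existence of a separating functional *)

Section median.
Context (R : realType).
Notation V := 'rV[R]_3.
Notation S2 := (sphere2 R).
Implicit Types (f g : V * R) (u v w x y z : V) (t : R).
Variables (I : finType) (F : I -> V * R).
Notation C := (core F).
Notation inner := (inner F).
Hypothesis Fn : forall i, (F i).1 != 0.
Hypothesis Ccon : connected C.
Hypothesis Cfull : forall f, f.1 != 0 -> exists2 z, C z & ev f z <> 0.

(** A rotation is stopped only if g takes the corresponding sign on the core. Adding a multiple of f
    to g provides both signs and leaves g unchanged on the circle f = 0. *)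
Lemma both_signs f g : f.1 != 0 -> cross f.1 g.1 != 0 -> inner f ->
  (forall w, C w -> ev f w = 0 -> ev g w <= 0) ->
  exists M : R, (exists2 w, C w & 0 < ev (pencil g M f) w) /\
    (exists2 w, C w & ev (pencil g M f) w < 0).
Proof.
move=> f0 fg fin gap.
have [z0 Cz0 fz0] := Cfull f0.
have fz : ev f z0 < 0 by rewrite lt_neqAle (fin z0 Cz0) andbT; apply/eqP.
(* M0 makes the functional vanish at z0 but not on the whole core; a small change of M0 then gives
   z0 and a second point opposite signs. *)
pose M0 := - ev g z0 / ev f z0.
have M0E : ev g z0 + M0 * ev f z0 = 0 by rewrite /M0; field; lra.
have [|z1 Cz1 /eqP] := Cfull (_ : (pencil g M0 f).1 != 0).
  apply/eqP => h; move/eqP: fg; apply; rewrite -(cross_pencilr f M0 g) h.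
  by apply: vec3P; rewrite /cross !coordE; ring.
have f1 := fin z1 Cz1.
rewrite ev_pencil neq_lt => /orP[h|h].
  pose e := - (ev g z1 + M0 * ev f z1) / (2 * (1 - ev f z1)).
  have e0 : 0 < e by rewrite divr_gt0//; lra.
  have eE : e * (2 * (1 - ev f z1)) = - (ev g z1 + M0 * ev f z1).
    by rewrite /e; field; lra.
  exists (M0 - e); split; [exists z0|exists z1] => //; rewrite ev_pencil; nra.
have f1' : ev f z1 < 0.
  rewrite lt_neqAle f1 andbT; apply/eqP => f10.
  by have := gap z1 Cz1 f10; rewrite f10 mulr0 addr0 in h; rewrite leNgt h.
pose e := (ev g z1 + M0 * ev f z1) / (- 2 * ev f z1).
have e0 : 0 < e by rewrite divr_gt0//; lra.
have eE : e * (- 2 * ev f z1) = ev g z1 + M0 * ev f z1.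
  by rewrite /e; field; lra.
by exists (M0 + e); split; [exists z1|exists z0] => //; rewrite ev_pencil; nra.
Qed.

(* Links persist under small changes of t, as a witness may be moved off {f + t g = 0}. *)
Lemma linked_open f g u v t : cross f.1 g.1 != 0 -> S2 u -> S2 v -> u <> v ->
  ev f u = 0 -> ev f v = 0 -> ev g u = 0 -> ev g v = 0 ->
  \forall t' \near t, forall i j, connect (linked F (pencil f t g)) i j ->
    connect (linked F (pencil f t' g)) i j.
Proof.
move=> fg u1 v1 uv fu fv gu gv.
have step : \forall t' \near t, forall ij : I * I, linked F (pencil f t g) ij.1 ij.2 ->
    linked F (pencil f t' g) ij.1 ij.2.
  apply: (@filter_forall R _ (fun ij t' => linked F (pencil f t g) ij.1 ij.2 ->
    linked F (pencil f t' g) ij.1 ij.2) (nbhs t) _) => -[i j]/=.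
  have [h|h] := boolP (linked F (pencil f t g) i j); last by apply: filterS filterT.
  have /asboolP[z [z1 iz jz fz]] := h.
  have [z' [z'1 iz' jz' fz']] : exists z', [/\ S2 z', 0 < ev (F i) z', 0 < ev (F j) z' &
      ev (pencil f t g) z' < 0].
    have [fz0|fz0] := eqVneq (ev (pencil f t g) z) 0; last first.
      by exists z; split => //; rewrite lt_neqAle fz0.
    have ni : \forall y \near z, 0 < ev (F i) y.
      exact: (cvgr_gt _ (@ev_continuous R (F i) z) _ iz).
    have nj : \forall y \near z, 0 < ev (F j) y.
      exact: (cvgr_gt _ (@ev_continuous R (F j) z) _ jz).
    have [|||z' [z'1 [iz' jz'] fz']] :=
      @near_contact_neg R (pencil f t g) u v z _ _ u1 v1 uv _ _ z1 fz0 (filterI ni nj).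
    - by apply: (@cross_neq0l _ _ g); rewrite cross_pencil.
    - by rewrite ev_pencil fu gu mulr0 addr0.
    - by rewrite ev_pencil fv gv mulr0 addr0.
    by exists z'.
  have ct : {for t, continuous (fun t' => ev f z' + t' * ev g z')}.
    exact: (cvgD (cvg_cst _) (cvgM (@cvg_id _ _) (cvg_cst _))).
  have : \forall t' \near t, ev f z' + t' * ev g z' < 0.
    by apply: (cvgr_lt _ ct); rewrite -ev_pencil.
  apply: filterS => t' ft' _; apply/asboolP; exists z'; split => //.
  by rewrite ev_pencil ltW.
apply: filterS step => t' h i j; apply: connect_sub => k l kl.
exact: connect1 (h (k, l) kl).
Qed.

Theorem median_cap : (2 < #|I|)%N -> separate_cap F \/ split3 F.
Proof.
move=> I3; have [//|[f [g0 [u [v [fg0 fin [Cu Cv uv] [fu fv g0u g0v] gap]]]]]] := first_gap Fn Cfull I3.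
have f0 := cross_neq0l fg0.
have [M [[w0 Cw0 gw0] [w0' Cw0' gw0']]] := both_signs f0 fg0 fin gap.
set g := pencil g0 M f in gw0 gw0'.
have fg : cross f.1 g.1 != 0 by rewrite cross_pencilr.
have gu : ev g u = 0 by rewrite ev_pencil fu g0u mulr0 addr0.
have gv : ev g v = 0 by rewrite ev_pencil fv g0v mulr0 addr0.
have gapg w : C w -> ev f w = 0 -> ev g w <= 0.
  by move=> Cw fw; rewrite ev_pencil fw mulr0 addr0; exact: gap.
clearbody g.
have [//|ns] := pselect (split3 F); first by right.
right; exfalso.
have [u1 _] := Cu; have [v1 _] := Cv.
have [T1 [T10 in1 [w1 Cw1 [fw1 gw1]]]] :
    exists T : R, [/\ 0 <= T, inner (pencil f T g) &
      exists2 w, C w & ev (pencil f T g) w = 0 /\ 0 < ev g w].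
  by apply: (@blocked_pencil R I F f g u v) => //; exists w0.
have fg' : cross f.1 (oppf g).1 != 0 by rewrite cross_opp oppr_eq0.
have [T2 [T20 in2 [w2 Cw2 [fw2 gw2]]]] :
    exists T : R, [/\ 0 <= T, inner (pencil f T (oppf g)) &
      exists2 w, C w & ev (pencil f T (oppf g)) w = 0 /\ 0 < ev (oppf g) w].
  apply: (@blocked_pencil R I F f (oppf g) u v) => //.
  - by rewrite ev_oppf gu oppr0.
  - by rewrite ev_oppf gv oppr0.
  - by exists w0' => //; rewrite ev_oppf oppr_gt0.
(* The gap makes this rotation nontrivial, so T1 + T2 > 0 and the two extreme planes differ. *)
have T1p : 0 < T1.
  rewrite lt_neqAle T10 andbT eq_sym; apply/eqP => T1E.
  move: fw1; rewrite ev_pencil T1E mul0r addr0 => /(gapg w1 Cw1).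
  by rewrite leNgt gw1.
have third h w : ev h u = 0 -> ev h v = 0 -> 0 < ev h w -> w <> u /\ w <> v.
  by move=> hu hv hw; split => wE; move: hw; rewrite wE ?hu ?hv ltxx.
(* The blocking contact is a third one, so [three_contacts] applies and [ns] leaves only a
   supporting cap. *)
have sup_of (h : V * R) t w : cross f.1 h.1 != 0 -> inner (pencil f t h) ->
    ev h u = 0 -> ev h v = 0 -> C w -> ev (pencil f t h) w = 0 -> 0 < ev h w ->
    exists j, supports F j (pencil f t h).
  move=> fh hin hu hv Cw fw hw; have [wu wv] := third h w hu hv hw.
  have h0 : (pencil f t h).1 != 0 by apply: (@cross_neq0l _ _ h); rewrite cross_pencil.
  have hu' : ev (pencil f t h) u = 0 by rewrite ev_pencil fu hu mulr0 addr0.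
  have hv' : ev (pencil f t h) v = 0 by rewrite ev_pencil fv hv mulr0 addr0.
  by have [] := three_contacts Fn Ccon Cfull h0 hin Cu Cv Cw uv wu wv hu' hv' fw.
have [i si] := sup_of g T1 w1 fg in1 gu gv Cw1 fw1 gw1.
have [j sj] : exists j, supports F j (pencil f T2 (oppf g)).
  apply: (sup_of _ _ w2) => //; by rewrite ev_oppf ?gu ?gv oppr0.
have fi y : exists2 c : R, 0 < c & ev (F i) y = c * (ev f y + T1 * ev g y).
  by have [c c0 E] := si; exists c => //; rewrite E ev_pencil.
have fj y : exists2 c : R, 0 < c & ev (F j) y = c * (ev f y - T2 * ev g y).
  by have [c c0 E] := sj; exists c => //; rewrite E ev_pencil ev_oppf; ring.
have ij : i <> j.
  move=> ij; have [c c0 Ei] := fi w1; have [d d0 Ej] := fj w1; rewrite -ij Ei in Ej.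
  rewrite ev_pencil in fw1; have : d * (T1 + T2) * ev g w1 = 0.
    by rewrite fw1 mulr0 in Ej; nra.
  by move/eqP; rewrite gt_eqF// !mulr_gt0// ltr_pwDl.
have inn t : - T2 <= t <= T1 -> inner (pencil f t g).
  move=> /andP[tm tM] z Cz; have := in1 z Cz; have := in2 z Cz.
  rewrite !ev_pencil ev_oppf => h2 h1; have [gz|gz] := leP (ev g z) 0.
    have tT : 0 <= t + T2 by rewrite -(opprK T2) subr_ge0.
    by have := mulr_ge0_le0 tT gz; lra.
  have tT : 0 <= T1 - t by rewrite subr_ge0.
  by have := mulr_ge0 tT (ltW gz); lra.
(* At the two extremes one of i, j is alone in its class. In between, on the circle f = - t g, the
   functional of i is a positive multiple of (T1 - t) g and that of j of - (t + T2) g, so the two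
   caps meet the circle on opposite sides of the chord. *)
have apart t : - T2 <= t <= T1 -> ~ connect (linked F (pencil f t g)) i j.
  move=> /andP[tm tM].
  have [tE|tN] := eqVneq t T1; first by rewrite tE => /(supports_isolated si).
  have [tE|tN'] := eqVneq t (- T2).
    rewrite linked_connect_sym tE => /(@isolated _ _ _ _ j) h.
    apply: ij; rewrite h// => z z1 jz; have [c c0 E] := fj z.
    by move: jz; rewrite E pmulr_rgt0// ev_pencil; lra.
  have tM' : t < T1 by rewrite lt_neqAle tN.
  have tm' : - T2 < t by rewrite lt_neqAle eq_sym tN'.
  set ft := pencil f t g.
  have ftg : cross ft.1 g.1 != 0 by rewrite cross_pencil.
  have ftg' : cross ft.1 (oppf g).1 != 0 by rewrite cross_opp oppr_eq0.
  have ftu : ev ft u = 0 by rewrite ev_pencil fu gu mulr0 addr0.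
  have ftv : ev ft v = 0 by rewrite ev_pencil fv gv mulr0 addr0.
  have [y [y1 fy gy]] := circle_point ftg u1 v1 uv ftu ftv gu gv.
  have [||y' [y'1 fy' gy']] := circle_point ftg' u1 v1 uv ftu ftv; rewrite ?ev_oppf ?gu ?gv ?oppr0//.
  rewrite ev_oppf oppr_gt0 in gy'.
  have iy : 0 < ev (F i) y.
    have [c c0 ->] := fi y; rewrite pmulr_rgt0//; move: fy; rewrite ev_pencil; nra.
  have jy' : 0 < ev (F j) y'.
    have [c c0 ->] := fj y'; rewrite pmulr_rgt0//; move: fy'; rewrite ev_pencil; nra.
  have ftin : inner ft by apply: inn; rewrite tm tM.
  exact: (chain_separation Ccon ftin Cu Cv uv ftu ftv gu gv ftg y1 fy gy iy y'1 fy' gy' jy').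
have [k ki kj] : exists2 k, k != i & k != j.
  have : (0 < #|(~: [set i; j])%SET|)%N.
    by rewrite cardsCs finset.setCK subn_gt0 (leq_ltn_trans _ I3)// cards2; case: (_ != _).
  by case/card_gt0P => l; rewrite !inE negb_or => /andP[]; exists l.
have either t : - T2 <= t <= T1 -> connect (linked F (pencil f t g)) i k \/
    connect (linked F (pencil f t g)) j k.
  move=> ht; apply: contrapT => /not_orP[nik njk]; apply: ns; exists (pencil f t g); split.
  - by apply: (@cross_neq0l _ _ g); rewrite cross_pencil.
  - exact: inn.
  - by exists i, j, k; split => //; exact: apart.
pose P t := connect (linked F (pencil f t g)) i k.
have TT : - T2 <= T1 by lra.
have P0 : P (- T2).
  have [|//|] := either (- T2); first by rewrite lexx.
  move/(@isolated _ _ _ _ j) => h; move/eqP: kj; case; rewrite -h// => z z1 jz.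
  have [c c0 E] := fj z.
  by move: jz; rewrite E pmulr_rgt0// ev_pencil; lra.
have : forall t, t \in `[- T2, T1] -> P t.
  apply: (@connected_locally_constant _ [set` `[- T2, T1]] P (@segment_connected R _ _)).
  - by exists (- T2) => //=; rewrite in_itv/= lexx.
  - move=> t _ Pt; have := linked_open t fg u1 v1 uv fu fv gu gv.
    by apply: filterS => t' h _; exact: h.
  - move=> t tI nPt; have := linked_open t fg u1 v1 uv fu fv gu gv.
    apply: filterS => t' h; rewrite /= in_itv/= => t'I Pt'; rewrite /= in_itv/= in tI.
    have [//|jk] := either t tI; apply: (apart t' t'I).
    by apply: connect_trans Pt' _; rewrite linked_connect_sym; exact: h.
move=> /(_ T1); rewrite in_itv/= lexx TT /P => /(_ isT) /(supports_isolated si) ik.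
by move/eqP: ki; apply.
Qed.

End median.

(** * Induction on the number of caps *)

(** A nonempty clopen part B of X either contains the intersection, and then B united with Y is
    clopen in the union, or avoids it, and then B itself is. *)
Lemma connected_of_union (T : topologicalType) (X Y : set T) : closed X -> closed Y ->
  connected (X `|` Y) -> connected (X `&` Y) -> X `&` Y !=set0 -> connected X.
Proof.
move=> cX cY cXY cXIY [c [Xc Yc]] B B0 [U oU BU] [K cK BK].
have cB : closed B by rewrite BK; exact: closedI.
have BX : B `<=` X by rewrite BU => z [].
have [[b [[Xb Yb] Bb]]|nB] := pselect (X `&` Y `&` B !=set0).
  have YB : X `&` Y `<=` B.
    have <- : X `&` Y `&` B = X `&` Y; last by move=> z [].
    apply: cXIY; first by exists b.
      exists U => //; apply/seteqP; split => z [[Xz Yz] h]; split => //.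
        by move: h; rewrite BU => -[].
      by rewrite BU.
    exists K => //; apply/seteqP; split => z [[Xz Yz] h]; split => //.
      by move: h; rewrite BK => -[].
    by rewrite BK.
  have E : B `|` Y = X `|` Y.
    apply: cXY; first by exists b; left.
      exists (~` (X `&` ~` U)); first by rewrite openC; apply: closedI => //; exact: open_closedC.
      apply/seteqP; split => z.
        move=> [Bz|Yz]; split.
        - by left; exact: BX.
        - by move=> [_]; apply; move: Bz; rewrite BU => -[].
        - by right.
        - by move=> [Xz]; apply; have : B z by [exact: YB]; rewrite BU => -[].
      move=> [[Xz|Yz] nz]; last by right.
      by left; rewrite BU; split => //; apply: contrapT => nU; exact: nz.
    exists (B `|` Y); first exact: closedU.
    by apply/seteqP; split => z; [move=> [Bz|Yz]; split; [left; exact: BX|left|right|right]|move=> []].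
  apply/seteqP; split => // z Xz.
  have : (B `|` Y) z by rewrite E; left.
  by move=> [//|Yz]; exact: YB.
have E : B = X `|` Y.
  apply: cXY => //; last first.
    exists B => //; apply/seteqP; split => z; [move=> Bz; split => //; left; exact: BX|by move=> []].
  exists (~` ((X `&` ~` U) `|` Y)).
    by rewrite openC; apply: closedU => //; apply: closedI => //; exact: open_closedC.
  apply/seteqP; split => z.
    move=> Bz; split; first by left; exact: BX.
    case=> [[_]|Yz]; first by apply; move: Bz; rewrite BU => -[].
    by apply: nB; exists z; split => //; split => //; exact: BX.
  move=> [[Xz|Yz] nz]; last by exfalso; apply: nz; right.
  by rewrite BU; split => //; apply: contrapT => nU; apply: nz; left.
by exfalso; apply: nB; exists c; split => //; rewrite E; left.
Qed.

(** * Connectedness of the complement of a link class and m *)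

Section spherical_cap_connected.
Context (R : realType).
Notation V := 'rV[R]_3.
Notation S2 := (sphere2 R).
Implicit Types (f : V * R) (u v z d : V).

Lemma push_path_continuous u v d :
  continuous (fun s : R => (u + s *: (v - u)) + push_time (u + s *: (v - u)) d *: d).
Proof.
move=> s.
have cp : {for s, continuous (fun s : R => u + s *: (v - u))}.
  exact: (cvgD (cvg_cst _) (cvgZ (@cvg_id _ _) (cvg_cst _))).
have cpd : {for s, continuous (fun s : R => dot (u + s *: (v - u)) d)}.
  exact: (continuous_comp cp (@dot_continuousl R d _)).
have cpp : {for s, continuous (fun s : R => dot (u + s *: (v - u)) (u + s *: (v - u)))}.
  exact: (continuous_comp cp (@dotdot_continuous R _)).
have cD : {for s, continuous (fun s : R => dot (u + s *: (v - u)) d * dot (u + s *: (v - u)) d +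
    dot d d * (1 - dot (u + s *: (v - u)) (u + s *: (v - u))))}.
  exact: (cvgD (cvgM cpd cpd) (cvgM (cvg_cst _) (cvgB (cvg_cst _) cpp))).
have ct : {for s, continuous (fun s : R => push_time (u + s *: (v - u)) d)}.
  apply: (cvgM (cvgD (cvgN cpd) _) (cvg_cst _)).
  exact: (continuous_comp cD (@sqrt_continuous R _)).
exact: (cvgD cp (cvgZ ct (cvg_cst d))).
Qed.

Lemma push_time0 u d : S2 u -> d != 0 -> 0 <= dot u d -> push_time u d = 0.
Proof.
move=> u1 d0 ud; rewrite /push_time (u1 : dot u u = 1) subrr mulr0 addr0 sqrtr_sqr ger0_norm//.
by rewrite addNr mul0r.
Qed.

(* Two points of {z in S2 | ev f z <= 0} are joined by pushing their chord out to the sphere. *)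
Lemma connected_spherical_cap f : connected [set z | S2 z /\ ev f z <= 0].
Proof.
set D := [set z | _].
have joined u v : D u -> D v -> exists B : set V, [/\ connected B, B u, B v & B `<=` D].
  move=> [u1 fu] [v1 fv].
  have [d d0 [ud vd fd]] := common_direction u v (- f.1).
  rewrite dotNl oppr_ge0 in fd.
  pose p (s : R) : V := u + s *: (v - u).
  pose c (s : R) : V := p s + push_time (p s) d *: d.
  exists [set c s | s in `[0, 1]%classic]; split.
  - apply: connected_continuous_connected; first exact: segment_connected.
    by apply: continuous_subspaceT; exact: push_path_continuous.
  - exists 0; first by rewrite /= in_itv/= lexx ler01.
    by rewrite /c /p scale0r addr0 push_time0// scale0r addr0.
  - exists 1; first by rewrite /= in_itv/= lexx ler01.
    have p1 : p 1 = v by rewrite /p scale1r addrC subrK.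
    by rewrite /c p1 push_time0// scale0r addr0.
  - move=> z [s]; rewrite /= in_itv/= => /andP[s0 s1] <-.
    have pE : p s = (1 - s) *: u + s *: v.
      by rewrite /p; apply: vec3P; rewrite !coordE; ring.
    have pp : dot (p s) (p s) <= 1.
      have s01 : 0 <= s <= 1 by rewrite s0 s1.
      rewrite pE (le_trans (dotdot_convex u v s01))//.
      by rewrite (u1 : dot u u = 1) (v1 : dot v v = 1); lra.
    have [t0 c1] := push_timeP pp d0; split => //.
    have fp : ev f (p s) <= 0 by rewrite pE ev_comb; [nra|ring].
    move: fp; rewrite /ev /c (dotDr f.1 (p s)) (dotZr _ f.1 d).
    by set t := push_time _ _ in t0 *; nra.
have [[u Du]|D0] := pselect (D !=set0); last first.
  rewrite (_ : D = set0); first exact: connected0.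
  by apply/seteqP; split => // z Dz; apply: D0; exists z.
have [K hK] : exists K : V -> set V, forall v, D v -> [/\ connected (K v), K v u, K v v & K v `<=` D].
  have /choice[K hK] : forall v, exists K, D v -> [/\ connected K, K u, K v & K `<=` D].
    move=> v; have [Dv|nDv] := pselect (D v); last by exists set0.
    by have [K hK] := joined u v Du Dv; exists K.
  by exists K.
rewrite (_ : D = \bigcup_(v in D) K v).
  apply: bigcup_connected; first by exists u => v /hK[].
  by move=> v /hK[].
apply/seteqP; split => z; first by move=> Dz; exists z => //; have [] := hK z Dz.
by move=> [v Dv Kz]; have [_ _ _] := hK v Dv; apply.
Qed.

(** Caps in A and caps outside A do not meet in {f <= 0}, so the two complements cover this
    connected set; they intersect in the core, and [connected_of_union] applies. *)
Lemma connected_subcore (I : finType) (F : I -> V * R) (A : pred I) f :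
  inner F f -> connected (core F) -> core F !=set0 ->
  (forall i j z, A i -> ~~ A j -> S2 z -> ev f z <= 0 -> 0 < ev (F i) z -> ev (F j) z <= 0) ->
  connected [set z | [/\ S2 z, ev f z <= 0 & forall i, A i -> ev (F i) z <= 0]].
Proof.
move=> fin con [c Cc] AF.
pose X (A : pred I) := [set z | [/\ S2 z, ev f z <= 0 & forall i, A i -> ev (F i) z <= 0]].
have cX B : closed (X B).
  rewrite (_ : X B = S2 `&` [set z | ev f z <= 0] `&`
      \bigcap_(i in [set i | B i]) [set z | ev (F i) z <= 0]).
    apply: closedI; first apply: closedI.
    - exact: closed_sphere.
    - by apply: closed_nonpos; exact: ev_continuous.
    - by apply: closed_bigI => i _; apply: closed_nonpos; exact: ev_continuous.
  by apply/seteqP; split => z; [case|case=> -[]].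
have XY : X A `|` X (predC A) = [set z | S2 z /\ ev f z <= 0].
  apply/seteqP; split => z; first by case=> -[].
  move=> [z1 fz].
  have [h|/existsNP[i /not_implyP[Ai /negP]]] := pselect (forall i, A i -> ev (F i) z <= 0); first by left.
  rewrite -ltNge => iz; right; split => // j /= Aj; exact: (AF i j).
have XI : X A `&` X (predC A) = core F.
  apply/seteqP; split => z.
    move=> [[z1 fz hA] [_ _ hC]]; split => // i.
    by case Ai : (A i); [exact: hA|apply: hC; rewrite /= Ai].
  by move=> Cz; have fz := fin z Cz; have [z1 hz] := Cz; split; split.
apply: (connected_of_union (cX A) (cX (predC A))).
- by rewrite XY; exact: (@connected_spherical_cap f).
- by rewrite XI.
- by rewrite XI; exists c.
Qed.

End spherical_cap_connected.

(** * Area of a union of caps *)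

Section union_of_caps.
Local Open Scope ereal_scope.
Context (R : realType).
Notation V := 'rV[R]_3.
Notation S2 := (sphere2 R).

Definition caps (I : finType) (A : pred I) (a : I -> V) (c : I -> R) : set V :=
  [set z | exists2 i, A i & (c i < dot (a i) z)%R].

Lemma borel3_caps (I : finType) (A : pred I) (a : I -> V) (c : I -> R) : borel3 (caps A a c).
Proof. by apply: (borel3_bigcup A (F := fun i => cap (a i) (c i))) => i; exact: borel3_cap. Qed.

Lemma area_setUD (A B : set V) : borel3 A -> borel3 B ->
  area (A `|` B) = area A + area (B `\` A).
Proof.
move=> mA mB; rewrite -areaU//; last by move=> z _ Az [].
  by apply: eq_area => z _; split => [[Az|Bz]|[Az|[Bz _]]];
    [left|have [Az|nAz] := pselect (A z); [left|right]|left|right].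
exact: borel3D.
Qed.

Lemma area_setU_le (A B : set V) : borel3 A -> borel3 B -> area (A `|` B) <= area A + area B.
Proof.
move=> mA mB; rewrite area_setUD// leeD2l// le_area//; first exact: borel3D.
by move=> z _ [].
Qed.

Section planar.
Variables (I : finType) (a b : I -> V) (c : I -> R).

(** The common complement lies in a plane and has area zero, so the caps around the a_i already have
    full area. *)
Lemma caps_planar n (h : R) : n != 0%R ->
  (forall z, S2 z -> (forall i, dot (a i) z <= c i)%R -> dot n z = h) ->
  area (caps predT b c) <= area (caps predT a c).
Proof.
move=> n0 hC; have mU x := borel3_caps predT x c; have mP := borel3_plane n h.
apply: (@le_trans _ _ (area (caps predT a c `|` [set z | dot n z = h]))).
  apply: le_area => //; first exact: borel3U.
  move=> z z1 _; have [h1|] := pselect (caps predT a c z); first by left.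
  move=> h1; right; apply: hC => // i; rewrite leNgt; apply/negP => iz.
  by apply: h1; exists i.
by rewrite (le_trans (area_setU_le _ _))// area_plane// adde0.
Qed.

Lemma caps_pair i j : (forall k, k = i \/ k = j) -> S2 (a i) -> S2 (a j) -> S2 (b i) -> S2 (b j) ->
  (dot (a i) (a j) <= dot (b i) (b j))%R ->
  area (caps predT b c) <= area (caps predT a c).
Proof.
move=> hk ai aj bi bj ab.
have E x : caps predT x c = cap (x i) (c i) `|` cap (x j) (c j).
  apply/seteqP; split => z; last by case=> hz; [exists i|exists j].
  by move=> [k _ kz]; have [<-|<-] := hk k; [left|right].
by rewrite !E; exact: area_capU_le.
Qed.

End planar.

Definition caps_monotone (n : nat) := forall (I : finType) (a b : I -> V) (c : I -> R),
  (#|I| <= n)%N -> (forall i, S2 (a i)) -> (forall i, S2 (b i)) ->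
  (forall i j, dot (a i) (a j) <= dot (b i) (b j))%R ->
  connected [set z | S2 z /\ forall i, (dot (a i) z <= c i)%R] ->
  area (caps predT b c) <= area (caps predT a c).

Section step.
Variables (n : nat) (IH : caps_monotone n).
Variables (I : finType) (a b : I -> V) (c : I -> R).
Hypothesis (In : (#|I| <= n.+1)%N).
Hypotheses (a1 : forall i, S2 (a i)) (b1 : forall i, S2 (b i)).
Hypothesis ab : forall i j, (dot (a i) (a j) <= dot (b i) (b j))%R.
Let F i := (a i, c i).
Hypothesis Ccon : connected (core F).
Hypothesis C0 : core F !=set0.

Lemma ev_cap i z : (0 < ev (F i) z)%R = (c i < dot (a i) z)%R.
Proof. by rewrite /ev/= subr_gt0. Qed.

Lemma ev_capN i z : (ev (F i) z <= 0)%R = (dot (a i) z <= c i)%R.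
Proof. by rewrite /ev/= subr_le0. Qed.

Lemma caps_subfamily (A : pred I) (x y : V) (h : R) : (#|A| < n)%N ->
  S2 x -> S2 y -> (forall i, dot x (a i) <= dot y (b i))%R ->
  inner F (x, h) ->
  (forall i j z, A i -> ~~ A j -> S2 z -> (dot x z <= h)%R -> (c i < dot (a i) z)%R ->
    (dot (a j) z <= c j)%R) ->
  area (cap y h `|` caps A b c) <= area (cap x h `|` caps A a c).
Proof.
move=> An x1 y1 xy xin AF.
(* [None] is the index of the additional cap. *)
pose J : finType := option {i : I | A i}.
pose ext (v : V) (w : I -> V) (k : J) := if k is Some i then w (val i) else v.
pose e (k : J) := if k is Some i then c (val i) else h.
have E v w : cap v h `|` caps A w c = caps predT (ext v w) e.
  apply/seteqP; split => z.
    case=> [vz|[i Ai iz]]; first by exists None.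
    by exists (Some (exist _ i Ai)).
  by move=> [[[i Ai]|] _ /= iz]; [right; exists i|left].
rewrite !E; apply: IH.
- by rewrite card_option card_sig.
- by case=> [i|]; [exact: a1|].
- by case=> [i|]; [exact: b1|].
- case=> [i|] [j|] /=; [exact: ab|by rewrite dotC (dotC (b _)); exact: xy|exact: xy|].
  by rewrite (x1 : dot x x = 1%R) (y1 : dot y y = 1%R).
- rewrite [X in connected X](_ : _ = [set z | [/\ S2 z, (ev (x, h) z <= 0)%R & forall i, A i -> (ev (F i) z <= 0)%R]]); last first.
    apply/seteqP; split => z.
      move=> [z1 hz]; split => //; first by rewrite /ev/= subr_le0; exact: (hz None).
      by move=> i Ai; rewrite ev_capN; exact: (hz (Some (exist _ i Ai))).
    move=> [z1 fz hz]; split => // -[[i Ai]|] /=; last by move: fz; rewrite /ev/= subr_le0.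
    by rewrite -ev_capN; exact: hz.
  apply: (connected_subcore (A := A) xin Ccon C0) => i j z Ai Aj z1 fz; rewrite ev_cap ev_capN => iz; apply: (AF i j z) => //.
  by move: fz; rewrite /ev/= subr_le0.
Qed.

(** Splitting off the cap j is additive around the a_i and subadditive around the b_i, and the other
    caps fall under the induction hypothesis. *)
Lemma caps_separate : separate_cap F -> area (caps predT b c) <= area (caps predT a c).
Proof.
move=> [j hj].
pose A : pred I := [pred i | i != j].
pose J : finType := {i : I | A i}.
have E w : caps predT w c = cap (w j) (c j) `|` caps A w c.
  apply/seteqP; split => z.
    move=> [i _ iz]; have [ij|ij] := eqVneq i j; first by left; rewrite -ij.
    by right; exists i.
  by case=> [jz|[i _ iz]]; [exists j|exists i].
have EJ w : caps A w c = caps predT (fun i : J => w (val i)) (fun i => c (val i)).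
  apply/seteqP; split => z; first by move=> [i Ai iz]; exists (exist _ i Ai).
  by move=> [[i Ai] _ iz]; exists i.
have mA w := borel3_caps A w c; have mj v := borel3_cap v (c j).
have disj : area (caps predT a c) = area (cap (a j) (c j)) + area (caps A a c).
  rewrite E areaU// => z z1 jz [i ij iz]; apply: (hj i ij); exists z.
  by rewrite !ev_cap.
rewrite disj E (le_trans (area_setU_le _ _))// leeD//; first by rewrite (area_cap_eq _ (a1 j) (b1 j)).
rewrite !EJ; apply: IH.
- rewrite card_sig; have := cardC1 j; rewrite (_ : #|predC1 j| = #|A|); last by apply: eq_card.
  by move=> ->; have := In; case: #|I|.
- by move=> i; exact: a1.
- by move=> i; exact: b1.
- by move=> i i'; exact: ab.
(* For the zero functional {f <= 0} is the whole sphere, the form of [connected_subcore] used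
   here. *)
- have zin : inner F (0%R, 0%R) by move=> z _; rewrite /ev/= dot0l subr0.
  rewrite [X in connected X](_ : _ = [set z | [/\ S2 z, (ev (0%R : V, 0%R : R) z <= 0)%R & forall i, A i -> (ev (F i) z <= 0)%R]]); last first.
    apply/seteqP; split => z.
      move=> [z1 hz]; split => //; first by rewrite /ev/= dot0l subr0.
      by move=> i Ai; rewrite ev_capN; exact: (hz (exist _ i Ai)).
    by move=> [z1 _ hz]; split => // -[i Ai]; rewrite -ev_capN; exact: hz.
  apply: (connected_subcore (A := A) zin Ccon C0) => i k z Ai; rewrite /A/= negbK => /eqP -> z1 _ iz.
  by rewrite leNgt; apply/negP => jz; apply: (hj i Ai); exists z.
Qed.

(** The cap m contains no point of the core, so around the a_i it is covered and the area of the
    union is exactly that of m plus those of the classes outside m. Around the b_i only an upper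
    bound of this form holds, and that is the direction required. *)
Lemma caps_split3 : split3 F -> area (caps predT b c) <= area (caps predT a c).
Proof.
move=> [f [f0 fin [i [j [k [nij nik njk]]]]]].
pose nu := Num.sqrt (dot f.1 f.1).
have nu0 : (0 < nu)%R by rewrite sqrtr_gt0 dot_gt0.
pose x : V := (nu^-1 *: f.1)%R; pose h := (nu^-1 * f.2)%R.
have x1 : S2 x.
  rewrite /sphere2/= /x dotZl dotZr -(sqr_sqrtr (dot_ge0 f.1)) -/nu; field.
  by rewrite gt_eqF.
have fE z : (dot x z <= h)%R = (ev f z <= 0)%R.
  rewrite -subr_le0 (_ : (dot x z - h = nu^-1 * ev f z)%R); last by rewrite /x /h /ev dotZl; ring.
  by rewrite pmulr_rle0// invr_gt0.
have xin : inner F (x, h).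
  by move=> z /fin; rewrite -fE /ev/= subr_le0.
have [y y1 xy] := kirszbraun_sphere a1 b1 ab x1.
have sym := linked_connect_sym F f.
pose A1 : pred I := connect (linked F f) i.
pose A2 : pred I := connect (linked F f) j.
(* The third family is all the rest and may consist of several link classes. *)
pose A3 : pred I := [pred l | ~~ A1 l && ~~ A2 l].
have clos l m z : S2 z -> (dot x z <= h)%R -> (c l < dot (a l) z)%R -> (c m < dot (a m) z)%R ->
    connect (linked F f) l m.
  move=> z1; rewrite fE => fz lz mz; apply: connect1; apply/asboolP; exists z.
  by rewrite !ev_cap.
have disj12 l : A1 l -> A2 l -> False.
  by move=> l1 l2; apply: nij; apply: connect_trans l1 _; rewrite sym.
have cls (A : pred I) : (forall l m, connect (linked F f) l m -> A l -> A m) ->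
    (forall l m z, A l -> ~~ A m -> S2 z -> (dot x z <= h)%R -> (c l < dot (a l) z)%R ->
      (dot (a m) z <= c m)%R).
  move=> Acl l m z Al nAm z1 fz lz; rewrite leNgt; apply/negP => mz.
  by move/negP: nAm; apply; apply: Acl Al; exact: clos fz lz mz.
have cl1 l m : connect (linked F f) l m -> A1 l -> A1 m by move=> lm l1; exact: connect_trans l1 lm.
have cl2 l m : connect (linked F f) l m -> A2 l -> A2 m by move=> lm l1; exact: connect_trans l1 lm.
have cl3 l m : connect (linked F f) l m -> A3 l -> A3 m.
  move=> lm /andP[l1 l2]; rewrite sym in lm; apply/andP; split.
    by apply: contra l1; exact: cl1.
  by apply: contra l2; exact: cl2.
(* Each family misses two of i, j, k, so with m added it has at most n members. *)
have small (A : pred I) l m : l != m -> ~~ A l -> ~~ A m -> (#|A| < n)%N.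
  move=> lm nl nm; rewrite -ltnS (leq_trans _ In)//.
  have : (#|A| + #|[set l; m]%SET| <= #|I|)%N.
    rewrite -cardUI [X in (_ + X)%N]eq_card0 ?addn0 ?max_card// => p.
    rewrite !inE; apply/negP => /andP[Ap /orP[]/eqP pE]; [move: nl|move: nm]; rewrite -pE => /negP; exact.
  by rewrite cards2 lm addn2.
have A1i : A1 i by exact: connect0.
have A2j : A2 j by exact: connect0.
have nij' : i != j by apply/eqP => E; apply: nij; rewrite E.
have nik' : i != k by apply/eqP => E; apply: nik; rewrite E.
have njk' : j != k by apply/eqP => E; apply: njk; rewrite E.
have s1 : (#|A1| < n)%N by apply: (small A1 j k) => //; exact/negP.
have A2i : ~~ A2 i by apply/negP => ji; apply: nij; rewrite sym.
have s2 : (#|A2| < n)%N by apply: (small A2 i k) => //; exact/negP.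
have s3 : (#|A3| < n)%N by apply: (small A3 i j) => //; rewrite /A3/= ?A1i ?A2j ?andbF.
have mX := borel3_cap x h; have mY := borel3_cap y h.
have mU (A : pred I) w := borel3_caps A w c.
have mD (A : pred I) w v := borel3D (mU A w) (borel3_cap v h).
have W (A : pred I) : (forall l m, connect (linked F f) l m -> A l -> A m) -> (#|A| < n)%N ->
    area (caps A b c `\` cap y h) <= area (caps A a c `\` cap x h).
  move=> Acl An; have := caps_subfamily An x1 y1 xy xin (cls A Acl).
  by rewrite !area_setUD// (area_cap_eq _ x1 y1) leeD2lE// area_fin_num.
have cover w : caps predT w c = caps A1 w c `|` (caps A2 w c `|` caps A3 w c).
  apply/seteqP; split => z.
    move=> [l _ lz]; case l1 : (A1 l); first by left; exists l.
    right; case l2 : (A2 l); first by left; exists l.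
    by right; exists l => //; rewrite /A3/= l1 l2.
  by move=> [|[|]] [l _ lz]; exists l.
have Ub : area (caps predT b c) <= area (cap y h) + (area (caps A1 b c `\` cap y h) +
    (area (caps A2 b c `\` cap y h) + area (caps A3 b c `\` cap y h))).
  apply: (@le_trans _ _ (area (cap y h `|` ((caps A1 b c `\` cap y h) `|`
      ((caps A2 b c `\` cap y h) `|` (caps A3 b c `\` cap y h)))))).
    apply: le_area => //; first by do !apply: borel3U.
    move=> z _; rewrite cover; have [yz|nyz] := pselect (cap y h z); first by left.
    by move=> [|[|]] hz; right; [left|right; left|right; right].
  rewrite (le_trans (area_setU_le _ _))//; first by do !apply: borel3U.
  rewrite leeD2l// (le_trans (area_setU_le _ _))//; first exact: borel3U.
  by rewrite leeD2l// area_setU_le.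
have Ua : area (caps predT a c) = area (cap x h) + (area (caps A1 a c `\` cap x h) +
    (area (caps A2 a c `\` cap x h) + area (caps A3 a c `\` cap x h))).
  have sep (A B : pred I) z : (forall l m, connect (linked F f) l m -> A l -> A m) ->
      (forall l, A l -> B l -> False) -> S2 z ->
      (caps A a c `\` cap x h) z -> (caps B a c `\` cap x h) z -> False.
    move=> Acl AB z1 [[l Al lz] /negP xz] [[m Bm mz] _]; rewrite -leNgt in xz.
    by apply: (AB m) => //; apply: Acl Al; exact: clos xz lz mz.
  rewrite -areaU//; last first.
    by move=> z z1; apply: sep => // l l2 /andP[_]; rewrite l2.
  rewrite -areaU//; [|exact: borel3U|]; last first.
    move=> z z1 h1 [h2|h3]; first by apply: (sep A1 A2 z).
    by apply: (sep A1 A3 z) => // l l1 /andP[]; rewrite l1.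
  rewrite -areaU//; [|by do !apply: borel3U|]; last first.
    by move=> z z1 xz [|[|]] [].
  apply: eq_area => z z1; rewrite cover; split.
    have [xz|nxz] := pselect (cap x h z); first by left.
    by move=> [|[|]] hz; right; [left|right; left|right; right].
  move=> [xz|[[hz _]|[[hz _]|[hz _]]]]; [|by left|by right; left|by right; right].
  rewrite -cover; have [Cz|[l lz]] := core_or_cap F z1; last by exists l; rewrite // -ev_cap.
  by have := xin z Cz; rewrite /ev/= leNgt subr_gt0 xz.
rewrite Ua (le_trans Ub)// (area_cap_eq _ y1 x1) leeD2l// leeD//; first exact: W.
by rewrite leeD//; exact: W.
Qed.

End step.

Theorem area_caps_le n : caps_monotone n.
Proof.
elim: n => [|n IH] I a b c In a1 b1 ab con.
  apply: le_area; [exact: borel3_caps|exact: borel3_caps|] => z _ [i].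
  by have := leq_trans (max_card (pred1 i)) In; rewrite card1.
pose F i := (a i, c i).
have conF : connected (core F).
  rewrite (_ : core F = [set z | S2 z /\ forall i, (dot (a i) z <= c i)%R])//.
  by apply/seteqP; split => z [z1 hz]; split => // i; have := hz i; rewrite /ev/= subr_le0.
have [full|/existsNP[f /not_implyP[f0 hf]]] :=
    pselect (forall f, f.1 != 0%R -> exists2 z, core F z & ev f z <> 0%R); last first.
  apply: (@caps_planar I a b c f.1 f.2 f0) => z z1 hz; apply: contrapT => nz; apply: hf.
  exists z; first by split => // i; rewrite /ev/= subr_le0.
  by rewrite /ev => /eqP; rewrite subr_eq0 => /eqP.
have C0 : core F !=set0.
  have [|z Cz _] := full (vec3 1 0 0, 0)%R; last by exists z.
  by apply/eqP => /(congr1 (@cx R)); rewrite !coordE => /eqP; rewrite oner_eq0.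
have Fn i : (F i).1 != 0%R by exact: (sphere_neq0 (a1 i)).
have [I3|I2] := ltnP 2 #|I|.
  have [h|h] := median_cap Fn conF full I3; first exact: (caps_separate IH In a1 b1 ab conF C0 h).
  exact: (caps_split3 IH In a1 b1 ab conF C0 h).
have [/card0_eq I0|/card_gt0P[i _]] := posnP #|I|.
  apply: le_area; [exact: borel3_caps|exact: borel3_caps|] => z _ [i].
  by have := I0 i; rewrite inE.
(* A single cap is treated as a pair with j = i. *)
have [j hj] : exists j, forall k, k = i \/ k = j.
  have [/existsP[j ji]|/existsPn h] := boolP [exists j, j != i]; last first.
    by exists i => k; left; apply/eqP; have := h k; rewrite negbK.
  exists j => k; apply: contrapT => /not_orP[/eqP ki /eqP kj].
  have : (#|[set i; j; k]%SET| <= 2)%N by rewrite (leq_trans (max_card _)).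
  by rewrite -finset.setUA cardsU1 cards2 !inE negb_or (eq_sym i j) ji (eq_sym i k) ki (eq_sym j) kj.
exact: (@caps_pair I a b c i j hj).
Qed.

End union_of_caps.

(** * Disks *)

Section disks.
Context (R : realType).
Notation V := 'rV[R]_3.
Notation S2 := (sphere2 R).

Lemma ler_acos : {in `[-1, 1]%R &, {mono (@acos R) : x y /~ (x <= y)%R}}.
Proof.
move=> x y; rewrite !in_itv/= => hx hy.
have I (z : R) : -1 <= z <= 1 -> acos z \in `[0, pi]%R.
  by move=> hz; rewrite in_itv/= acos_ge0// acos_lepi.
by rewrite !leNgt -(ltr_cos (I _ hy) (I _ hx)) !acosK// in_itv.
Qed.

Lemma sphere_dot_itv (u v : V) : S2 u -> S2 v -> dot u v \in `[-1, 1]%R.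
Proof. by move=> u1 v1; rewrite in_itv/= sphere_dot_geN1// sphere_dot_le1. Qed.

(* The complement of a disk of radius r is the cap of level [level r] around the
   antipode; it is empty as soon as r >= pi. *)
Definition level (r : R) : R := if r < pi then - cos r else 1.

Lemma disk_level (p z : V) r : S2 p -> S2 z -> 0 < r ->
  (geodesic_dist p z <= r) = (dot (- p) z <= level r).
Proof.
move=> p1 z1 r0; have hpz := sphere_dot_itv p1 z1; rewrite dotNl /level.
have [rpi|rpi] := ltP r pi.
  have rI : r \in `[0, pi]%R by rewrite in_itv/= !ltW.
  rewrite /geodesic_dist -{1}(cosK rI) ler_acos//; first by rewrite lerN2.
  by rewrite in_itv/= cos_geN1 cos_le1.
move: hpz; rewrite in_itv/= => hpz; rewrite (le_trans (acos_lepi hpz) rpi).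
by apply/esym; case/andP: hpz; lra.
Qed.

Lemma disk_intersectionE (k : nat) (p : 'I_k -> V) (r : 'I_k -> R) :
  (forall i, S2 (p i)) -> (forall i, 0 < r i) ->
  disk_intersection p r = [set z | S2 z /\ forall i, dot (- p i) z <= level (r i)].
Proof.
move=> p1 r0; apply/seteqP; split => z [z1 hz]; split => // i.
  by rewrite -disk_level//; have [] := hz i Logic.I.
by move=> _; split => //; rewrite disk_level.
Qed.

Lemma area_disk_intersection (k : nat) (p : 'I_k -> V) (r : 'I_k -> R) :
  (forall i, S2 (p i)) -> (forall i, 0 < r i) ->
  (area (caps predT (fun i => - p i)%R (fun i => level (r i))) +
   area (disk_intersection p r) = area [set: V])%E.
Proof.
move=> p1 r0; set U := caps _ _ _.
have mU : borel3 U by exact: borel3_caps.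
rewrite -[RHS](_ : area (U `|` ~` U) = _); last by rewrite setUv.
rewrite areaU//; last exact: borel3C.
congr (_ + _)%E.
apply: eq_area => z z1; rewrite disk_intersectionE//; split.
  by move=> [_ hz] [i _]; rewrite ltNge hz.
by move=> nU; split => // i; rewrite leNgt; apply/negP => iz; apply: nU; exists i.
Qed.

End disks.

Theorem corollary1p3 (R : realType) (k : nat)
    (p q : 'I_k -> 'rV[R]_3) (r : 'I_k -> R)
    (hp : forall i, sphere2 R (p i))
    (hq : forall i, sphere2 R (q i))
    (hr : forall i, 0 < r i)
    (hd : forall i j,
        geodesic_dist (q i) (q j) <= geodesic_dist (p i) (p j))
    (hconn : connected (disk_intersection p r)) :
  (area (disk_intersection p r) <= area (disk_intersection q r))%E.
Proof.
have opp_sphere (x : 'rV[R]_3) : sphere2 R x -> sphere2 R (- x).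
  by move=> x1; rewrite /sphere2/= dotNl dotNr opprK.
have pq : (area (caps predT (fun i => - q i)%R (fun i => level (r i))) <=
           area (caps predT (fun i => - p i)%R (fun i => level (r i))))%E.
  apply: (@area_caps_le R k) => [|i|i|i j|].
  - by rewrite card_ord.
  - exact: opp_sphere.
  - exact: opp_sphere.
  - by rewrite !dotNl !dotNr !opprK -ler_acos ?sphere_dot_itv//; exact: hd.
  - by rewrite -disk_intersectionE.
set Up := caps _ (fun i => - p i) _ in pq; set Uq := caps _ _ _ in pq.
have fin : area Up \is a fin_num by apply: area_fin_num; exact: borel3_caps.
(* Union and disk intersection share the finite total area, so the inequality between the unions
   reverses for the intersections. *)
rewrite -(leeD2lE _ _ fin) area_disk_intersection// -(area_disk_intersection hq hr).
by rewrite leeD2r.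
Qed.
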